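(* Let $1\le m<n$ and let $\Omega\subset\mathbb C^n$ be a domain. (i) For every $u\in L^1_{\mathrm{loc}}(\Omega)$, the map $a\mapsto\iota_a(u)$ is lower semicontinuous on $\Omega$. (ii) For fixed $a\in\Omega$, the map $u\mapsto\iota_a(u)$ is not lower semicontinuous with respect to the $L^1_{\mathrm{loc}}(\Omega)$-topology, even when restricted to $\mathrm{SH}_m(\Omega)$. (iii) The interval $I_u(K)$ need not be open, even when $u$ is $m$-subharmonic and $K$ is a singleton; that is, there exist a domain $\Omega\subset\mathbb C^n$, a function $u\in\mathrm{SH}_m(\Omega)$ and a point $a\in\Omega$ such that $I_u(\{a\})$ is not an open subset of $(0,\infty)$.
   Context: Let $\beta=dd^c|z|^2$ on $\mathbb C^n$. A real constant-coefficient $(1,1)$-form $\alpha$ is $m$-positive if $\alpha^k\wedge\beta^{n-k}\ge0$ for $1\le k\le m$. For an open set $\Omega\subset\mathbb C^n$, a locally integrable, upper semicontinuous function $u:\Omega\to[-\infty,\infty)$ is $m$-subharmonic, written $u\in \mathrm{SH}_m(\Omega)$, if it is subharmonic and $dd^c u\wedge\alpha_1\wedge\cdots\wedge\alpha_{m-1}\wedge\beta^{n-m}\ge0$ (as a current) for all constant-coefficient $m$-positive $(1,1)$-forms $\alpha_j$. For $u\in L^1_{\mathrm{loc}}(\Omega)$ and a compact set $K\Subset\Omega$, $$I_u(K)=\{p>0: |u|^p\in L^1(U)\text{ for some open }U\text{ with }K\Subset U\Subset\Omega\},\qquad \iota_K(u)=\sup I_u(K)\in(0,+\infty],$$ and for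 $a\in\Omega$, $\iota_a(u)=\iota_{\{a\}}(u)$. *)

(* Defs.v *)
From HB Require Import structures.
From mathcomp Require Import all_boot all_order all_algebra.
From mathcomp Require Import complex.
From mathcomp Require Import all_classical all_reals all_analysis.
From mathcomp Require Import measurable_realfun.
Set Implicit Arguments. Unset Strict Implicit. Unset Printing Implicit Defensive.
Import Order.TTheory GRing.Theory Num.Theory.
Import numFieldNormedType.Exports.
Local Open Scope classical_set_scope.
Local Open Scope ring_scope.

(* Product sigma-algebra on row vectors, as the library does for tuples; over
   the reals it is the Borel sigma-algebra of 'rV[R]_n. *)
Section rV_measurable.
Context {d} {T : measurableType d} (n : nat).

Let coord (i : 'I_n) (x : 'rV[T]_n) : T := x ord0 i.

Let rV_set0 : g_sigma_preimage coord set0.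
Proof. exact: sigma_algebra0. Qed.

Let rV_setC A : g_sigma_preimage coord A -> g_sigma_preimage coord (~` A).
Proof. exact: sigma_algebraC. Qed.

Let rV_bigcup (F : (set 'rV[T]_n)^nat) : (forall i, g_sigma_preimage coord (F i)) ->
  g_sigma_preimage coord (\bigcup_i (F i)).
Proof. exact: sigma_algebra_bigcup. Qed.

HB.instance Definition _ := @isMeasurable.Build (measure_tuple_display d)
  'rV[T]_n (g_sigma_preimage coord) rV_set0 rV_setC rV_bigcup.
End rV_measurable.

(* Lebesgue measure on R^n as the n-fold product of lebesgue_measure. *)
Section lebesgue_tuple.
Local Open Scope ereal_scope.
Context {R : realType}.
Local Notation RM := (measurableTypeR R).

Section cons.
Variables (n : nat) (m : {sigma_finite_measure set (n.-tuple RM) -> \bar R}).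

Definition tuple_cons (p : RM * n.-tuple RM) : n.+1.-tuple RM :=
  [the n.+1.-tuple RM of p.1 :: p.2].

Lemma measurable_tuple_cons : measurable_fun setT tuple_cons.
Proof. exact: measurable_cons. Qed.

Definition lebesgue_cons : set (n.+1.-tuple RM) -> \bar R :=
  pushforward (@lebesgue_measure R \x m) tuple_cons.

Let cons_pushforward : {measure set (n.+1.-tuple RM) -> \bar R} :=
  measure_function_pushforward__canonical__measure_function_Measure
    (@lebesgue_measure R \x m) measurable_tuple_cons.

HB.instance Definition _ := isMeasure.Build _ _ _ lebesgue_cons
  (measure0 cons_pushforward) (measure_ge0 cons_pushforward)
  (@measure_semi_sigma_additive _ _ _ cons_pushforward).

Lemma lebesgue_cons_sigma_finite : sigma_finite setT lebesgue_cons.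
Proof.
have /sigma_finiteP [F [FT Fnd Foo]] := sigma_finiteT (@lebesgue_measure R).
have /sigma_finiteP [G [GT Gnd Goo]] := sigma_finiteT m.
pose h (t : n.+1.-tuple RM) : RM * n.-tuple RM :=
  (thead t, [tuple of behead t]).
have mh : measurable_fun setT h.
  apply/measurable_fun_pair => /=; [exact: measurable_tnth|exact: measurable_behead].
have hK p : h (tuple_cons p) = p.
  by case: p => x t; rewrite /h /=; congr pair; exact/val_inj.
exists (fun i => h @^-1` (F i `*` G i)) => [|i].
- apply/seteqP; split=> // t _.
  have : [set: RM] (h t).1 by [].
  have : [set: n.-tuple RM] (h t).2 by [].
  rewrite FT GT => -[j _ Gj] [i _ Fi]; exists (maxn i j) => //; split.
  + by move: Fi; apply/subsetPset; apply: Fnd; exact: leq_maxl.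
  + by move: Gj; apply/subsetPset; apply: Gnd; exact: leq_maxr.
- have [mF Fi] := Foo i; have [mG Gi] := Goo i; split.
    by rewrite -[X in measurable X]setTI; apply: mh => //; exact: measurableX.
  rewrite /lebesgue_cons /pushforward -comp_preimage.
  rewrite (_ : h \o tuple_cons = id); last exact/funext.
  by rewrite preimage_id product_measure1E// lte_mul_pinfty// ge0_fin_numE.
Qed.

HB.instance Definition _ := Measure_isSigmaFinite.Build _ _ _
  lebesgue_cons lebesgue_cons_sigma_finite.

Definition lebesgue_cons_sf :
  {sigma_finite_measure set (n.+1.-tuple RM) -> \bar R} := lebesgue_cons.

End cons.

Fixpoint lebesgue_tuple (n : nat) :
    {sigma_finite_measure set (n.-tuple RM) -> \bar R} :=
  if n is n'.+1 return {sigma_finite_measure set (n.-tuple RM) -> \bar R}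
  then lebesgue_cons_sf (lebesgue_tuple n') else dirac [tuple].

End lebesgue_tuple.

Section lebesgue_rV.
Context {R : realType} (n : nat).
Local Notation RM := (measurableTypeR R).

Definition row_of_tuple (t : n.-tuple RM) : 'rV[R]_n := \row_i tnth t i.

Lemma measurable_row_of_tuple : measurable_fun setT row_of_tuple.
Proof.
move=> _ Y mY; rewrite setTI.
have -> : measurable (row_of_tuple @^-1` Y) =
    g_sigma_preimage (fun i (t : n.-tuple RM) => row_of_tuple t ord0 i)
      (row_of_tuple @^-1` Y).
  rewrite /measurable /=; congr (g_sigma_preimage _ _).
  by apply/funext => i; apply/funext => t; rewrite mxE.
rewrite (g_sigma_preimage_comp (fun i (x : 'rV[R]_n) => x ord0 i)).
by exists Y => //; rewrite setTI.
Qed.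

Definition lebesgue_rV : {measure set 'rV[R]_n -> \bar R} :=
  measure_function_pushforward__canonical__measure_function_Measure
    (lebesgue_tuple n) measurable_row_of_tuple.

End lebesgue_rV.

(* C^n is R^(2n) with coordinates (x_1, y_1, ..., x_n, y_n), z_j = x_j + i y_j *)
Notation Cspace R n := ('rV[R]_(n.*2)).

Section coordinates.
Variable n : nat.

Lemma xidx_subproof (j : 'I_n) : (j.*2 < n.*2)%N.
Proof. by rewrite ltn_double. Qed.

Lemma yidx_subproof (j : 'I_n) : (j.*2.+1 < n.*2)%N.
Proof. by rewrite ltn_Sdouble. Qed.

Definition xidx (j : 'I_n) : 'I_(n.*2) := Ordinal (xidx_subproof j).
Definition yidx (j : 'I_n) : 'I_(n.*2) := Ordinal (yidx_subproof j).

End coordinates.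

(* Constant-coefficient complex-valued differential forms on C^n: if the
   elements of S are i_1 < ... < i_k, then alpha S is the coefficient of alpha
   on dt_{i_1} /\ ... /\ dt_{i_k}, where t_0 = x_1, t_1 = y_1, t_2 = x_2, ... *)
Section forms.
Context {R : realType} {n : nat}.
Local Notation C := R[i].

Definition cform := {ffun {set 'I_(n.*2)} -> C^o}.

Definition wedge (f g : cform) : cform :=
  [ffun S : {set 'I_(n.*2)} => \sum_(A : {set 'I_(n.*2)} | A \subset S)
    (-1) ^+ #|[pred p : 'I_(n.*2) * 'I_(n.*2) |
               [&& p.1 \in A, p.2 \in S :\: A & (p.2 < p.1)%N]]|
    * f A * g (S :\: A)].

Definition form1 : cform := [ffun S : {set 'I_(n.*2)} => (S == finset.set0)%:R].

Definition wedge_exp (f : cform) (k : nat) : cform := iter k (wedge f) form1.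

Definition dcoord (i : 'I_(n.*2)) : cform := [ffun S : {set 'I_(n.*2)} => (S == [set i]%SET)%:R].

Definition dz (j : 'I_n) : cform := dcoord (xidx j) + 'i%C *: dcoord (yidx j).
Definition dzbar (j : 'I_n) : cform := dcoord (xidx j) - 'i%C *: dcoord (yidx j).

Definition form11 (a : 'M[C]_n) : cform :=
  \sum_j \sum_k a j k *: wedge (dz j) (dzbar k).

(* the dt_i being real, a form is real iff its coefficients are *)
Definition real_form (alpha : cform) := forall S, alpha S \is Num.real.

Definition real_form11 (alpha : cform) :=
  real_form alpha /\ exists a : 'M[C]_n, alpha = form11 a.

(* coefficient of the volume form dx_1 /\ dy_1 /\ ... /\ dx_n /\ dy_n *)
Definition top_coef (alpha : cform) : C := alpha [set: 'I_(n.*2)]%SET.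

End forms.
Arguments cform : clear implicits.

Section ddc.
Context {R : realType} {n : nat}.
Local Notation C := R[i].
Implicit Types (phi : Cspace R n -> R) (x : Cspace R n).

Definition partial (i : 'I_(n.*2)) phi : Cspace R n -> R :=
  fun x => 'D_(delta_mx ord0 i) phi x.

(* d^2 phi / dz_j dzbar_k, with d/dz = (d/dx - i d/dy) / 2 and
   d/dzbar = (d/dx + i d/dy) / 2 *)
Definition levi phi x : 'M[C]_n := \matrix_(j, k)
  (4^-1 * (partial (xidx j) (partial (xidx k) phi) x +
           partial (yidx j) (partial (yidx k) phi) x) +i*
   (4^-1 * (partial (xidx j) (partial (yidx k) phi) x -
            partial (yidx j) (partial (xidx k) phi) x)))%C.

(* d^c = i (dbar - d), so that dd^c = 2 i d dbar *)
Definition ddc phi x : cform R n := (2 * 'i)%C *: form11 (levi phi x).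

Lemma is_derive_coord (i k : 'I_(n.*2)) (x : Cspace R n) :
  is_derive x (delta_mx ord0 i) (fun z : Cspace R n => z ord0 k) (k == i)%:R.
Proof.
have H : (fun h : R => h^-1 *: ((h *: (delta_mx ord0 i : Cspace R n) + x) ord0 k - x ord0 k))
           @ 0^' --> ((k == i)%:R : R).
  apply: cvg_near_cst; near=> h.
  rewrite !mxE eqxx /= addrK /GRing.scale /= mulrA mulVf ?mul1r//.
  near: h; exact: nbhs_dnbhs_neq.
apply: DeriveDef; first by apply/cvg_ex; exists (k == i)%:R; exact: H.
exact/cvg_lim.
Unshelve. all: by end_near.
Qed.

Definition sqnorm (z : Cspace R n) : R := \sum_i z ord0 i ^+ 2.

Lemma partial_sqnorm (i : 'I_(n.*2)) : partial i sqnorm = fun x => x ord0 i *+ 2.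
Proof.
apply/funext => x; rewrite /partial.
have -> : sqnorm = \sum_k (fun z : Cspace R n => z ord0 k ^+ 2).
  by apply/funext => z; rewrite fct_sumE.
have dk k := is_derive_coord i k x.
have H k : is_derive x (delta_mx ord0 i) (fun z : Cspace R n => z ord0 k ^+ 2)
  ((x ord0 k *+ 2) * (k == i)%:R).
  rewrite (_ : (fun z => _) = (fun z : Cspace R n => z ord0 k) ^+ 2); last first.
    by apply/funext => z; rewrite exprfctE.
  apply: (is_derive_eq (is_deriveX 2 (dk k))).
  by rewrite expr1 /GRing.scale /= mulr_natl.
rewrite derive_sum; last by move=> k; apply: ex_derive; exact: H.
under eq_bigr do rewrite (@derive_val _ _ _ _ _ _ _ (H _)).
rewrite (bigD1 i)//= eqxx mulr1 big1 ?addr0// => k ki.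
by rewrite (negbTE ki) mulr0.
Qed.

Lemma levi_sqnorm x : levi sqnorm x = 1%:M.
Proof.
have pp i j : partial i (partial j sqnorm) x = (j == i)%:R *+ 2.
  rewrite partial_sqnorm /partial.
  have -> : (fun z : Cspace R n => z ord0 j *+ 2) = 2 \*: (fun z : Cspace R n => z ord0 j).
    by apply/funext => z /=; rewrite scaler_nat.
  have dj := is_derive_coord i j x.
  by rewrite deriveZ //= derive_val /GRing.scale /= mulr_natl.
apply/matrixP => j k; rewrite !mxE !pp.
have xx : (xidx k == xidx j) = (k == j).
  by rewrite -!val_eqE /= -!muln2 eqn_pmul2r.
have yy : (yidx k == yidx j) = (k == j).
  by rewrite -!val_eqE /= eqSS -!muln2 eqn_pmul2r.
have yx a b : (yidx a == xidx b) = false.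
  apply/negP => /eqP /(congr1 (odd \o val)) /=; by rewrite !odd_double.
have xy a b : (xidx a == yidx b) = false by rewrite eq_sym yx.
have E : 4^-1 * (1 *+ 2 + 1 *+ 2) = 1 :> R.
  by rewrite -mulrnDr mulVf ?pnatr_eq0.
rewrite xx yy xy yx subrr mulr0 eq_sym.
by case: (j == k); rewrite ?E//= !mul0rn addr0 mulr0.
Qed.

Lemma ddc_sqnorm x : ddc sqnorm x = (2 * 'i)%C *: form11 1%:M.
Proof. by rewrite /ddc levi_sqnorm. Qed.

(* dd^c |z|^2; its coefficients are constant by ddc_sqnorm *)
Definition beta : cform R n := ddc sqnorm 0.

Definition m_positive (m : nat) (alpha : cform R n) :=
  real_form11 alpha /\ forall k, (1 <= k <= m)%N ->
    0 <= top_coef (wedge (wedge_exp alpha k) (wedge_exp beta (n - k))).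

End ddc.

Section functions.
Context {R : realType} {n : nat}.
Local Notation Cn := (Cspace R n).
Local Notation mu := (@lebesgue_rV R (n.*2)).
Implicit Types (Omega K : set Cn) (u : Cn -> \bar R) (phi : Cn -> R).

Definition is_domain Omega := [/\ open Omega, connected Omega & Omega !=set0].

(* Functions on Omega are represented by functions on C^n whose values outside
   Omega are irrelevant. *)
Definition L1loc Omega u := measurable_fun Omega u /\
  forall K, compact K -> K `<=` Omega -> mu.-integrable K u.

(* neighbourhood base of u for the topology of the seminorms
   v |-> \int_K |v|, K a compact subset of Omega *)
Definition L1loc_nbhs Omega u : set_system (Cn -> \bar R) :=
  filter_from [set Ke : set Cn * R | [/\ compact Ke.1, Ke.1 `<=` Omega & 0 < Ke.2]]
    (fun Ke => [set v | (\int[mu]_(x in Ke.1) `|v x - u x| < Ke.2%:E)%E]).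

Definition usc_on Omega u := forall x, Omega x -> (u x < +oo)%E /\
  forall c : R, (u x < c%:E)%E -> \forall y \near x, Omega y -> (u y < c%:E)%E.

(* Euclidean balls: the library norm of 'rV[R]_n is the max norm *)
Definition cball (a : Cn) (r : R) : set Cn :=
  [set x | \sum_i (x ord0 i - a ord0 i) ^+ 2 <= r ^+ 2].

Definition subharmonic Omega u := usc_on Omega u /\
  forall a r, 0 < r -> cball a r `<=` Omega ->
    (u a * mu (cball a r) <= \int[mu]_(x in cball a r) u x)%E.

Definition smooth phi := forall (s : seq 'I_(n.*2)) (x : Cn),
  differentiable (foldr partial phi s) x.

Definition test_function Omega phi := [/\ smooth phi,
  compact (closure [set x | phi x != 0]) &
  closure [set x | phi x != 0] `<=` Omega].

(* dd^c u /\ theta >= 0 as a current of bidegree (n, n), for a real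
   constant-coefficient (n-1, n-1)-form theta:
   <dd^c u /\ theta, phi> = \int u dd^c phi /\ theta *)
Definition ddc_wedge_ge0 Omega u (theta : cform R n) :=
  forall phi, test_function Omega phi -> (forall x, 0 <= phi x) ->
    (0 <= \int[mu]_(x in Omega)
            (u x * (complex.Re (top_coef (wedge (ddc phi x) theta)))%:E))%E.

Definition SH (m : nat) Omega u :=
  [/\ L1loc Omega u, subharmonic Omega u &
      forall alpha : 'I_m.-1 -> cform R n, (forall j, m_positive m (alpha j)) ->
        ddc_wedge_ge0 Omega u
          (wedge (\big[wedge/form1]_(j < m.-1) alpha j)
                 (wedge_exp beta (n - m)))].

Definition I_set Omega u K : set R := [set p | 0 < p /\ exists U : set Cn,
  [/\ open U, K `<=` U, compact (closure U), closure U `<=` Omega &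
      mu.-integrable U (fun x => `|u x| `^ p)%E]].

Definition iota_K Omega u K : \bar R := ereal_sup (EFin @` I_set Omega u K).

Definition iota_at Omega u (a : Cn) : \bar R := iota_K Omega u [set a].

End functions.

(* The library's lower_semicontinuous, for the restriction of f to D and a
   topology given by its neighbourhood systems. *)
Definition lsc_on {R : realType} {X : Type} (D : set X)
    (nb : X -> set_system X) (f : X -> \bar R) := forall x, D x -> forall c : R,
  (c%:E < f x)%E -> \forall y \near nb x, D y -> (c%:E < f y)%E.

(* Main.v *)
(* The counterexample is u(x) = f(|x - a|^2) with
   f(t) = - delta t^(-1/m) / (2m + ln(1 + 1/t)).
   Since f' >= 0 and t f'' + (1 + 1/m) f' >= 0, the smooth functions
   w_k(x) = f(|x - a|^2 + 4^-k), which decrease to u, have dd^c w_k >= 0 against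
   all products of m - 1 constant m-positive forms and beta^(n-m): the radial
   Hessian lies in the closed Garding cone of the hyperbolic polynomial
   alpha |-> alpha^m /\ beta^(n-m), so this is Garding's inequality. The
   sub-mean value property and the positivity of the current pass to the limit
   by dominated convergence, hence u is m-subharmonic.
   On the dyadic shell |x - a| ~ 2^-j, of volume ~ 4^(-jn), |u|^(nm) is of order
   4^(jn) / j^(nm) with nm >= 2, so the sum over j converges; as every power
   beats the logarithm, |u|^p is not integrable near a for p > nm. Thus
   I_u({a}) = (0, nm], which is not open. As delta -> 0, u tends to 0 in L^1_loc
   while iota_a(u) <= nm < +oo = iota_a(0). *)

Require Import Defs.
From HB Require Import structures.
From mathcomp Require Import all_boot all_order all_algebra.
From mathcomp Require Import complex spectral.
From mathcomp Require Import all_classical all_reals all_analysis.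
From mathcomp Require Import measurable_realfun.
From mathcomp Require Import ring lra zify.
Set Implicit Arguments. Unset Strict Implicit. Unset Printing Implicit Defensive.
Import Order.TTheory GRing.Theory Num.Theory.
Import numFieldNormedType.Exports.
Local Open Scope classical_set_scope.
Local Open Scope ring_scope.

(** * Hyperbolic polynomials and Garding's inequality *)

(** The exponent 1/m comes from the smallest admissible dimension n = m + 1, where -t^(-1/m) is the
    radial solution of the m-Hessian equation. For this pure power t f'' + (1 + 1/m) f' vanishes
    identically, so inserting a logarithm could spoil the sign; the constant 2m added to the
    logarithm keeps the expression nonnegative. The hypothesis m < n enters as n >= m + 1, which
    turns that inequality into n f' + m t f'' >= 0.

    Gårding's inequality is called for because the forms alpha_j differ from one another and from
    dd^c w_k, while m-positivity only controls the powers of a single form. It is proved for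
    polynomials x |-> top(o x^m) over a commutative algebra, where multiplying [o] by a vector is a
    directional derivative.

    No Stokes formula is used: both analytic facts rest on integration by parts along coordinate
    lines. Over a large box it moves the two derivatives of a test function onto w_k, one Hessian
    entry at a time; over a ball, with (|x - b|^2 - rho^2) / 2 as one factor, it gives the sub-mean
    value property. *)

Section half_plane.
Context {R : realType}.
Local Notation C := R[i].
Implicit Types (z w s t : C) (rs : seq C) (p : {poly C}).

Definition lower_roots p := forall z, root p z -> complex.Im z < 0.

Lemma Im_le_norm z : ((complex.Im z)%:C)%C <= `|z|.
Proof.
have -> : `|z| = `|z * 'i%C|.
  by rewrite normrM [X in _ * X]normc_def /= expr0n expr1n add0r sqrtr1 mulr1.
by apply: le_trans (normc_ge_Re _); rewrite ReiNIm normrN lecR ler_norm.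
Qed.

Lemma ImD z w : complex.Im (z + w) = complex.Im z + complex.Im w.
Proof. by case: z w => [? ?] []. Qed.

Lemma ImB z w : complex.Im (z - w) = complex.Im z - complex.Im w.
Proof. by case: z w => [? ?] []. Qed.

(** For [w] in the closed upper half-plane each factor satisfies |w - z| >= -Im z, hence 1 + |w| <=
    (1 + |z|) + |w - z| <= ((1 + |z|) / (-Im z) + 1) |w - z|. A perturbation of size eps (1 + |w|)^m
    then creates no zero there, even near infinity. *)
Lemma lower_prod_lb rs : (forall z, z \in rs -> complex.Im z < 0) ->
  exists2 K : C, 0 < K & forall w, 0 <= complex.Im w ->
    (1 + `|w|) ^+ size rs <= K * `|\prod_(z <- rs) (w - z)|.
Proof.
elim: rs => [_|z rs IH lt0].
  by exists 1 => // w _; rewrite big_nil normr1 mul1r expr0.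
have [|K K0 HK] := IH; first by move=> y yrs; apply: lt0; rewrite inE yrs orbT.
have z0 : 0 < - complex.Im z by rewrite oppr_gt0 lt0// mem_head.
pose d : C := ((- complex.Im z)%:C)%C.
have d0 : 0 < d by rewrite ltcR.
have K'0 : 0 < (1 + `|z|) / d + 1 :> C.
  by rewrite ltr_wpDl// divr_ge0 ?(ltW d0)// addr_ge0.
exists (((1 + `|z|) / d + 1) * K); first exact: mulr_gt0.
move=> w w0; rewrite big_cons normrM exprS.
rewrite mulrACA ler_pM ?HK ?exprn_ge0 ?addr_ge0//.
have dw : d <= `|w - z|.
  apply: le_trans (Im_le_norm _); rewrite lecR ImB; lra.
rewrite mulrDl mul1r.
have -> : 1 + `|w| = 1 + `|(w - z) + z| by rewrite subrK.
apply: (@le_trans _ _ ((1 + `|z|) + `|w - z|)).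
  by rewrite -[leRHS]addrA lerD2l [leRHS]addrC ler_normD.
rewrite lerD2r -mulrA ler_peMr ?addr_ge0//.
by rewrite mulrC ler_pdivlMr// mul1r.
Qed.

Lemma upper_prod_lb rs w : (forall z, z \in rs -> complex.Im z < 0) ->
  0 < complex.Im w ->
  (((complex.Im w)%:C)%C) ^+ size rs <= `|\prod_(z <- rs) (w - z)|.
Proof.
move=> + w0; elim: rs => [_|z rs IH lt0]; first by rewrite big_nil normr1 expr0.
have w0' : 0 <= ((complex.Im w)%:C)%C :> C by rewrite lecR ltW.
rewrite big_cons normrM exprS; apply: ler_pM => //; first exact: exprn_ge0.
- by apply: le_trans (Im_le_norm _); rewrite lecR ImB; have := lt0 _ (mem_head _ _); lra.
- by apply: IH => y yrs; apply: lt0; rewrite inE yrs orbT.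
Qed.

Lemma locally_constant01 (G : R -> Prop) :
  (forall r, 0 <= r <= 1 -> exists2 e : R, 0 < e &
     forall r', 0 <= r' <= 1 -> `|r - r'| < e -> (G r <-> G r')) ->
  G 0 -> G 1.
Proof.
move=> loc G0; apply: contrapT => G1.
(* A two-valued locally constant function is continuous; if it took both values, the intermediate
   value theorem would give the value 1/2. *)
pose g (r : R) : R := if `[< G r >] then 0 else 1.
have cg : {within `[0, 1], continuous g}.
  apply/continuous_within_itvP => //; split.
  - move=> x /itvP x01; have [|e e0 He] := loc x; first by rewrite !x01.
    apply: cvg_near_cst.
    near=> y; rewrite /g; congr (if _ then _ else _).
    apply/asbool_equiv_eq; apply: iff_sym; apply: He; last by near: y; apply/nbhs_ballP; exists e.
    apply/andP; split; apply: ltW; near: y.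
    + by apply: lt_nbhsr; rewrite x01.
    + by apply: lt_nbhsl; rewrite x01.
  - have [|e e0 He] := loc 0; first by rewrite lexx ler01.
    apply: cvg_near_cst.
    near=> y; rewrite /g; congr (if _ then _ else _).
    apply/asbool_equiv_eq; apply: iff_sym; apply: He.
    + apply/andP; split; first by near: y; exact: nbhs_right_ge.
      by near: y; apply: nbhs_right_le.
    + have y0 : 0 < y by near: y; exact: nbhs_right_gt.
      by rewrite sub0r normrN gtr0_norm//; near: y; exact: nbhs_right_lt.
  - have [|e e0 He] := loc 1; first by rewrite lexx ler01.
    apply: cvg_near_cst.
    near=> y; rewrite /g; congr (if _ then _ else _).
    apply/asbool_equiv_eq; apply: iff_sym; apply: He.
    + apply/andP; split; last by near: y; exact: nbhs_left_le.
      by near: y; apply: nbhs_left_ge.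
    + have y1 : y < 1 by near: y; exact: nbhs_left_lt.
      rewrite gtr0_norm ?subr_gt0// ltrBlDr -ltrBlDl.
      by near: y; apply: nbhs_left_gt; rewrite ltrBlDr ltrDl.
have g0 : g 0 = 0 by rewrite /g asboolT.
have g1 : g 1 = 1 by rewrite /g asboolF.
have [|c _] := IVT (v := 2^-1) ler01 cg.
  by rewrite g0 g1 minElt maxElt ltr01; apply/andP; split; lra.
by rewrite /g; case: ifP => _; lra.
Unshelve. all: by end_near.
Qed.

(* The roots cannot cross the real axis, and none escapes to infinity since
   the leading coefficient is fixed. *)
Lemma lower_roots_homotopy (P : R -> {poly C}) (m : nat) (c L : C) :
  (forall r, size (P r) = m.+1) -> (forall r, lead_coef (P r) = c) -> 0 <= L ->
  (forall r r' z, 0 <= r <= 1 -> 0 <= r' <= 1 ->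
     `|(P r).[z] - (P r').[z]| <= L * (`|r - r'|%:C)%C * (1 + `|z|) ^+ m) ->
  (forall (r x : R), 0 <= r <= 1 -> ~~ root (P r) (x%:C)%C) ->
  lower_roots (P 0) -> lower_roots (P 1).
Proof.
move=> sP lP L0 lip noreal; apply: (@locally_constant01 (fun r => lower_roots (P r))).
move=> r r01.
have c0 : 0 < `|c|.
  by rewrite normr_gt0 -(lP 0) lead_coef_eq0 -size_poly_eq0 sP.
have fact r' : exists rs, [/\ size rs = m, forall z, root (P r') z = (z \in rs)
    & forall w, `|(P r').[w]| = `|c| * `|\prod_(z <- rs) (w - z)|].
  have [rs] := closed_field_poly_normal (P r'); rewrite lP => Prs.
  have cn0 : c != 0 by rewrite -normr_gt0.
  exists rs; split.
  - have := sP r'; rewrite Prs size_scale// size_prod_XsubC.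
    by move=> [].
  - by move=> z; rewrite Prs rootZ// root_prod_XsubC.
  - move=> w; rewrite Prs hornerZ normrM; congr (_ * `|_|).
    by rewrite horner_prod; apply: eq_bigr => z _; rewrite hornerXsubC.
have pos_real (x : C) : 0 <= x -> exists2 q : R, 0 <= q & x = (q%:C)%C.
  move=> x0; have /complex_realP[k xk] : x \is Num.real by exact: ger0_real.
  by exists k => //; rewrite -ler0c -xk.
(* Both alternatives are open in [r]. Roots in the lower half-plane bound |P r| below by a multiple
   of (1 + |z|)^m on the closed upper half-plane; a root [z] violating the condition lies strictly
   above the axis, and a polynomial with all its roots below is at least |c| (Im z)^m at [z]. In
   each case [q] is the ratio of the Lipschitz constant to the lower bound, and q |r - r'| < 1 gives
   the contradiction. *)
have [gr|bad] := pselect (lower_roots (P r)).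
- have [rs [srs rrs ers]] := fact r.
  have [K K0 HK] := lower_prod_lb (rs := rs) ltac:(by move=> z; rewrite -rrs; apply: gr).
  have [q q0 qE] := pos_real (L * K / `|c|) (divr_ge0 (mulr_ge0 L0 (ltW K0)) (ltW c0)).
  exists (q + 1)^-1 => [|r' r'01 rr']; first by rewrite invr_gt0; lra.
  split=> // _ z rz; rewrite ltNge; apply/negP => z0.
  have := HK _ z0; rewrite srs.
  have H : `|c| * `|\prod_(x <- rs) (z - x)| <= L * (`|r - r'|%:C)%C * (1 + `|z|) ^+ m.
    by rewrite -ers; have := lip r r' z r01 r'01; rewrite (rootP rz) subr0.
  move=> /le_trans H3.
  have {}H3 : (1 + `|z|) ^+ m <= K * (`|c|^-1 * (L * (`|r - r'|%:C)%C * (1 + `|z|) ^+ m)).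
    by apply: H3; rewrite ler_pM2l// ler_pdivlMl.
  have E : K * (`|c|^-1 * (L * (`|r - r'|%:C)%C * (1 + `|z|) ^+ m)) =
     (q * `|r - r'|)%:C%C * (1 + `|z|) ^+ m.
    by rewrite rmorphM/= -qE; ring.
  move: H3; rewrite E ler_pMl; last first.
    by rewrite exprn_gt0// ltr_pwDl.
  rewrite -[1](rmorph1 (real_complex R)) lecR => H4.
  have : q * `|r - r'| < 1.
    rewrite (@le_lt_trans _ _ (q * (q + 1)^-1))//; first by rewrite ler_wpM2l// ltW.
    rewrite ltr_pdivrMr; lra.
  lra.
- have [z rz z0] : exists2 z, root (P r) z & 0 <= complex.Im z.
    move/existsNP : bad => [z /not_implyP[rz /negP]]; rewrite -leNgt => z0.
    by exists z.
  have {}z0 : 0 < complex.Im z.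
    rewrite lt_def z0 andbT; apply/eqP => z00.
    have := noreal r (complex.Re z) r01; case: z z00 rz {z0} => a b /= -> rz.
    by rewrite rz.
  have zm0 : 0 < ((complex.Im z)%:C)%C ^+ m :> C by rewrite exprn_gt0// ltcR.
  have [q q0 qE] := pos_real (L * (1 + `|z|) ^+ m / `|c| / (((complex.Im z)%:C)%C ^+ m))
    (divr_ge0 (divr_ge0 (mulr_ge0 L0 (exprn_ge0 _ (addr_ge0 ler01 (normr_ge0 _)))) (ltW c0)) (ltW zm0)).
  exists (q + 1)^-1 => [|r' r'01 rr']; first by rewrite invr_gt0; lra.
  split=> // gr'.
  have [rs [srs rrs ers]] := fact r'.
  have H := upper_prod_lb (rs := rs) ltac:(by move=> y; rewrite -rrs; apply: gr') z0.
  rewrite srs in H.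
  have H1 : `|c| * `|\prod_(x <- rs) (z - x)| <= L * (`|r - r'|%:C)%C * (1 + `|z|) ^+ m.
    by rewrite -ers; have := lip r r' z r01 r'01; rewrite (rootP rz) sub0r normrN.
  have := le_trans _ H1; move=> /(_ (`|c| * ((complex.Im z)%:C)%C ^+ m)).
  rewrite ler_pM2l// => /(_ H).
  have -> : L * (`|r - r'|%:C)%C * (1 + `|z|) ^+ m =
    (q * `|r - r'|)%:C%C * (`|c| * ((complex.Im z)%:C)%C ^+ m).
    by rewrite rmorphM/= -qE; field; rewrite !gt_eqF.
  rewrite ler_pMl ?mulr_gt0// -[1](rmorph1 (real_complex R)) lecR => H4.
  have : q * `|r - r'| < 1.
    rewrite (@le_lt_trans _ _ (q * (q + 1)^-1))//; first by rewrite ler_wpM2l// ltW.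
    rewrite ltr_pdivrMr; lra.
  lra.
Qed.
End half_plane.

(** * Gårding's inequality in a commutative algebra with a linear functional *)

Section garding.
Context {R : realType} {A : comNzRingType}.
Local Notation C := R[i].
Variables (iota : {rmorphism C -> A}) (top : {additive A -> C}).
Hypothesis topZ : forall c x, top (iota c * x) = c * top x.
Implicit Types (w : A) (V W : A -> Prop) (m : nat).

Local Notation ir r := (iota (r%:C)%C).
Local Notation P o m x := (top (o * x ^+ m)).

Lemma top_expand o m w a (s : C) :
  P o m (w + iota s * a) =
  \sum_(k < m.+1) top (o * (w ^+ (m - k) * a ^+ k) *+ 'C(m, k)) * s ^+ k.
Proof.
rewrite exprDn mulr_sumr raddf_sum; apply: eq_bigr => k _.
rewrite mulrnAr raddfMn exprMn -rmorphXn.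
rewrite (_ : o * _ = iota (s ^+ k) * (o * (w ^+ (m - k) * a ^+ k))) ?topZ; last by ring.
by rewrite raddfMn/= mulrnAl mulrC.
Qed.

Definition line_poly o m w a : {poly C} :=
  \poly_(k < m.+1) top (o * (w ^+ (m - k) * a ^+ k) *+ 'C(m, k)).

Lemma horner_line_poly o m w a s : (line_poly o m w a).[s] = P o m (w + iota s * a).
Proof. by rewrite horner_poly top_expand. Qed.

Lemma coef_line_poly_lead o m w a : (line_poly o m w a)`_m = P o m a.
Proof. by rewrite coef_poly ltnSn binn mulr1n subnn expr0 mul1r. Qed.

Lemma size_line_poly o m w a : P o m a != 0 -> size (line_poly o m w a) = m.+1.
Proof. by move=> a0; rewrite size_poly_eq// subnn expr0 mul1r binn mulr1n. Qed.

Lemma lead_line_poly o m w a : P o m a != 0 ->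
  lead_coef (line_poly o m w a) = P o m a.
Proof. by move=> a0; rewrite lead_coefE size_line_poly// coef_line_poly_lead. Qed.

(** This coefficient is the derivative at [w] in the direction [a]: up to the factor m + 1,
    differentiating the polynomial attached to [o] means replacing [o] by [o * a]. *)
Lemma coef1_line_poly o m w a :
  (line_poly o m.+1 w a)`_1 = top (o * a * w ^+ m) *+ m.+1.
Proof.
rewrite coef_poly/= subSS subn0 bin1 raddfMn/= expr1.
by congr (top _ *+ _); ring.
Qed.

Let lipschitz01 m (g : R -> C -> C) := exists2 L : C, 0 <= L &
  forall r r' z, 0 <= r <= 1 -> 0 <= r' <= 1 ->
    `|g r z - g r' z| <= L * (`|r - r'|%:C)%C * (1 + `|z|) ^+ m.

Let lipschitz01_sum m n (g : 'I_n -> R -> C -> C) :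
  (forall i, lipschitz01 m (g i)) -> lipschitz01 m (fun r z => \sum_i g i r z).
Proof.
move=> /(_ _)/cid2-/all_sig2[L L0 HL]; exists (\sum_i L i); first exact: sumr_ge0.
move=> r r' z r01 r'01; rewrite -sumrB -mulrA mulr_suml.
by apply: le_trans (ler_norm_sum _ _ _) _; apply: ler_sum => i _; rewrite mulrA HL.
Qed.

Let lipschitz01_monomial m i k (c : C) : (k <= m)%N ->
  lipschitz01 m (fun r z => c * (r%:C)%C ^+ i * z ^+ k).
Proof.
move=> km; have [L L0 HL] : exists2 L : C, 0 <= L &
    forall r r' : R, 0 <= r <= 1 -> 0 <= r' <= 1 ->
      `|(r%:C)%C ^+ i - (r'%:C)%C ^+ i| <= L * (`|r - r'|%:C)%C.
  exists i%:R => // r r' r01 r'01.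
  elim: i => [|i IH]; first by rewrite !expr0 subrr normr0 mul0r.
  have -> : (r%:C)%C ^+ i.+1 - (r'%:C)%C ^+ i.+1 =
     (r%:C)%C * ((r%:C)%C ^+ i - (r'%:C)%C ^+ i) + ((r - r')%:C)%C * (r'%:C)%C ^+ i.
    by rewrite rmorphB/= !exprS; ring.
  apply: le_trans (ler_normD _ _) _; rewrite !normrM -natr1 mulrDl mul1r.
  have nr (x : R) : `|(x%:C)%C| = (`|x|%:C)%C :> C.
    by rewrite normc_def /= expr0n addr0 sqrtr_sqr.
  apply: lerD.
    rewrite -[leRHS]mul1r ler_pM ?IH// nr lecR ger0_norm; lra.
  rewrite nr; apply: ler_piMr; first by rewrite lecR.
  rewrite normrX nr; apply: exprn_ile1; rewrite lecR//.
  rewrite ger0_norm; lra.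
exists (`|c| * L) => [|r r' z r01 r'01]; first exact: mulr_ge0.
have -> : c * (r%:C)%C ^+ i * z ^+ k - c * (r'%:C)%C ^+ i * z ^+ k =
   c * ((r%:C)%C ^+ i - (r'%:C)%C ^+ i) * z ^+ k by ring.
rewrite !normrM -[_ * L * _]mulrA; apply: ler_pM; rewrite ?mulr_ge0//.
  by rewrite ler_wpM2l ?HL.
rewrite normrX (@le_trans _ _ ((1 + `|z|) ^+ k))//.
  by rewrite lerXn2r ?nnegrE ?addr_ge0 ?lerDr.
by rewrite ler_weXn2l// lerDl.
Qed.

(** The expression is a polynomial in [r] and [z], of degree at most [m] in [z]. This is the
    estimate that [lower_roots_homotopy] asks for when [w] is shrunk to 0. *)
Lemma lipschitz_line o m w b a : exists2 L : C, 0 <= L &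
  forall r r' z, 0 <= r <= 1 -> 0 <= r' <= 1 ->
    `|P o m (ir r * w + b + iota z * a) - P o m (ir r' * w + b + iota z * a)|
      <= L * (`|r - r'|%:C)%C * (1 + `|z|) ^+ m.
Proof.
have : lipschitz01 m (fun r z => \sum_(k < m.+1) \sum_(i < (m - k).+1)
    top ((o * a ^+ k *+ 'C(m, k)) * (b ^+ (m - k - i) * w ^+ i) *+ 'C(m - k, i))
      * (r%:C)%C ^+ i * z ^+ k).
  apply: lipschitz01_sum => k; apply: lipschitz01_sum => i.
  by apply: lipschitz01_monomial; rewrite -ltnS.
move=> [L L0 HL]; exists L => // r r' z r01 r'01.
have E r0 : P o m (ir r0 * w + b + iota z * a) = \sum_(k < m.+1) \sum_(i < (m - k).+1)
    top ((o * a ^+ k *+ 'C(m, k)) * (b ^+ (m - k - i) * w ^+ i) *+ 'C(m - k, i))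
      * (r0%:C)%C ^+ i * z ^+ k.
  rewrite top_expand; apply: eq_bigr => k _; rewrite -mulr_suml; congr (_ * _).
  rewrite [ir r0 * w + b]addrC -top_expand; congr (top _).
  by rewrite mulrnAl; congr (_ *+ _); ring.
by rewrite !E; exact: HL.
Qed.

(* [W] will consist of real vectors, or of combinations of a real vector with
   an element of the cone; in both cases the homotopy [r * w] ends at 0. *)
Lemma extend_direction o m e a W :
  (forall w (t : C), W w -> 0 < complex.Im t -> P o m (w + iota t * e) != 0) ->
  (forall w (x : R), W w -> W (w + ir x * a)) ->
  (forall w (r : R), 0 <= r -> W w -> W (ir r * w)) ->
  P o m a != 0 ->
  (forall t s : C, 0 < complex.Im t -> P o m (iota t * e + iota s * a) = 0 ->
     complex.Im s < 0) ->
  forall w (t s : C), W w -> 0 < complex.Im t -> 0 <= complex.Im s ->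
    P o m (w + iota t * e + iota s * a) != 0.
Proof.
move=> Wne Wa Wr a0 lower w t s Ww t0 s0.
pose Q r := line_poly o m (ir r * w + iota t * e) a.
have [L L0 HL] := lipschitz_line o m w (iota t * e) a.
have : lower_roots (Q 1).
  apply: (@lower_roots_homotopy R Q m (P o m a) L) => //.
  - by move=> r; rewrite size_line_poly.
  - by move=> r; rewrite lead_line_poly.
  - by move=> r r' z r01 r'01; rewrite !horner_line_poly HL.
  - move=> r x r01; rewrite rootE horner_line_poly addrAC Wne//.
    by apply/Wa/Wr => //; case/andP: r01.
  - move=> z; rewrite rootE horner_line_poly rmorph0 mul0r add0r => /eqP.
    exact: lower.
move=> /(_ s) H; apply/negP => s00.
have /H : root (Q 1) s by rewrite rootE horner_line_poly rmorph1 mul1r.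
by rewrite ltNge s0.
Qed.

(* For [f = c \prod (X - z_i)] with all [Im z_i < 0], the logarithmic
   derivative [f'(0) / f(0) = - \sum 1 / z_i] has negative imaginary part. *)
Lemma lower_roots_coef1 (p : {poly C}) : (1 < size p)%N -> lower_roots p -> p`_1 != 0.
Proof.
move=> sp lp; have [rs prs] := closed_field_poly_normal p.
have c0 : lead_coef p != 0 by rewrite lead_coef_eq0 -size_poly_gt0 (ltn_trans _ sp).
have rs0 : rs != [::].
  by apply: contraTneq sp => rs0; rewrite prs rs0 big_nil alg_polyC size_polyC c0.
have lrs z : z \in rs -> complex.Im z < 0.
  by move=> zrs; apply: lp; rewrite prs rootZ// root_prod_XsubC.
rewrite prs coefZ mulf_neq0//.
have Iinv (z : C) : complex.Im z < 0 -> complex.Im (- z^-1) < 0.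
  case: z => a b /= b0; rewrite opprK pmulr_llt0// invr_gt0.
  by rewrite ltr_wpDl ?sqr_ge0// exprn_even_gt0//= lt_eqF.
suff [q0 qI] : (\prod_(z <- rs) ('X - z%:P))`_0 != 0 /\ complex.Im
    ((\prod_(z <- rs) ('X - z%:P))`_1 / (\prod_(z <- rs) ('X - z%:P))`_0) < 0.
  by apply: contraTneq qI => ->; rewrite mul0r ltxx.
have : complex.Im ((\prod_(z <- [::]) ('X - z%:P))`_1 /
     (\prod_(z <- [::]) ('X - z%:P))`_0 : C) <= 0 /\
     (\prod_(z <- [::]) ('X - z%:P))`_0 != 0 :> C.
  by rewrite big_nil !coefC/= mul0r oner_neq0.
case: rs rs0 lrs {prs} => // z0 rs _ lrs.
have key : forall rs z, (complex.Im ((\prod_(z <- rs) ('X - z%:P))`_1 /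
     (\prod_(z <- rs) ('X - z%:P))`_0 : C) <= 0 /\
     (\prod_(z <- rs) ('X - z%:P))`_0 != 0 :> C) -> complex.Im z < 0 ->
    (\prod_(y <- z :: rs) ('X - y%:P))`_0 != 0 /\
    complex.Im ((\prod_(y <- z :: rs) ('X - y%:P))`_1 /
     (\prod_(y <- z :: rs) ('X - y%:P))`_0 : C) < 0.
  move=> r z [I0 r0] z0lt; rewrite big_cons mulrBl !coefB coefXM !coefCM/=.
  rewrite coefXM/= sub0r; set q0 := _`_0 in r0 I0 *; set q1 := _`_1 in I0 *.
  have zn0 : z != 0 by apply: contraTneq z0lt => ->; rewrite ltxx.
  split; first by rewrite oppr_eq0 mulf_neq0.
  have -> : (q0 - z * q1) / - (z * q0) = - z^-1 + q1 / q0.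
    by field; apply/andP; split.
  by rewrite ImD; have := Iinv z z0lt; lra.
move=> base; elim: rs z0 lrs => [|z1 rs IH] z0 lrs.
  by apply: key => //; apply: lrs; rewrite mem_head.
apply: key; last by apply: lrs; rewrite mem_head.
have [|n0 I0] := IH z1; last by split=> //; apply: ltW.
by move=> y yrs; apply: lrs; rewrite inE yrs orbT.
Qed.

(* [V] is the set of real vectors, [e] the direction of hyperbolicity. *)
Variables (V : A -> Prop) (e : A).
Hypotheses (VD : forall x y, V x -> V y -> V (x + y))
  (VZ : forall (r : R) x, V x -> V (ir r * x)) (Ve : V e).

Definition hyperbolic o m := 0 < P o m e /\
  forall x (t : C), V x -> 0 < complex.Im t -> P o m (x + iota t * e) != 0.

(** The open Gårding cone of [e]: for a hyperbolic polynomial the roots of t |-> P(a + t e) are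
    real, and here all of them are required to be negative. *)
Definition hyp_cone o m a := V a /\ forall t : R, 0 <= t -> P o m (a + ir t * e) != 0.

Lemma top_exprZ o m c x : P o m (iota c * x) = c ^+ m * P o m x.
Proof. by rewrite exprMn -rmorphXn mulrCA topZ. Qed.

(** By homogeneity, multiplication by -1 exchanges the two half-planes. *)
Lemma hyperbolic_nonreal o m x (t : C) : hyperbolic o m -> V x ->
  complex.Im t != 0 -> P o m (x + iota t * e) != 0.
Proof.
move=> [_ h] Vx; rewrite neq_lt => /orP[t0|t0]; last exact: h.
have -> : x + iota t * e = iota (-1) * (ir (-1) * x + iota (- t) * e).
  by rewrite rmorphN/= !rmorphN !rmorph1; ring.
rewrite top_exprZ mulf_neq0 ?expf_neq0 ?oppr_eq0 ?oner_eq0//.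
by apply: h; [exact: VZ|case: t t0 => a b /=; rewrite oppr_gt0].
Qed.

(** Factoring out [s] gives t e + s a = s (a + (t / s) e). A zero forces t / s to be real by
    hyperbolicity and negative by the cone condition, so the imaginary parts of [s] and [t] have
    opposite signs. *)
Lemma hyp_cone_lower o m a : hyperbolic o m -> hyp_cone o m a ->
  forall t s : C, 0 < complex.Im t -> P o m (iota t * e + iota s * a) = 0 ->
     complex.Im s < 0.
Proof.
move=> hyp [Va ca] t s t0.
have [->|sn0] := eqVneq s 0.
  rewrite rmorph0 mul0r addr0 top_exprZ => /eqP; rewrite mulf_eq0 => /orP[|].
    by rewrite expf_eq0 => /andP[_ /eqP t00]; rewrite t00 ltxx in t0.
  by rewrite (gt_eqF hyp.1).
have -> : iota t * e + iota s * a = iota s * (a + iota (t / s) * e).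
  by rewrite mulrDr mulrA -rmorphM/= [s * _]mulrC divfK// addrC.
rewrite top_exprZ => /eqP; rewrite mulf_eq0 expf_eq0 (negbTE sn0) andbF /= => z.
have [I0|I0] := eqVneq (complex.Im (t / s)) 0; last first.
  by move: z; rewrite (negbTE (hyperbolic_nonreal hyp Va I0)).
have tsE : t / s = ((complex.Re (t / s))%:C)%C by case: (t / s) I0 => ? ? /= ->.
move: z; rewrite tsE; set q := complex.Re _ => z.
have q0 : q < 0 by rewrite ltNge; apply/negP => /ca; rewrite z.
have tE : t = s * (q%:C)%C by rewrite -tsE mulrC divfK.
have : complex.Im t = complex.Im s * q.
  rewrite {1}tE; have ImMr (u : C) (x : R) : complex.Im (u * (x%:C)%C) = complex.Im u * x.
    by case: u => u v /=; ring.
  exact: ImMr.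
by move=> E; rewrite E nmulr_lgt0 in t0.
Qed.

Lemma hyp_cone_neq0 o m a : hyp_cone o m a -> P o m a != 0.
Proof. by move=> [_ /(_ 0 (lexx _))]; rewrite !rmorph0 mul0r addr0. Qed.

Lemma hyp_cone_shift o m a (t : R) : 0 <= t -> hyp_cone o m a -> hyp_cone o m (a + ir t * e).
Proof.
move=> t0 [Va ca]; split=> [|s s0]; first by apply: VD => //; exact: VZ.
by rewrite -addrA -mulrDl -rmorphD/= -rmorphD ca// addr_ge0.
Qed.

Lemma hyp_cone_open o m a : hyperbolic o m -> hyp_cone o m a ->
  exists2 d : R, 0 < d & hyp_cone o m (a - ir d * e).
Proof.
move=> [e0 _] [Va ca].
have [rs prs] := closed_field_poly_normal (line_poly o m a e).
have c0 : lead_coef (line_poly o m a e) != 0 by rewrite lead_line_poly ?gt_eqF.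
have : 0 \notin rs.
  rewrite -root_prod_XsubC -(rootZ _ _ c0) -prs rootE horner_line_poly.
  by rewrite rmorph0 mul0r addr0 hyp_cone_neq0.
(* Only real roots matter; being finitely many and nonzero, they keep a positive distance from 0. *)
have dist : 0 \notin rs -> exists2 d : R, 0 < d & forall x : R,
    (x%:C)%C \in rs -> d < `|x|.
  elim: rs {prs} => [_|z rs IH]; first by exists 1.
  rewrite inE negb_or => /andP[z0 /IH[d d0 Hd]].
  have [dz|dz] := pselect (exists x : R, z = (x%:C)%C); last first.
    by exists d => // x; rewrite inE => /orP[/eqP xz|/Hd//]; case: dz; exists x.
  case: dz => y zy; exists (Num.min d (`|y| / 2)).
    rewrite lt_min d0 divr_gt0// normr_gt0.
    by apply: contraNneq z0 => y0; rewrite zy y0.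
  move=> x; rewrite inE zy => /orP[/eqP/complexI ->|/Hd]; last first.
    by move=> dx; rewrite gt_min dx.
  rewrite gt_min; apply/orP; right; rewrite ltr_pdivrMr// ltr_pMr ?ltr1n//.
  by rewrite normr_gt0; apply: contraNneq z0 => y0; rewrite zy y0.
move=> /dist[d d0 Hd]; exists d => //; split.
  have -> : - (ir d * e) = ir (- d) * e by rewrite rmorphN/= rmorphN mulNr.
  by apply: VD => //; exact: VZ.
move=> t t0; have -> : a - ir d * e + ir t * e = a + ir (t - d) * e.
  by rewrite (rmorphB (real_complex R)) rmorphB; ring.
have [td|td] := leP d t; first by rewrite ca// subr_ge0.
rewrite -horner_line_poly -rootE prs rootZ// root_prod_XsubC.
apply/negP => /Hd; rewrite ltr0_norm; lra.
Qed.

(** The inductive step: the derivative in a direction of the cone is again hyperbolic, and its cone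
    contains the old one. Nonvanishing of the derivative comes from [lower_roots_coef1], applied to
    lines in the direction [a] whose roots all lie in the lower half-plane. *)
Lemma hyperbolic_derive o m a : hyperbolic o m.+1 -> hyp_cone o m.+1 a ->
  hyperbolic (o * a) m /\ forall b, hyp_cone o m.+1 b -> hyp_cone (o * a) m b.
Proof.
move=> hyp ca; have [Va _] := ca; have a0 := hyp_cone_neq0 ca.
have V0 : V 0 by have := VZ 0 Ve; rewrite !rmorph0 mul0r.
have K b : hyp_cone o m.+1 b -> forall w (t s : C), V w -> 0 < complex.Im t ->
    0 <= complex.Im s -> P o m.+1 (w + iota t * e + iota s * b) != 0.
  move=> cb; apply: extend_direction.
  - exact: hyp.2.
  - by move=> w x Vw; apply: VD => //; apply: VZ; case: cb.
  - by move=> w r _; exact: VZ.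
  - exact: hyp_cone_neq0.
  - exact: hyp_cone_lower.
split; last first.
  move=> b cb; split; first by case: cb.
  move=> t t0; set b' := b + ir t * e.
  have cb' : hyp_cone o m.+1 b' by exact: hyp_cone_shift.
  (* Splitting i b' = i (b' - d e) + i d e leaves a term along [e] with positive imaginary part, as
     [extend_direction] requires. The set [W] absorbs the rest: real vectors plus closed upper
     half-plane multiples of b' - d e. *)
  have [d d0 cd] := hyp_cone_open hyp cb'.
  pose W w := exists x (z : C), [/\ V x, 0 <= complex.Im z & w = x + iota z * (b' - ir d * e)].
  pose i : C := 'i%C.
  have lr : lower_roots (line_poly o m.+1 (iota i * b') a).
    move=> z; rewrite rootE horner_line_poly => rz; rewrite ltNge; apply: contraL rz => z0.
    have -> : iota i * b' + iota z * a =
       iota i * (b' - ir d * e) + iota (i * (d%:C)%C) * e + iota z * a.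
      by rewrite (rmorphM iota); ring.
    apply: (@extend_direction _ _ e a W) => //.
    - move=> w s [x [y [Vx y0 ->]]] s0; rewrite addrAC; exact: K.
    - move=> w x [y [s [Vy s0 ->]]]; exists (y + ir x * a), s; split=> //.
        by apply: VD => //; exact: VZ.
      by rewrite addrAC.
    - move=> w r r0 [y [s [Vy s0 ->]]].
      exists (ir r * y), ((r%:C)%C * s); split; first exact: VZ.
        by case: s s0 => ? ? /= ?; rewrite mul0r addr0 mulr_ge0.
      by rewrite (rmorphM iota); ring.
    - exact: hyp_cone_lower.
    - by exists 0, i; rewrite add0r; split=> //; rewrite /= ler01.
    - by rewrite /= mul0r mul1r add0r.
  have := lower_roots_coef1 _ lr; rewrite size_line_poly// => /(_ isT).
  rewrite coef1_line_poly exprMn -rmorphXn mulrCA topZ.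
  by apply: contraNneq => ->; rewrite mulr0 mul0rn.
have lr x t : V x -> 0 < complex.Im t -> lower_roots (line_poly o m.+1 (x + iota t * e) a).
  move=> Vx t0 z; rewrite rootE horner_line_poly => rz; rewrite ltNge.
  by apply: contraL rz => z0; exact: K.
split; last first.
  move=> x t Vx t0; have := lower_roots_coef1 _ (lr x t Vx t0).
  rewrite size_line_poly// => /(_ isT).
  by rewrite coef1_line_poly; apply: contraNneq => ->; rewrite mul0rn.
(* Positivity at [e]: the coefficient of degree m of s |-> P(a + s e) is m + 1 times the new value
   at [e]. It is also P(e) > 0 times minus the sum of the roots, and these are real and negative
   because [a] is in the cone. *)
have [rs prs] := closed_field_poly_normal (line_poly o m.+1 a e).
have e0 := hyp.1; have en0 : P o m.+1 e != 0 by rewrite gt_eqF.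
have srs : size rs = m.+1.
  have := size_line_poly a en0; rewrite prs size_scale ?lead_coef_eq0.
    by rewrite size_prod_XsubC => -[].
  by rewrite -size_poly_eq0 size_line_poly.
have rsneg z : z \in rs -> z < 0.
  rewrite -root_prod_XsubC => rz.
  have : root (line_poly o m.+1 a e) z.
    by rewrite prs rootZ// lead_coef_eq0 -size_poly_eq0 size_line_poly.
  rewrite rootE horner_line_poly => z0.
  have [I0|I0] := eqVneq (complex.Im z) 0; last first.
    by move: z0; rewrite (negbTE (hyperbolic_nonreal hyp Va I0)).
  rewrite ltcE/= I0 eqxx/= ltNge; apply/negP => /ca.2.
  by case: z I0 z0 {rz} => ? ? /= -> ->.
have := coefPn_prod_XsubC (ps := rs); rewrite srs => /(_ isT) /= E.
have : (line_poly o m.+1 a e)`_m = top (o * a * e ^+ m) *+ m.+1.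
  by rewrite coef_poly leqnSn subSn// subnn expr1 binSn raddfMn/= mulrA.
rewrite prs coefZ E lead_line_poly// => F.
have : 0 < top (o * a * e ^+ m) *+ m.+1.
  rewrite -F mulr_gt0// oppr_gt0.
  case: rs srs rsneg {prs E F lr} => // z rs _ rsneg.
  rewrite big_cons ltr_wnDr ?rsneg ?mem_head//.
  rewrite big_seq; apply: sumr_le0 => y yrs; rewrite ltW// rsneg// inE yrs orbT//.
by rewrite pmulrn_lgt0.
Qed.

(** Each factor split off is one differentiation, after which the other factors still lie in the
    cone of a hyperbolic polynomial of degree one less. *)
Lemma garding o (s : seq A) : hyperbolic o (size s) ->
  (forall a, a \in s -> hyp_cone o (size s) a) -> 0 < top (o * \prod_(a <- s) a).
Proof.
elim: s o => [|a s IH] o hyp cs; first by rewrite big_nil; have := hyp.1; rewrite expr0.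
have [|h c] := hyperbolic_derive hyp (a := a); first by apply: cs; rewrite mem_head.
rewrite big_cons mulrA; apply: IH => // b bs.
by apply/c/cs; rewrite inE bs orbT.
Qed.

Lemma hyp_cone_base o m : hyperbolic o m -> hyp_cone o m e.
Proof.
move=> [e0 _]; split=> // t t0.
have -> : e + ir t * e = iota (1 + t)%:C%C * e.
  by rewrite (rmorphD (real_complex R)) rmorphD !rmorph1; ring.
rewrite top_exprZ mulf_neq0 ?gt_eqF//.
by rewrite exprn_gt0// ltcR; lra.
Qed.

(** Differentiating k times in the direction [e] itself; this leads from alpha^n to alpha^m /\
    beta^(n-m). *)
Lemma hyperbolic_base_exp o m k : hyperbolic o (k + m) -> hyperbolic (o * e ^+ k) m.
Proof.
elim: k o => [|k IH] o; first by rewrite expr0 mulr1.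
move=> h; rewrite exprS mulrA; apply: IH.
by have [] := hyperbolic_derive h (hyp_cone_base h).
Qed.

Let top_prod_shift_lipschitz o (s : seq A) : exists2 L : C, 0 <= L & forall d : R,
  0 <= d <= 1 -> `|top (o * \prod_(a <- s) (a + ir d * e)) - top (o * \prod_(a <- s) a)|
    <= L * (d%:C)%C.
Proof.
elim: s o => [|a s IH] o.
  by exists 0 => // d _; rewrite !big_nil subrr normr0 mul0r.
have [L1 L10 H1] := IH (o * a); have [L2 L20 H2] := IH (o * e).
pose M := `|top (o * e * \prod_(a <- s) a)|.
exists (L1 + (L2 + M)) => [|d d01].
  by apply: addr_ge0 => //; apply: addr_ge0 => //; exact: normr_ge0.
rewrite !big_cons; set X := \prod_(a <- s) (a + _); set Y := \prod_(a <- s) a.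
have -> : o * ((a + ir d * e) * X) = o * a * X + ir d * (o * e * X) by ring.
rewrite raddfD topZ mulrA -addrAC; apply: le_trans (ler_normD _ _) _.
have nd : `|(d%:C)%C| = (d%:C)%C :> C by rewrite ger0_norm// lecR; case/andP: d01.
rewrite mulrDl; apply: lerD; first exact: H1.
rewrite normrM nd mulrC; apply: ler_wpM2r; first by rewrite lecR; case/andP: d01.
rewrite -[top _](subrK (top (o * e * Y))).
apply: le_trans (ler_normD _ _) _; rewrite lerD2r.
apply: le_trans (H2 d d01) _; apply: ler_piMr => //; rewrite lecR.
by case/andP: d01.
Qed.

(** Every factor is pushed into the open cone by adding d e, and then d tends to 0. This version is
    needed because m-positivity consists of weak inequalities, so the forms may lie on the boundary
    of the cone. *)
Lemma garding_closed o (s : seq A) : hyperbolic o (size s) ->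
  (forall a, a \in s -> V a /\ forall t : R, 0 < t -> P o (size s) (a + ir t * e) != 0) ->
  0 <= top (o * \prod_(a <- s) a).
Proof.
move=> hyp cs; have [L L0 HL] := top_prod_shift_lipschitz o s.
have pos (d : R) : 0 < d -> 0 < top (o * \prod_(a <- s) (a + ir d * e)).
  move=> d0; rewrite -(big_map (fun a => a + ir d * e) xpredT id).
  apply: garding; rewrite size_map// => _ /mapP[a /cs[Va ca] ->]; split.
    by apply: VD => //; exact: VZ.
  by move=> t t0; rewrite -addrA -mulrDl -rmorphD/= -rmorphD ca// ltr_wpDr.
have /complex_realP[l lE] : L \is Num.real by exact: ger0_real.
have l0 : 0 <= l by rewrite -ler0c -lE.
move: HL; set q := top (o * \prod_(a <- s) a) => HL.
(* Being nonnegative in the complex field includes having zero imaginary part, so both parts of the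
   limit have to be controlled. *)
have key (d : R) : 0 < d <= 1 -> `|complex.Im q| <= l * d /\ - complex.Re q <= l * d.
  move=> /andP[d0 d1]; have := HL d; rewrite (ltW d0) d1 => /(_ isT).
  have := pos d d0; case: (top _) => x y; rewrite ltcE/= => /andP[/eqP -> x0].
  rewrite lE -(rmorphM (real_complex R)) => H.
  have := le_trans (normc_ge_Re _) H; rewrite lecR.
  have := le_trans (Im_le_norm _) H; rewrite lecR.
  rewrite distrC in H; have := le_trans (Im_le_norm _) H; rewrite lecR.
  case: q HL H => u v _ _ /=; rewrite !ler_norml; lra.
have lim (x : R) : (forall d : R, 0 < d <= 1 -> x <= l * d) -> x <= 0.
  move=> H; rewrite leNgt; apply/negP => x0.
  have xl : 0 < x / (l + 1) by rewrite divr_gt0//; lra.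
  have := H (Num.min 1 (x / (l + 1))).
  rewrite lt_min ltr01 xl ge_min lexx => /(_ isT).
  apply/negP; rewrite -ltNge (le_lt_trans (_ : _ <= l * (x / (l + 1))))//.
    by rewrite ler_wpM2l// ge_min lexx orbT.
  rewrite mulrA ltr_pdivrMr; last lra.
  rewrite mulrC ltr_pM2l//; lra.
rewrite lecE/=; apply/andP; split.
  by rewrite -normr_le0 lim// => d /key[].
by rewrite -oppr_le0 lim// => d /key[].
Qed.

End garding.

(** * Exterior algebra and m-positive forms *)

Section wedge_algebra.
Context {R : realType} {n : nat}.
Local Notation C := R[i].
Local Notation I := 'I_(n.*2).
Implicit Types (f g h : cform R n) (S D B : {set I}).

Definition inversions S D :=
  #|[pred p : I * I | [&& p.1 \in S, p.2 \in D & (p.2 < p.1)%N]]|.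

Definition form_basis S : cform R n := [ffun D : {set I} => (D == S)%:R].

Lemma form_basisE S D : form_basis S D = (D == S)%:R.
Proof. by rewrite ffunE. Qed.

Lemma wedgeE f g S : wedge f g S = \sum_(D : {set I} | D \subset S)
  (-1) ^+ inversions D (S :\: D)%SET * f D * g (S :\: D)%SET.
Proof. by rewrite ffunE. Qed.

Lemma form1E : form1 = form_basis finset.set0.
Proof. by []. Qed.

(* Otherwise conversion tests unfold the two finite functions. *)
#[local] Opaque form_basis wedge.

Lemma wedgeDl f f' g : wedge (f + f') g = wedge f g + wedge f' g.
Proof.
apply/ffunP => S; rewrite [RHS]ffunE !wedgeE -big_split; apply: eq_bigr => D _ /=.
by rewrite !ffunE mulrDr mulrDl.
Qed.

Lemma wedgeDr f g g' : wedge f (g + g') = wedge f g + wedge f g'.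
Proof.
apply/ffunP => S; rewrite [RHS]ffunE !wedgeE -big_split; apply: eq_bigr => D _ /=.
by rewrite !ffunE mulrDr.
Qed.

Lemma wedgeZl (c : C) f g : wedge (c *: f) g = c *: wedge f g.
Proof.
apply/ffunP => S; rewrite [RHS]ffunE !wedgeE scaler_sumr; apply: eq_bigr => D _ /=.
by rewrite !ffunE /GRing.scale /=; ring.
Qed.

Lemma wedgeZr (c : C) f g : wedge f (c *: g) = c *: wedge f g.
Proof.
apply/ffunP => S; rewrite [RHS]ffunE !wedgeE scaler_sumr; apply: eq_bigr => D _ /=.
by rewrite !ffunE /GRing.scale /=; ring.
Qed.

Lemma wedge0l g : wedge 0 g = 0.
Proof. by rewrite -(scale0r (0 : cform R n)) wedgeZl !scale0r. Qed.

Lemma wedge0r f : wedge f 0 = 0.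
Proof. by rewrite -(scale0r (0 : cform R n)) wedgeZr !scale0r. Qed.

Lemma wedgeNl f g : wedge (- f) g = - wedge f g.
Proof. by rewrite -scaleN1r wedgeZl scaleN1r. Qed.

Lemma wedgeNr f g : wedge f (- g) = - wedge f g.
Proof. by rewrite -scaleN1r wedgeZr scaleN1r. Qed.

Lemma wedge_suml (T : Type) (r : seq T) (P : pred T) (F : T -> cform R n) g :
  wedge (\sum_(i <- r | P i) F i) g = \sum_(i <- r | P i) wedge (F i) g.
Proof.
by rewrite (big_morph (wedge^~ g) (fun x y => wedgeDl x y g) (wedge0l g)).
Qed.

Lemma wedge_sumr (T : Type) (r : seq T) (P : pred T) (F : T -> cform R n) f :
  wedge f (\sum_(i <- r | P i) F i) = \sum_(i <- r | P i) wedge f (F i).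
Proof.
by rewrite (big_morph (wedge f) (wedgeDr f) (wedge0r f)).
Qed.

Lemma form_decomp f : f = \sum_S (f S *: form_basis S : cform R n).
Proof.
apply/ffunP => D; rewrite sum_ffunE.
have E S : (f S *: form_basis S) D = f S * (D == S)%:R by rewrite ffunE form_basisE.
rewrite (eq_bigr _ (fun S _ => E S)) (bigD1 D)// big1 => [|S SD].
  by rewrite eqxx mulr1; exact/esym/addr0.
by rewrite eq_sym (negbTE SD) mulr0.
Qed.

Lemma wedge_basis S D : wedge (form_basis S) (form_basis D) =
  if [disjoint S & D] then (-1) ^+ inversions S D *: form_basis (S :|: D)%SET else 0.
Proof.
apply/ffunP => U; rewrite wedgeE.
have [SU|SU] := boolP (S \subset U); last first.
  rewrite big1 => [|A AU]; last first.
    rewrite form_basisE; case: eqP => [AS|_]; last by rewrite mulr0 mul0r.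
    by rewrite -AS AU in SU.
  case: ifP => _; last by rewrite ffunE.
  rewrite ffunE form_basisE; case: eqP => [UE|_]; last by rewrite /GRing.scale/= mulr0.
  by rewrite UE finset.subsetUl in SU.
rewrite (bigD1 S)//= big1 ?addr0; last first.
  by move=> A /andP[_ AS]; rewrite form_basisE (negbTE AS) mulr0 mul0r.
rewrite !form_basisE eqxx mulr1.
have [SD|SD] := boolP [disjoint S & D].
  rewrite ffunE form_basisE; have -> : ((U :\: S)%SET == D) = (U == (S :|: D)%SET).
    apply/eqP/eqP => [<-|->].
      by rewrite -[LHS](finset.setID U S) finset.setIC (finset.setIidPl SU).
    rewrite finset.setDUl finset.setDv finset.set0U.
    by apply/finset.setDidPl; rewrite disjoint_sym.
  case: eqP => [UE|_]; last by rewrite /GRing.scale/= !mulr0.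
  rewrite /GRing.scale/= !mulr1; congr (_ ^+ _); rewrite /inversions.
  have -> // : (U :\: S)%SET = D.
  rewrite UE finset.setDUl finset.setDv finset.set0U.
  by apply/finset.setDidPl; rewrite disjoint_sym.
rewrite ffunE; case: eqP => [UE|_]; last by rewrite mulr0.
case/negP: SD; rewrite -UE disjoint_sym; apply/pred0P => x /=.
by rewrite !inE; case: (x \in S); rewrite ?andbF.
Qed.

Lemma inversionsUl S S' D : [disjoint S & S']%B ->
  inversions (S :|: S')%SET D = (inversions S D + inversions S' D)%N.
Proof.
move=> SS; rewrite /inversions -cardUI [X in (_ + X)%N]eq_card0 ?addn0; last first.
  move=> p; rewrite !inE; apply/negP => /andP[/and3P[pS _ _] /and3P[pS' _ _]].
  by move/pred0P : SS => /(_ p.1) /=; rewrite pS pS'.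
by apply: eq_card => p; rewrite !inE andb_orl.
Qed.

Lemma inversionsUr S D D' : [disjoint D & D']%B ->
  inversions S (D :|: D')%SET = (inversions S D + inversions S D')%N.
Proof.
move=> DD; rewrite /inversions -cardUI [X in (_ + X)%N]eq_card0 ?addn0; last first.
  move=> p; rewrite !inE; apply/negP => /andP[/and3P[_ pD _] /and3P[_ pD' _]].
  by move/pred0P : DD => /(_ p.2) /=; rewrite pD pD'.
by apply: eq_card => p; rewrite !inE; case: (p.1 \in S) => //=; rewrite andb_orl.
Qed.

Lemma inversionsC S D : [disjoint S & D]%B ->
  (inversions S D + inversions D S)%N = (#|S| * #|D|)%N.
Proof.
move=> SD; have -> : inversions D S =
    #|[pred p : I * I | [&& p.1 \in S, p.2 \in D & (p.1 < p.2)%N]]|.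
  rewrite /inversions -!sum1_card.
  rewrite (reindex_inj (h := fun p : I * I => (p.2, p.1))) /=; last first.
    by move=> [? ?] [? ?] [-> ->].
  by apply: eq_bigl => p; rewrite !inE/= andbCA.
rewrite -cardX /inversions -cardUI [X in (_ + X)%N]eq_card0 ?addn0; last first.
  move=> p; rewrite !inE; apply/negP => /andP[/and3P[_ _ p21] /and3P[_ _]].
  by rewrite ltnNge ltnW.
apply: eq_card => p; rewrite !inE; case: (boolP (p.1 \in S)) => //= pS.
case: (boolP (p.2 \in D)) => //= pD; rewrite -neq_ltn; apply/eqP => E.
by move/pred0P : SD => /(_ p.1) /=; rewrite pS -(val_inj E) pD.
Qed.

Lemma wedgeA : associative (@wedge R n).
Proof.
have dUl S D B : ([disjoint (D :|: B)%SET & S] = [disjoint D & S] && [disjoint B & S])%B.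
  apply/pred0P/andP => [H|[/pred0P H1 /pred0P H2] x]; last first.
    by have := H1 x; have := H2 x; rewrite /= !inE; case: (x \in D) (x \in B) => [] [].
  by split; apply/pred0P => x; have := H x; rewrite /= !inE;
     case: (x \in S) (x \in D) (x \in B) => [] [] [].
have dU S D B : ([disjoint S & (D :|: B)%SET] = [disjoint S & D] && [disjoint S & B])%B.
  by rewrite disjoint_sym dUl; congr (_ && _); rewrite disjoint_sym.
(* By trilinearity basis forms suffice; there both signs count the inversions between three pairwise
   disjoint index sets. *)
have base S D B : wedge (form_basis S) (wedge (form_basis D) (form_basis B)) =
    wedge (wedge (form_basis S) (form_basis D)) (form_basis B).
  rewrite (wedge_basis D B) (wedge_basis S D).
  have [DB|DB] := boolP [disjoint D & B]; have [SD|SD] := boolP [disjoint S & D].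
  - rewrite wedgeZl wedgeZr (wedge_basis S) (wedge_basis _ B) dU SD dUl DB andbT/=.
    have [SB|SB] := boolP [disjoint S & B].
      etransitivity; first exact: scalerA.
      etransitivity; last exact/esym/scalerA.
      have E : (S :|: (D :|: B) = S :|: D :|: B)%SET := finset.setUA S D B.
      rewrite E; congr (_ *: _); rewrite -!exprD inversionsUl// inversionsUr//.
      by congr (_ ^+ _); lia.
    by etransitivity; [exact: scaler0|exact/esym/scaler0].
  - by rewrite wedgeZr wedge_basis dU (negbTE SD) scaler0 wedge0l.
  - by rewrite wedgeZl wedge_basis dUl (negbTE DB) andbF scaler0 wedge0r.
  - by rewrite wedge0l wedge0r.
have base2 S D h : wedge (form_basis S) (wedge (form_basis D) h) =
    wedge (wedge (form_basis S) (form_basis D)) h.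
  rewrite (form_decomp h) !wedge_sumr; apply: eq_bigr => B _.
  by rewrite !wedgeZr base.
have base1 S g h : wedge (form_basis S) (wedge g h) = wedge (wedge (form_basis S) g) h.
  rewrite (form_decomp g) wedge_suml !wedge_sumr wedge_suml; apply: eq_bigr => D _.
  by rewrite wedgeZl !wedgeZr wedgeZl base2.
move=> f g h; rewrite (form_decomp f) !wedge_suml; apply: eq_bigr => S _.
by rewrite !wedgeZl base1.
Qed.

Lemma wedge1f : left_id form1 (@wedge R n).
Proof.
move=> f; rewrite {2}(form_decomp f) {1}(form_decomp f) wedge_sumr.
apply: eq_bigr => S _; rewrite wedgeZr; congr (_ *: _).
rewrite form1E.
rewrite wedge_basis finset.set0U (_ : [disjoint _ & _]%B); last first.
  by apply/pred0P => x; rewrite !inE.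
rewrite (_ : inversions _ _ = 0%N) ?expr0 ?scale1r//.
by apply: eq_card0 => p; rewrite !inE.
Qed.

Definition even_form : {pred cform R n} :=
  [pred f : cform R n | [forall S : {set I}, odd #|S| ==> (f S == 0)]].

Lemma even_formP f : reflect (forall S, odd #|S| -> f S = 0) (f \in even_form).
Proof.
apply: (iffP forallP) => H S; last by apply/implyP => /H ->.
by have /implyP /[apply] /eqP := H S.
Qed.

Lemma even_form_zmod : zmod_closed even_form.
Proof.
split=> [|f g /even_formP f0 /even_formP g0]; apply/even_formP => S oS.
  by rewrite ffunE.
by rewrite !ffunE f0// g0// subr0.
Qed.
HB.instance Definition _ := GRing.isZmodClosed.Build _ even_form even_form_zmod.

Lemma even_formZ (c : C) f : f \in even_form -> c *: f \in even_form.
Proof. by move=> /even_formP f0; apply/even_formP => S oS; rewrite ffunE f0// scaler0. Qed.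

Lemma even_form_wedge f g : f \in even_form -> g \in even_form ->
  wedge f g \in even_form.
Proof.
move=> /even_formP f0 /even_formP g0; apply/even_formP => S oS.
rewrite wedgeE big1// => D DS.
have := finset.cardsID D S; rewrite (finset.setIidPr DS) => E.
move: oS; rewrite -E oddD; case: (boolP (odd #|D|)) => [oD _|oD /= oSD].
  by rewrite f0// mulr0 mul0r.
by rewrite g0// mulr0.
Qed.

Lemma even_form1 : form1 \in even_form.
Proof.
by apply/even_formP => S; rewrite ffunE; case: eqP => // ->; rewrite cards0.
Qed.

(** Swapping basis forms on [S] and [D] costs the sign (-1)^(|S| |D|), which is 1 when |S| is even;
    only one of the two forms has to be even. *)
Lemma even_wedgeC f g : f \in even_form -> wedge f g = wedge g f.
Proof.
move=> /even_formP f0; rewrite (form_decomp g) wedge_sumr wedge_suml.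
apply: eq_bigr => D _; rewrite wedgeZl wedgeZr; congr (_ *: _).
rewrite (form_decomp f) wedge_sumr wedge_suml; apply: eq_bigr => S _.
rewrite wedgeZl wedgeZr; have [/f0 ->|eS] := boolP (odd #|S|); first by rewrite !scale0r.
congr (_ *: _); rewrite (wedge_basis S D) (wedge_basis D S) disjoint_sym.
have [DS|_] := boolP [disjoint D & S]; last by [].
have E : (S :|: D = D :|: S)%SET := finset.setUC S D.
rewrite E; congr (_ *: _); rewrite -signr_odd -[RHS]signr_odd.
have := congr1 odd (inversionsC DS); rewrite oddD oddM (negbTE eS) andbF.
by case: (odd (inversions S D)); case: (odd (inversions D S)).
Qed.

End wedge_algebra.

(** * The commutative ring of even forms *)

Section even_forms.
Context {R : realType} {n : nat}.
Local Notation C := R[i].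

#[local] Opaque form_basis wedge.

(* Forms of even degree are a commutative ring, to which Garding's inequality
   applies; all forms would only be a graded commutative one. *)
Record evenform := EvenForm { ev_val : cform R n; _ : ev_val \in even_form }.

HB.instance Definition _ := [isSub for ev_val].
HB.instance Definition _ := [Choice of evenform by <:].
HB.instance Definition _ := [SubChoice_isSubZmodule of evenform by <:].

Implicit Types x y : evenform.

Definition ev_mul x y := EvenForm (even_form_wedge (valP x) (valP y)).
Definition ev_const (c : C) := EvenForm (even_formZ c even_form1).

Let ev_mulA : associative ev_mul.
Proof. by move=> x y z; apply/val_inj; exact: wedgeA. Qed.

Let ev_mulC : commutative ev_mul.
Proof. by move=> x y; apply/val_inj; apply: even_wedgeC; exact: valP. Qed.

Let ev_mul1 : left_id (EvenForm even_form1) ev_mul.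
Proof. by move=> x; apply/val_inj; exact: wedge1f. Qed.

Let ev_mulDl : left_distributive ev_mul +%R.
Proof. by move=> x y z; apply/val_inj; exact: wedgeDl. Qed.

Let ev_1neq0 : EvenForm even_form1 != 0.
Proof.
apply/eqP => /(congr1 (fun x => ev_val x finset.set0)); rewrite !ffunE eqxx.
by apply/eqP; exact: oner_neq0.
Qed.

HB.instance Definition _ :=
  GRing.Zmodule_isComNzRing.Build evenform ev_mulA ev_mulC ev_mul1 ev_mulDl ev_1neq0.

Lemma ev_val_inj : injective ev_val.
Proof. exact: val_inj. Qed.

Lemma ev_valM x y : ev_val (x * y) = wedge (ev_val x) (ev_val y).
Proof. by []. Qed.

Lemma ev_valD x y : ev_val (x + y) = ev_val x + ev_val y.
Proof. by []. Qed.

Lemma ev_val_sum (T : Type) (r : seq T) (P : pred T) (F : T -> evenform) :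
  ev_val (\sum_(i <- r | P i) F i) = \sum_(i <- r | P i) ev_val (F i).
Proof. exact: (big_morph ev_val ev_valD erefl). Qed.

Lemma ev_val_prod (T : Type) (r : seq T) (P : pred T) (F : T -> evenform) :
  ev_val (\prod_(i <- r | P i) F i) = \big[wedge/form1]_(i <- r | P i) ev_val (F i).
Proof. exact: (big_morph ev_val ev_valM erefl). Qed.

Lemma ev_valX x k : ev_val (x ^+ k) = wedge_exp (ev_val x) k.
Proof. by elim: k => // k IH; rewrite exprS ev_valM IH. Qed.

Let ev_const_additive : {morph ev_const : c d / c - d}.
Proof. by move=> c d; apply/val_inj; exact: scalerBl. Qed.

Let ev_const_multiplicative : multiplicative ev_const.
Proof.
split=> [c d|]; apply/val_inj; last exact: scale1r.
by rewrite /= wedgeZl wedge1f scalerA.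
Qed.

HB.instance Definition _ := GRing.isZmodMorphism.Build C evenform ev_const ev_const_additive.
HB.instance Definition _ := GRing.isMultiplicative.Build C evenform ev_const ev_const_multiplicative.

Lemma ev_val_constM c x : ev_val (ev_const c * x) = c *: ev_val x.
Proof. by rewrite ev_valM wedgeZl wedge1f. Qed.

Definition ev_top x : C := top_coef (ev_val x).

Let ev_top_additive : {morph ev_top : x y / x - y}.
Proof. by move=> x y; rewrite /ev_top /top_coef !ffunE. Qed.

HB.instance Definition _ := GRing.isZmodMorphism.Build evenform C ev_top ev_top_additive.

Lemma ev_topZ c x : ev_top (ev_const c * x) = c * ev_top x.
Proof. by rewrite /ev_top ev_val_constM /top_coef ffunE. Qed.

End even_forms.
Arguments evenform : clear implicits.

Section square_zero.
Context {A : comNzRingType}.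
Implicit Types (x y : A).

Lemma exprD_square0 x y k : y * y = 0 -> (x + y) ^+ k.+1 = x ^+ k.+1 + k.+1%:R * x ^+ k * y.
Proof.
move=> yy; elim: k => [|k IH]; first by rewrite !expr1 expr0 !mul1r.
rewrite exprS IH.
have -> : (x + y) * (x ^+ k.+1 + k.+1%:R * x ^+ k * y) =
  x ^+ k.+2 + (k.+1%:R + 1) * x ^+ k.+1 * y + k.+1%:R * x ^+ k * (y * y).
  by rewrite !exprS; ring.
by rewrite yy mulr0 addr0 natr1.
Qed.

(** The multinomial theorem when every square vanishes: only the squarefree term survives, with
    coefficient N! for N summands. *)
Lemma exp_sum_square0 (T : Type) (r : seq T) (y : T -> A) :
  (forall i, y i * y i = 0) ->
  (\sum_(i <- r) y i) ^+ size r = (size r)`!%:R * \prod_(i <- r) y i.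
Proof.
move=> yy; elim: r => [|i r IH]; first by rewrite !big_nil expr0 fact0 mul1r.
rewrite !big_cons addrC exprD_square0// IH.
have -> : (\sum_(j <- r) y j) ^+ (size r).+1 = 0.
  rewrite exprS IH mulrCA; apply/eqP.
  have -> : (\sum_(j <- r) y j) * \prod_(j <- r) y j = 0; last by rewrite mulr0.
  elim: r {IH} => [|j r IH]; first by rewrite !big_nil mul0r.
  rewrite !big_cons mulrDl mulrA yy mul0r add0r mulrCA IH mulr0//.
by rewrite add0r factS natrM; ring.
Qed.

End square_zero.

(** * Covectors, conjugation and (1,1)-forms *)

Section covectors.
Context {R : realType} {n : nat}.
Local Notation C := R[i].
Local Notation I := 'I_(n.*2).
Implicit Types (f g h : cform R n).

Lemma dcoordE i : dcoord i = form_basis [set i]%SET :> cform R n.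
Proof. by []. Qed.

#[local] Opaque form_basis wedge.

Definition covector f := exists c : I -> C, f = \sum_i (c i *: dcoord i : cform R n).

Lemma wedge_dcoordC (i k : I) : wedge (dcoord i) (dcoord k) =
  - wedge (dcoord k) (dcoord i) :> cform R n.
Proof.
rewrite !dcoordE (wedge_basis [set i]%SET [set k]%SET) (wedge_basis [set k]%SET [set i]%SET).
have [->|ik] := eqVneq i k.
  have -> : ([disjoint [set k]%SET & [set k]%SET] = false)%B.
    by apply/negbTE/negP => /pred0P /(_ k); rewrite /= !inE eqxx.
  by rewrite oppr0.
have dis (a b : I) : a != b -> [disjoint [set a]%SET & [set b]%SET]%B.
  move=> ab; apply/pred0P => x; rewrite /= !inE.
  by case: eqP => // ->; exact/negbTE.
rewrite (dis _ _ ik) (dis k i) 1?eq_sym//.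
have inv (a b : I) : inversions [set a]%SET [set b]%SET = (b < a)%N.
  rewrite /inversions; case: ltnP => ba.
    transitivity #|pred1 (a, b)|; last exact: card1.
    apply: eq_card => -[x y]; rewrite !inE/= xpair_eqE.
    by case: eqP => // ->; case: eqP => // ->; rewrite ba.
  apply: eq_card0 => -[x y]; rewrite !inE/=.
  by case: eqP => // ->; case: eqP => // ->; rewrite ltnNge ba.
rewrite !inv; have E : ([set i] :|: [set k] = [set k] :|: [set i])%SET := finset.setUC _ _.
rewrite E; case: ltngtP => [ki|ki|/val_inj ki]; last by rewrite ki eqxx in ik.
  by rewrite expr1 expr0 scaleN1r scale1r.
by rewrite expr1 expr0 scaleN1r scale1r opprK.
Qed.

Lemma covectorC f g : covector f -> covector g -> wedge f g = - wedge g f.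
Proof.
move=> [c ->] [d ->]; rewrite wedge_suml wedge_sumr -sumrN; apply: eq_bigr => i _.
rewrite wedgeZl wedgeZr wedge_sumr wedge_suml -scalerN -sumrN; congr (_ *: _).
by apply: eq_bigr => k _; rewrite wedgeZl wedgeZr wedge_dcoordC scalerN.
Qed.

Lemma covector_sq f : covector f -> wedge f f = 0.
Proof.
move=> cf; have : wedge f f *+ 2 = 0 by rewrite mulr2n {2}(covectorC cf cf) subrr.
move=> /eqP; rewrite -scaler_nat scaler_eq0 pnatr_eq0 /= => /eqP//.
Qed.

Lemma covectorD f g : covector f -> covector g -> covector (f + g).
Proof.
move=> [c ->] [d ->]; exists (fun i => c i + d i); rewrite -big_split.
by apply: eq_bigr => i _ /=; rewrite scalerDl.
Qed.

Lemma covectorZ (a : C) f : covector f -> covector (a *: f).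
Proof.
move=> [c ->]; exists (fun i => a * c i); rewrite scaler_sumr.
by apply: eq_bigr => i _; rewrite scalerA.
Qed.

Lemma covector0 : covector 0.
Proof. by exists (fun=> 0); rewrite big1// => i _; rewrite scale0r. Qed.

Lemma covector_sum (T : Type) (r : seq T) (F : T -> cform R n) :
  (forall i, covector (F i)) -> covector (\sum_(i <- r) F i).
Proof.
by move=> cF; elim/big_ind: _ => //; [exact: covector0|exact: covectorD].
Qed.

Lemma covector_dcoord i : covector (dcoord i).
Proof.
exists (fun k => (k == i)%:R); rewrite (bigD1 i)//= eqxx scale1r big1 ?addr0//.
by move=> k /negbTE ->; rewrite scale0r.
Qed.

Lemma covector_dz (j : 'I_n) : covector (dz j).
Proof. by apply: covectorD; [|apply: covectorZ]; exact: covector_dcoord. Qed.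

Lemma covector_dzbar (j : 'I_n) : covector (dzbar j).
Proof.
apply: covectorD; first exact: covector_dcoord.
by rewrite -scaleN1r; do 2! apply: covectorZ; exact: covector_dcoord.
Qed.

Lemma wedge_covector_even f g : covector f -> covector g -> wedge f g \in even_form.
Proof.
have supp h (S : {set I}) : covector h -> #|S| != 1%N -> h S = 0.
  move=> [c ->] S1; rewrite sum_ffunE big1// => i _.
  rewrite ffunE dcoordE form_basisE; case: eqP => [SE|_]; last by rewrite scaler0.
  by rewrite SE cards1 in S1.
move=> cf cg; apply/even_formP => S oS; rewrite wedgeE big1// => D DS.
have [D1|D1] := eqVneq #|D| 1%N; last by rewrite (supp f)// mulr0 mul0r.
rewrite (supp g) ?mulr0//.
have := finset.cardsID D S; rewrite (finset.setIidPr DS) D1 => E.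
by move: oS; rewrite -E; apply: contraTneq => ->.
Qed.

Lemma wedge_covector_sq f g : covector f -> covector g ->
  wedge (wedge f g) (wedge f g) = 0.
Proof.
move=> cf cg; rewrite -wedgeA (wedgeA g f g) (covectorC cg cf) wedgeNl wedgeNr.
by rewrite -(wedgeA f g g) (covector_sq cg) !wedge0r oppr0.
Qed.

Definition conj_form f : cform R n := [ffun S => (f S)^*%C].

Lemma conj_formD f g : conj_form (f + g) = conj_form f + conj_form g.
Proof. by apply/ffunP => S; rewrite !ffunE rmorphD. Qed.

Lemma conj_formZ (a : C) f : conj_form (a *: f) = (a^*%C) *: conj_form f.
Proof. by apply/ffunP => S; rewrite !ffunE rmorphM. Qed.

Lemma conj_form_sum (T : Type) (r : seq T) (F : T -> cform R n) :
  conj_form (\sum_(i <- r) F i) = \sum_(i <- r) conj_form (F i).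
Proof.
apply: (big_morph conj_form conj_formD).
by apply/ffunP => S; rewrite !ffunE rmorph0.
Qed.

Lemma conj_form_wedge f g : conj_form (wedge f g) = wedge (conj_form f) (conj_form g).
Proof.
apply/ffunP => S; rewrite ffunE !wedgeE rmorph_sum; apply: eq_bigr => D _.
by rewrite !rmorphM/= rmorphXn rmorphN1 !ffunE.
Qed.

Lemma conj_dcoord i : conj_form (dcoord i) = dcoord i.
Proof.
by apply/ffunP => S; rewrite ffunE dcoordE form_basisE; case: eqP => _; rewrite ?rmorph0 ?rmorph1.
Qed.

Lemma conj_dz (j : 'I_n) : conj_form (dz j) = dzbar j.
Proof.
rewrite /dz /dzbar conj_formD conj_formZ !conj_dcoord; congr (_ + _).
rewrite -scaleNr; congr (_ *: _); apply/eqP; rewrite eq_complex/= oppr0 !eqxx//.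
Qed.

Lemma conj_dzbar (j : 'I_n) : conj_form (dzbar j) = dz j.
Proof.
rewrite -conj_dz; apply/ffunP => S; rewrite !ffunE.
by set a := _ + _; exact: conjcK.
Qed.

Lemma real_formP f : real_form f <-> conj_form f = f.
Proof.
split=> [rf|cf S].
  apply/ffunP => S; rewrite ffunE; have /complex_realP[x ->] := rf S.
  exact: conjc_real.
have : conj_form f S = f S by rewrite cf.
rewrite ffunE; case: (f S) => a b /= [ab]; rewrite complex_real; apply/eqP; lra.
Qed.

Lemma form11D (a b : 'M[C]_n) : form11 (a + b) = form11 a + form11 b.
Proof.
rewrite /form11 -big_split; apply: eq_bigr => j _ /=.
by rewrite -big_split; apply: eq_bigr => k _ /=; rewrite mxE scalerDl.
Qed.

Lemma form11Z (c : C) (a : 'M[C]_n) : form11 (c *: a) = c *: form11 a.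
Proof.
rewrite /form11 scaler_sumr; apply: eq_bigr => j _ /=.
by rewrite scaler_sumr; apply: eq_bigr => k _ /=; rewrite mxE scalerA.
Qed.

Lemma form11_even (a : 'M[C]_n) : form11 a \in even_form.
Proof.
apply: rpred_sum => j _; apply: rpred_sum => k _; apply: even_formZ.
by apply: wedge_covector_even; [exact: covector_dz|exact: covector_dzbar].
Qed.

Lemma form11_rank1 (u v : 'I_n -> C) :
  form11 (\matrix_(j, k) (u j * v k)) =
  wedge (\sum_j (u j *: dz j : cform R n)) (\sum_k (v k *: dzbar k : cform R n)).
Proof.
rewrite wedge_suml; apply: eq_bigr => j _; rewrite wedge_sumr.
by apply: eq_bigr => k _; rewrite mxE wedgeZl wedgeZr scalerA.
Qed.

Lemma conj_form11 (a : 'M[C]_n) : conj_form (form11 a) = - form11 (map_mx conjc a)^T.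
Proof.
rewrite /form11 exchange_big conj_form_sum -sumrN; apply: eq_bigr => j _.
rewrite conj_form_sum -sumrN; apply: eq_bigr => k _; rewrite conj_formZ.
rewrite conj_form_wedge conj_dz conj_dzbar !mxE -scalerN; congr (_ *: _).
by apply: covectorC; [exact: covector_dzbar|exact: covector_dz].
Qed.

End covectors.

(** * Real (1,1)-forms and Hermitian matrices *)

Section hermitian_forms.
Import sesquilinear.
Local Open Scope sesquilinear_scope.
Context {R : realType} {n : nat}.
Local Notation C := R[i].
Local Notation I := 'I_(n.*2).
Local Notation E := (evenform R n).
Implicit Types (h a : 'M[C]_n) (x : E).

#[local] Opaque form_basis wedge.

Let conjcM (u v : C) : ((u * v)^*)%C = (u^*)%C * (v^*)%C.
Proof. exact: rmorphM. Qed.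

Let conjcB (u v : C) : ((u - v)^*)%C = (u^*)%C - (v^*)%C.
Proof. exact: rmorphB. Qed.

(** The factor 2i is the one in [ddc]: the identity matrix gives beta. It also compensates the sign
    in conj(dz_j /\ dzbar_k) = -dz_k /\ dzbar_j, so that Hermitian matrices give real forms. *)
Definition ev11 a : E := EvenForm (even_formZ (2 * 'i)%C (form11_even a)).

Lemma ev_val_beta : ev_val (ev11 1%:M) = beta.
Proof. by rewrite /beta ddc_sqnorm. Qed.

Lemma ev11D a b : ev11 (a + b) = ev11 a + ev11 b.
Proof. by apply: ev_val_inj; rewrite /= form11D scalerDr. Qed.

Lemma ev11Z (c : C) a : ev11 (c *: a) = ev_const c * ev11 a.
Proof. by apply: ev_val_inj; rewrite /= form11Z wedgeZl wedge1f scalerA mulrC -scalerA. Qed.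

Lemma ev11_sum (T : Type) (r : seq T) (F : T -> 'M[C]_n) :
  ev11 (\sum_(i <- r) F i) = \sum_(i <- r) ev11 (F i).
Proof.
apply: (big_morph ev11 ev11D).
by rewrite -(scale0r (0 : 'M[C]_n)) ev11Z rmorph0 mul0r.
Qed.

Lemma ev11_rank1_sq (u v : 'I_n -> C) :
  ev11 (\matrix_(j, k) (u j * v k)) * ev11 (\matrix_(j, k) (u j * v k)) = 0.
Proof.
apply: ev_val_inj; rewrite ev_valM /= wedgeZl wedgeZr form11_rank1 wedge_covector_sq ?scaler0//.
  by apply: covector_sum => j; apply: covectorZ; exact: covector_dz.
by apply: covector_sum => j; apply: covectorZ; exact: covector_dzbar.
Qed.

Definition hermitian h := forall j k, h k j = (h j k)^*%C.

Definition real11 x := real_form11 (ev_val x).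

Lemma conj_ev11 h : hermitian h -> conj_form (ev_val (ev11 h)) = ev_val (ev11 h).
Proof.
move=> hh; rewrite /= conj_formZ conj_form11 scalerN -scaleNr; congr (_ *: form11 _).
  by apply/eqP; rewrite eq_complex /=; apply/andP; split; apply/eqP; ring.
by apply/matrixP => j k; rewrite !mxE -hh.
Qed.

Lemma real11_ev11 h : hermitian h -> real11 (ev11 h).
Proof.
move=> hh; split; first by apply/real_formP/conj_ev11.
by exists ((2 * 'i)%C *: h); rewrite form11Z.
Qed.

Lemma real11P x : real11 x -> exists2 h, hermitian h & x = ev11 h.
Proof.
move=> [/real_formP xr [a xa]].
pose i2 : C := (2 * 'i)%C.
have i20 : i2 != 0 by rewrite mulf_neq0 ?pnatr_eq0// eq_complex/= oner_eq0 andbF.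
(* The Hermitian part of [a] divided by 2i: since the form is real it equals the average of itself
   and its conjugate, and that average has this matrix. Injectivity of [form11] is thereby
   avoided. *)
pose h := (i2^-1 / 2) *: (a - (map_mx conjc a)^T).
have ic : (i2^-1)^*%C = - i2^-1.
  rewrite conjc_inv -invrN; congr (_^-1).
  by apply/eqP; rewrite eq_complex /=; apply/andP; split; apply/eqP; ring.
exists h => [j k|].
  rewrite !mxE !conjcM ic conjcB conjcK conjc_inv conjc_nat; ring.
apply: ev_val_inj; rewrite /= -/i2 form11Z form11D -scaleN1r form11Z scaleN1r -conj_form11.
rewrite -xa xr; have scaleK (v : cform R n) : v = i2 *: ((i2^-1 / 2) *: (v + v)).
  by apply/ffunP => S; rewrite !ffunE /GRing.scale/=; field.
exact: scaleK.
Qed.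

Lemma real11D x y : real11 x -> real11 y -> real11 (x + y).
Proof.
move=> /real11P[h hh ->] /real11P[h' hh' ->]; rewrite -ev11D; apply: real11_ev11.
by move=> j k; rewrite !mxE hh hh' rmorphD.
Qed.

Lemma real11Z (r : R) x : real11 x -> real11 (ev_const (r%:C)%C * x).
Proof.
move=> /real11P[h hh ->]; rewrite -ev11Z; apply: real11_ev11.
by move=> j k; rewrite !mxE hh conjcM conjc_real.
Qed.

Lemma real11_beta : real11 (ev11 1%:M).
Proof.
apply: real11_ev11 => j k; rewrite !mxE eq_sym.
by case: eqP => _; rewrite ?conjc0 ?conjc1.
Qed.

(* In a unitary coframe diagonalizing [h], both forms are combinations of the
   same rank one forms [B l], whose squares vanish. *)
Lemma ev11_spectral h : hermitian h -> exists (B : 'I_n -> E) (d : 'I_n -> R),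
  [/\ forall l, B l * B l = 0, ev11 1%:M = \sum_l B l,
      ev11 h = \sum_l ev_const ((d l)%:C)%C * B l & \tr h = \sum_l ((d l)%:C)%C].
Proof.
move=> hh; have hs : h \is hermsymmx.
  apply/is_hermitianmxP; rewrite expr0 scale1r; apply/matrixP => j k.
  by rewrite !mxE hh.
have /orthomx_spectralP := hermitian_normalmx hs.
have := spectral_unitarymx h; set P := spectralmx h => uP.
have /mxOverP dR := hermitian_spectral_diag_real hs.
set D := spectral_diag h in dR *.
rewrite invmx_unitary// => hE.
have PP : P^t* *m P = 1%:M.
  by rewrite -invmx_unitary// mulVmx// unitarymx_unit.
pose G l : 'M[C]_n := \matrix_(j, k) ((P l j)^*%C * P l k).
have GE (c : 'rV[C]_n) : P^t* *m diag_mx c *m P = \sum_l c 0 l *: G l.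
  apply/matrixP => j k; rewrite mul_mx_diag mxE summxE; apply: eq_bigr => l _.
  by rewrite !mxE mulrAC mulrC.
have dE l : D 0 l = ((complex.Re (D 0 l))%:C)%C by rewrite RRe_real.
exists (fun l => ev11 (G l)), (fun l => complex.Re (D 0 l)); split.
- by move=> l; exact: ev11_rank1_sq.
- rewrite -ev11_sum; congr ev11; rewrite -PP -[X in X *m P]mulmx1.
  by rewrite -diag_const_mx GE; apply: eq_bigr => l _; rewrite mxE scale1r.
- rewrite [in LHS]hE GE ev11_sum; apply: eq_bigr => l _.
  by rewrite ev11Z -dE.
- rewrite [in LHS]hE mxtrace_mulC mulmxA -invmx_unitary// mulmxV ?mul1mx ?unitarymx_unit//.
  by rewrite mxtrace_diag; apply: eq_bigr => l _; rewrite -dE.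
Qed.

End hermitian_forms.

(** * Hyperbolicity of the top power and Gårding's inequality for m-positive forms *)

Section m_positive_forms.
Context {R : realType} {n : nat}.
Local Notation C := R[i].
Local Notation E := (evenform R n).
Local Notation betaE := (ev11 1%:M : E).
Implicit Types (x : E) (h : 'M[C]_n).

Lemma wedge_dxdy (j : 'I_n) : wedge (dcoord (xidx j)) (dcoord (yidx j)) =
  form_basis [set xidx j; yidx j]%SET :> cform R n.
Proof.
rewrite !dcoordE (wedge_basis [set xidx j]%SET [set yidx j]%SET).
have dis : [disjoint [set xidx j]%SET & [set yidx j]%SET]%B.
  apply/pred0P => i; rewrite /= !inE; case: eqP => // ->.
  by apply/eqP => /(congr1 val) /=; lia.
have inv : inversions [set xidx j]%SET [set yidx j]%SET = 0%N.
  apply: eq_card0 => -[i k]; rewrite !inE/=.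
  by case: eqP => // ->; case: eqP => // ->; rewrite /= ltnNge leqnSn.
by rewrite dis inv expr0; exact: scale1r.
Qed.

#[local] Opaque form_basis wedge.

Lemma form_basis_xy_even (j : 'I_n) : form_basis [set xidx j; yidx j]%SET \in @even_form R n.
Proof.
by rewrite -wedge_dxdy; apply: wedge_covector_even; exact: covector_dcoord.
Qed.

Definition area_form (j : 'I_n) : E := EvenForm (form_basis_xy_even j).

Lemma betaE_area : betaE = \sum_j ev_const 4 * area_form j.
Proof.
apply: ev_val_inj; rewrite ev_val_sum /= /form11 scaler_sumr; apply: eq_bigr => j _.
rewrite wedgeZl wedge1f (bigD1 j)//= [X in _ + X]big1; last first.
  by move=> k kj; rewrite mxE eq_sym (negbTE kj) scale0r.
rewrite mxE eqxx scale1r addr0 -wedge_dxdy /dz /dzbar.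
set dx := dcoord (xidx j); set dy := dcoord (yidx j).
have cx : covector dx := covector_dcoord _; have cy : covector dy := covector_dcoord _.
rewrite wedgeDl !wedgeDr !wedgeNr !wedgeZl !wedgeZr (covector_sq cx) (covector_sq cy).
rewrite (covectorC cy cx); move: (wedge dx dy) => w.
by apply/ffunP => S; rewrite !ffunE /GRing.scale/=; case: (w S) => u v;
  apply/eqP; rewrite eq_complex /=; apply/andP; split; apply/eqP; ring.
Qed.

Lemma ev_top_area : ev_top (\prod_j area_form j) = 1.
Proof.
(* The coordinates are ordered x_1, y_1, x_2, y_2, ..., so multiplying by the area form of index k
   on the right creates no inversion, and the product of the first k area forms fills exactly the
   first 2k coordinates. *)
have H k : (k <= n)%N -> ev_val (\prod_(j < n | (j < k)%N) area_form j) =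
    form_basis [set i : 'I_(n.*2) | (i < k.*2)%N]%SET.
  elim: k => [_|k IH kn].
    rewrite big_pred0// /= form1E; congr form_basis.
  have -> : \prod_(j < n | (j < k.+1)%N) area_form j =
      (\prod_(j < n | (j < k)%N) area_form j) * area_form (Ordinal kn).
    rewrite (bigD1 (Ordinal kn))//= mulrC; congr (_ * _).
    by apply: eq_bigl => j; rewrite -val_eqE/= ltnS ltn_neqAle andbC.
  rewrite ev_valM IH ?(ltnW kn)//.
  pose S := [set i : 'I_(n.*2) | (i < k.*2)%N]%SET.
  pose D := [set xidx (Ordinal kn); yidx (Ordinal kn)]%SET.
  transitivity (wedge (form_basis S) (form_basis D) : cform R n); first by [].
  rewrite (wedge_basis S D).
  have dis : [disjoint S & D]%B.
    apply/pred0P => i; rewrite /= !inE -!val_eqE/=.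
    by apply/negbTE/negP => /andP[ik /orP[/eqP|/eqP]]; lia.
  have inv : inversions S D = 0%N.
    apply: eq_card0 => -[i l]; rewrite !inE/= -!val_eqE/=; apply/negP.
    by move=> /and3P[ik /orP[/eqP|/eqP] ->]; lia.
  rewrite dis inv expr0; etransitivity; first exact: scale1r.
  congr form_basis; apply/finset.setP => i; rewrite !inE -!val_eqE/=.
  by apply/idP/idP; lia.
have -> : \prod_j area_form j = \prod_(j < n | (j < n)%N) area_form j.
  by apply: eq_bigl => j; rewrite ltn_ord.
rewrite /ev_top /top_coef H// form_basisE.
rewrite (_ : (_ == _) = true)//; apply/eqP/finset.setP => i; rewrite !inE.
by have := ltn_ord i; lia.
Qed.

(** In a diagonalizing coframe the top power of a form is its determinant, the product of the
    eigenvalues, times beta^n. *)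
Let exp_sum_scaled (B : 'I_n -> E) (c : 'I_n -> C) : (forall l, B l * B l = 0) ->
  (\sum_l ev_const (c l) * B l) ^+ n = ev_const (\prod_l c l) * (\sum_l B l) ^+ n.
Proof.
move=> BB; have sq (y : 'I_n -> E) : (forall l, y l * y l = 0) ->
    (\sum_l y l) ^+ n = n`!%:R * \prod_l y l.
  move=> yy; have := exp_sum_square0 (index_enum 'I_n) yy.
  suff -> : size (index_enum 'I_n) = n by [].
  by have := size_enum_ord n; rewrite enumT.
rewrite !sq//; first by rewrite big_split/= rmorph_prod; ring.
by move=> l; rewrite mulrACA BB mulr0.
Qed.

Lemma ev_top_beta_gt0 : 0 < ev_top (betaE ^+ n).
Proof.
have asq j : area_form j * area_form j = 0.
  apply: ev_val_inj; rewrite ev_valM /= -wedge_dxdy.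
  by rewrite wedge_covector_sq//; exact: covector_dcoord.
rewrite betaE_area exp_sum_scaled// ev_topZ.
have := exp_sum_square0 (index_enum 'I_n) asq.
have -> : size (index_enum 'I_n) = n by have := size_enum_ord n; rewrite enumT.
move=> ->.
rewrite mulr_natl raddfMn/= ev_top_area mulr_gt0//.
by apply: prodr_gt0 => j _; rewrite ltr0n.
Qed.

(** On real forms the polynomial in question is the product of the d_l + t times a positive number,
    with real eigenvalues d_l. *)
Lemma hyperbolic_beta : hyperbolic (@ev_const R n) (@ev_top R n) real11 betaE 1 n.
Proof.
split; first by rewrite mul1r ev_top_beta_gt0.
move=> _ t /real11P[h hh ->] t0; rewrite mul1r.
have [B [d [BB bE hE _]]] := ev11_spectral hh.
have -> : ev11 h + ev_const t * betaE = \sum_l ev_const ((d l)%:C%C + t) * B l.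
  rewrite hE bE mulr_sumr -big_split; apply: eq_bigr => l _.
  by rewrite /= rmorphD mulrDl.
rewrite exp_sum_scaled// -bE; set c := \prod_l _.
suff c0 : c != 0.
  suff : ev_top (ev_const c * betaE ^+ n) != 0 by [].
  by rewrite ev_topZ mulf_neq0// gt_eqF// ev_top_beta_gt0.
apply/prodf_neq0 => l _; apply: contraTneq t0 => dt.
have -> : t = - ((d l)%:C%C) by apply/eqP; rewrite -addr_eq0 addrC dt.
by rewrite /= oppr0 ltxx.
Qed.

Lemma ev_top_trace h : hermitian h -> (0 < n)%N ->
  n%:R * ev_top (betaE ^+ n.-1 * ev11 h) = \tr h * ev_top (betaE ^+ n).
Proof.
move=> hh n0; have [B [d [BB bE hE ->]]] := ev11_spectral hh.
rewrite hE mulr_sumr raddf_sum mulr_sumr mulr_suml; apply: eq_bigr => l _.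
rewrite mulrCA /= ev_topZ mulrCA; congr (_ * _).
(* (beta + B_l)^n is computed twice: as the determinant 2 times beta^n, and by the binomial formula
   with B_l^2 = 0. Comparison gives n beta^(n-1) B_l = beta^n, which is the claim for a single rank
   one form. *)
have := exp_sum_scaled (fun k => 1 + (k == l)%:R) BB.
have -> : \sum_k ev_const (1 + (k == l)%:R) * B k = betaE + B l.
  rewrite bE; under eq_bigr do rewrite rmorphD rmorph1 mulrDl mul1r.
  rewrite big_split/=; congr (_ + _); rewrite (bigD1 l)//= eqxx rmorph1 mul1r.
  by rewrite big1 ?addr0// => k /negbTE ->; rewrite rmorph0 mul0r.
rewrite -bE; have -> : \prod_k (1 + (k == l)%:R) = 2%:R :> C.
  rewrite (bigD1 l)//= eqxx big1 ?mulr1// => k /negbTE ->.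
  by rewrite addr0.
have := exprD_square0 betaE n.-1 (BB l); rewrite (prednK n0) rmorph_nat => -> E2.
have <- : n%:R * betaE ^+ n.-1 * B l = betaE ^+ n.
  by apply: (@addrI _ (betaE ^+ n)); rewrite E2; ring.
by rewrite -mulrA mulr_natl [RHS](raddfMn ev_top) mulr_natl.
Qed.

Lemma m_positiveP m (alpha : cform R n) : m_positive m alpha ->
  exists2 x : E, ev_val x = alpha & real11 x /\ forall k, (1 <= k <= m)%N ->
    0 <= ev_top (x ^+ k * betaE ^+ (n - k)).
Proof.
move=> [ra pos]; have [_ [a aE]] := ra.
have ae : alpha \in even_form by rewrite aE form11_even.
exists (EvenForm ae) => //; split=> // k km.
by rewrite /ev_top ev_valM !ev_valX ev_val_beta /=; exact: pos.
Qed.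

(* Gårding's inequality for the polarization of [alpha ^ m /\ beta ^ (n - m)]. *)
Lemma garding_m_positive m (s : seq E) : (m <= n)%N -> size s = m ->
  (forall x, x \in s -> real11 x /\ forall k, (1 <= k <= m)%N ->
    0 <= ev_top (x ^+ k * betaE ^+ (n - k))) ->
  0 <= ev_top (betaE ^+ (n - m) * \prod_(x <- s) x).
Proof.
move=> mn sm pos; have hyp : hyperbolic (@ev_const R n) (@ev_top R n) real11 betaE
    (betaE ^+ (n - m)) m.
  rewrite -[betaE ^+ _]mul1r.
  apply: (hyperbolic_base_exp (@ev_topZ R n) real11D real11Z real11_beta).
  by rewrite subnK//; exact: hyperbolic_beta.
apply: (garding_closed (@ev_topZ R n) real11D real11Z real11_beta); rewrite sm//.
move=> x /pos[rx px]; split=> // t t0.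
have t0' : 0 <= (t%:C)%C by rewrite lecR ltW.
(* For t > 0 every term in the expansion of (x + t beta)^m /\ beta^(n-m) is nonnegative by
   m-positivity, and the term t^m beta^n is positive. So [x] lies in the closed cone. *)
rewrite addrC exprDn mulr_sumr raddf_sum gt_eqF// big_ord_recl/=.
apply: ltr_wpDr; last first.
  rewrite subn0 expr0 bin0 mulr1n mulr1 exprMn -rmorphXn mulrCA -exprD subnK//=.
  by rewrite ev_topZ mulr_gt0 ?ev_top_beta_gt0// exprn_gt0// ltcR.
apply: sumr_ge0 => i _; rewrite mulrnAr raddfMn mulrn_wge0//=.
rewrite exprMn -rmorphXn.
have im : (bump 0 i <= m)%N by rewrite /bump/=; have := ltn_ord i; lia.
have -> : betaE ^+ (n - m) * (ev_const ((t%:C)%C ^+ (m - bump 0 i)) *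
    betaE ^+ (m - bump 0 i) * x ^+ bump 0 i) =
  ev_const ((t%:C)%C ^+ (m - bump 0 i)) * (x ^+ bump 0 i * betaE ^+ (n - bump 0 i)).
  have -> : (n - bump 0 i = (n - m) + (m - bump 0 i))%N by lia.
  by rewrite exprD; ring.
by rewrite ev_topZ mulr_ge0 ?exprn_ge0 ?px// im andbT.
Qed.

End m_positive_forms.

(** * Positivity of radial Hessians *)

Section hessian_functional.
Context {R : realType} {n : nat}.
Local Notation C := R[i].
Local Notation I := 'I_(n.*2).
Local Notation E := (evenform R n).
Local Notation betaE := (ev11 1%:M : E).
Implicit Types (S : I -> I -> R) (theta : cform R n).

#[local] Opaque form_basis wedge.

(** The matrix [levi] as a linear function of an arbitrary array in the place of the second partial
    derivatives. The Hessian of a test function can then be exchanged for that of a radial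
    function. *)
Definition levi_mx S : 'M[C]_n := \matrix_(j, k)
  (4^-1 * (S (xidx j) (xidx k) + S (yidx j) (yidx k)) +i*
   (4^-1 * (S (xidx j) (yidx k) - S (yidx j) (xidx k))))%C.

Definition top_re theta S : R :=
  complex.Re (top_coef (wedge ((2 * 'i)%C *: form11 (levi_mx S)) theta)).

Lemma top_re_ddc theta phi x :
  complex.Re (top_coef (wedge (ddc phi x) theta)) =
  top_re theta (fun i k => partial i (partial k phi) x).
Proof. by []. Qed.

Lemma top_reD theta S S' : top_re theta (S + S') = top_re theta S + top_re theta S'.
Proof.
rewrite /top_re (_ : levi_mx _ = levi_mx S + levi_mx S'); last first.
  by apply/matrixP => j k; rewrite !mxE; apply/eqP; rewrite eq_complex /=;
    apply/andP; split; apply/eqP; rewrite !fctE; ring.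
rewrite form11D scalerDr wedgeDl /top_coef ffunE.
have ReD (u v : C) : complex.Re (u + v) = complex.Re u + complex.Re v.
  by case: u v => [? ?] [].
exact: ReD.
Qed.

Lemma top_reZ theta (c : R) S : top_re theta (fun i k => c * S i k) = c * top_re theta S.
Proof.
rewrite /top_re (_ : levi_mx _ = (c%:C)%C *: levi_mx S); last first.
  by apply/matrixP => j k; rewrite !mxE; apply/eqP; rewrite eq_complex /=;
    apply/andP; split; apply/eqP; ring.
rewrite form11Z !wedgeZl /top_coef !ffunE.
have ReZ (v : C) : complex.Re ((2 * 'i)%C * ((c%:C)%C * v)) = c * complex.Re ((2 * 'i)%C * v).
  by case: v => x y /=; ring.
exact: ReZ.
Qed.

Definition top_re_coef theta (i k : I) : R :=
  top_re theta (fun i' k' => (i' == i)%:R * (k' == k)%:R).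

(** Separates the entries of the Hessian, so that integration by parts can be carried out for each
    of them with constant weights. *)
Lemma top_re_lin theta S :
  top_re theta S = \sum_i \sum_k S i k * top_re_coef theta i k.
Proof.
have top_re_sum (T : Type) (r : seq T) (F : T -> I -> I -> R) :
    top_re theta (\sum_(t <- r) F t) = \sum_(t <- r) top_re theta (F t).
  apply: (big_morph (top_re theta) (top_reD theta)).
  have -> : 0 = (fun i k => 0 * (fun=> fun=> 0 : R) i k) :> (I -> I -> R).
    by apply/funext => i; apply/funext => k; rewrite mul0r.
  by rewrite top_reZ mul0r.
under eq_bigr do under eq_bigr do rewrite -top_reZ.
under eq_bigr do rewrite -top_re_sum.
rewrite -top_re_sum; congr top_re; apply/funext => a; apply/funext => b.
rewrite !fct_sumE (bigD1 a)//= fct_sumE fct_sumE (bigD1 b)//= !eqxx !mulr1.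
rewrite big1 ?addr0 => [|k /negbTE kb]; last by rewrite eq_sym kb !mulr0.
rewrite big1 ?addr0// => i /negbTE ia; rewrite fct_sumE fct_sumE big1// => k _.
by rewrite eq_sym ia mul0r mulr0.
Qed.

(** The array is the real Hessian of f(|z|^2), with [p] and [q] the first and second derivatives of
    f at |z|^2. *)
Lemma levi_mx_radial (p q : R) (z : Cspace R n) :
  let zc j := (z ord0 (xidx j) +i* z ord0 (yidx j))%C in
  levi_mx (fun i k => 2 * p * (i == k)%:R + 4 * q * (z ord0 i * z ord0 k)) =
  (p%:C)%C *: 1%:M + (q%:C)%C *: \matrix_(j, k) ((zc j)^*%C * zc k).
Proof.
move=> zc; apply/matrixP => j k; rewrite !mxE.
have xx : (xidx j == xidx k) = (j == k) by rewrite -!val_eqE /=; apply/eqP/eqP; lia.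
have yy : (yidx j == yidx k) = (j == k) by rewrite -!val_eqE /=; apply/eqP/eqP; lia.
have xy a b : (xidx a == yidx b :> I) = false by rewrite -!val_eqE /=; apply/eqP; lia.
have yx a b : (yidx a == xidx b :> I) = false by rewrite eq_sym xy.
rewrite xx yy xy yx /zc; case: eqP => _; apply/eqP; rewrite eq_complex /=;
  apply/andP; split; apply/eqP; field; exact: isT.
Qed.

(** The form is x = p beta + q h with h of rank one and h^2 = 0, so the top coefficient of n x^k /\
    beta^(n-k) is that of p^(k-1) (n p + k q |z|^2) beta^n. Hence [x] is itself m-positive and joins
    the m - 1 given forms in Gårding's inequality. *)
Theorem top_re_radial_ge0 m (alpha : 'I_m.-1 -> cform R n) (p q : R) (z : Cspace R n) :
  (1 <= m)%N -> (m < n)%N -> (forall j, m_positive m (alpha j)) ->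
  0 <= p -> 0 <= n%:R * p + m%:R * (q * sqnorm z) ->
  0 <= top_re (wedge (\big[wedge/form1]_(j < m.-1) alpha j) (wedge_exp beta (n - m)))
         (fun i k => 2 * p * (i == k)%:R + 4 * q * (z ord0 i * z ord0 k)).
Proof.
move=> m0 mn pos p0 pq.
pose zc j := (z ord0 (xidx j) +i* z ord0 (yidx j))%C.
pose h : 'M[C]_n := \matrix_(j, k) ((zc j)^*%C * zc k).
have hh : hermitian h.
  by move=> j k; rewrite !mxE; apply/eqP; rewrite eq_complex /=;
    apply/andP; split; apply/eqP; ring.
have trh : \tr h = ((sqnorm z)%:C)%C.
  rewrite /mxtrace /sqnorm rmorph_sum.
  have -> : \sum_(i < n.*2) ((z ord0 i ^+ 2)%:C)%C =
     \sum_(j < n) (((z ord0 (xidx j) ^+ 2 + z ord0 (yidx j) ^+ 2)%:C)%C) :> C.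
    (* Extending the summand by 0 to all natural numbers lets the 2n coordinates be regrouped in
       pairs by induction. *)
    pose F i := if @insub nat (fun i => (i < n.*2)%N) _ i is Some o then ((z ord0 o ^+ 2)%:C)%C else 0 : C.
    transitivity (\sum_(0 <= i < n.*2) F i).
      rewrite big_mkord; apply: eq_bigr => i _.
      by rewrite /F valK.
    transitivity (\sum_(0 <= j < n) (F j.*2 + F j.*2.+1)).
      elim: (n) => [|k IH]; first by rewrite !big_nil.
      by rewrite doubleS !big_nat_recr//= IH addrA.
    rewrite big_mkord; apply: eq_bigr => j _; rewrite rmorphD /F.
    by rewrite -[j.*2]/(val (xidx j)) -[j.*2.+1]/(val (yidx j)) !valK.
  apply: eq_bigr => j _; rewrite mxE; apply/eqP; rewrite eq_complex /=;
    apply/andP; split; apply/eqP; ring.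
pose x : E := ev_const ((p%:C)%C) * betaE + ev_const ((q%:C)%C) * ev11 h.
have xE : ev_val x = (2 * 'i)%C *: form11 (levi_mx
    (fun i k => 2 * p * (i == k)%:R + 4 * q * (z ord0 i * z ord0 k))).
  by rewrite levi_mx_radial /x -!ev11Z -ev11D.
have n0 : (0 < n)%N by exact: leq_ltn_trans mn.
have posx : real11 x /\ forall k, (1 <= k <= m)%N ->
    0 <= ev_top (x ^+ k * betaE ^+ (n - k)).
  split.
    by apply: real11D; apply: real11Z; [exact: real11_beta|exact: real11_ev11].
  move=> k /andP[k0 km].
  have hsq : (ev_const ((q%:C)%C) * ev11 h) * (ev_const ((q%:C)%C) * ev11 h) = 0 :> E.
    by rewrite mulrACA ev11_rank1_sq mulr0.
  have T0 := @ev_top_beta_gt0 R n.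
  set T := ev_top (betaE ^+ n) in T0.
  have key : n%:R * ev_top (x ^+ k * betaE ^+ (n - k)) =
      ((p%:C)%C) ^+ k.-1 * ((n%:R * p + k%:R * (q * sqnorm z))%:C)%C * T.
    rewrite -(prednK k0) exprD_square0// (prednK k0).
    have -> : ((ev_const (p%:C)%C * betaE) ^+ k +
         k%:R * (ev_const (p%:C)%C * betaE) ^+ k.-1 * (ev_const (q%:C)%C * ev11 h)) *
        betaE ^+ (n - k) =
      ev_const ((p%:C)%C ^+ k) * betaE ^+ n +
      ev_const (k%:R * ((p%:C)%C ^+ k.-1 * (q%:C)%C)) * (betaE ^+ n.-1 * ev11 h).
      have -> : betaE ^+ n = betaE ^+ k * betaE ^+ (n - k) by rewrite -exprD subnKC// ltnW// (leq_ltn_trans km).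
      have -> : betaE ^+ n.-1 = betaE ^+ k.-1 * betaE ^+ (n - k).
        by rewrite -exprD; congr (_ ^+ _); lia.
      by rewrite !exprMn !rmorphM !rmorphXn/= rmorph_nat; ring.
    rewrite raddfD/= !ev_topZ mulrDr (mulrCA n%:R (k%:R * _)) ev_top_trace// trh -/T.
    rewrite -{1}(prednK k0) exprS !(rmorphD, rmorphM)/= !rmorph_nat; ring.
  rewrite -(pmulr_rge0 _ (_ : 0 < n%:R :> C)) ?ltr0n// key.
  rewrite mulr_ge0 ?(ltW T0)// mulr_ge0 ?exprn_ge0 ?lecR//.
  have k1 : k%:R / m%:R <= 1 :> R by rewrite ler_pdivrMr ?ltr0n// mul1r ler_nat.
  have k0' : 0 <= k%:R / m%:R :> R by rewrite divr_ge0.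
  (* The expression is affine in k, hence between its values at k = 0 and k = m, which are
     nonnegative by hypothesis. *)
  have -> : n%:R * p + k%:R * (q * sqnorm z) =
     (1 - k%:R / m%:R) * (n%:R * p) + k%:R / m%:R * (n%:R * p + m%:R * (q * sqnorm z)).
    by field; rewrite pnatr_eq0 -lt0n.
  rewrite addr_ge0 ?mulr_ge0//; lra.
pose y j := s2val (cid2 (m_positiveP (pos j))).
have yE j : ev_val (y j) = alpha j by rewrite /y; case: cid2.
have py j : real11 (y j) /\ forall k, (1 <= k <= m)%N ->
    0 <= ev_top (y j ^+ k * betaE ^+ (n - k)) by rewrite /y; case: cid2.
pose s := x :: [seq y j | j <- enum 'I_m.-1].
have ss : size s = m by rewrite /= size_map size_enum_ord prednK.
have := garding_m_positive (ltnW mn) ss.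
have spos t : t \in s -> real11 t /\ forall k, (1 <= k <= m)%N ->
    0 <= ev_top (t ^+ k * betaE ^+ (n - k)).
  by rewrite inE => /orP[/eqP ->//|/mapP[j _ ->]]; exact: py.
move=> /(_ spos); rewrite /s big_cons big_map big_enum/=.
rewrite /top_re -xE.
have -> : ev_top (betaE ^+ (n - m) * (x * \prod_j y j)) =
   top_coef (wedge (ev_val x) (wedge (\big[wedge/form1]_(j < m.-1) alpha j) (wedge_exp beta (n - m)))).
  rewrite mulrC -mulrA /ev_top !ev_valM ev_valX ev_val_beta ev_val_prod.
  by congr (top_coef (wedge _ (wedge _ _))); apply: eq_bigr => j _; exact: yE.
by case: (top_coef _) => u v; rewrite lecE /= => /andP[].
Qed.

End hessian_functional.

(** * Lebesgue measure on row vectors *)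

Section tuple_slices.
Context {R : realType}.
Local Notation RM := (measurableTypeR R).
Local Open Scope ereal_scope.

Definition tuple_upd (n : nat) (t : n.-tuple RM) (i : 'I_n) (s : R) : n.-tuple RM :=
  [tuple if k == i then s else tnth t k | k < n].

Lemma tuple_upd_cons0 n (x s : RM) (t : n.-tuple RM) :
  tuple_upd (tuple_cons (x, t)) ord0 s = tuple_cons (s, t).
Proof.
apply: eq_from_tnth => k; rewrite tnth_mktuple.
case: (unliftP ord0 k) => [j ->|->]; last by rewrite eqxx.
by rewrite eq_sym (negbTE (neq_lift _ _)) !tnthS.
Qed.

Lemma tuple_upd_consS n (x s : RM) (t : n.-tuple RM) (j : 'I_n) :
  tuple_upd (tuple_cons (x, t)) (lift ord0 j) s = tuple_cons (x, tuple_upd t j s).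
Proof.
apply: eq_from_tnth => k; rewrite tnth_mktuple.
case: (unliftP ord0 k) => [l ->|->]; last by rewrite (negbTE (neq_lift _ _)).
by rewrite (inj_eq (lift_inj (h := ord0))) !tnthS tnth_mktuple.
Qed.

Lemma integrable_pushforward_comp d1 d2 (X : measurableType d1) (Y : measurableType d2)
  (phi : X -> Y) (mphi : measurable_fun setT phi)
  (mu : {measure set X -> \bar R}) (f : Y -> \bar R) :
  (pushforward mu phi).-integrable setT f -> mu.-integrable setT (f \o phi).
Proof.
move=> /integrableP[mf foo]; apply/integrableP; split; first exact: measurableT_comp.
move: foo; rewrite (ge0_integral_pushforward mphi)//.
exact: measurableT_comp.
Qed.

(** Fubini's theorem with the i-th variable integrated first. The induction removes the leading
    coordinate: it is the outer variable when i > 0, and the inner one when i = 0. *)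
Lemma integral0_of_line_integrals n (f : n.-tuple RM -> R) (i : 'I_n) :
  (lebesgue_tuple n).-integrable setT (EFin \o f) ->
  (forall t, \int[lebesgue_measure]_s (f (tuple_upd t i s))%:E = 0) ->
  \int[lebesgue_tuple n]_t (f t)%:E = 0.
Proof.
elim: n f i => [|n IH] f i intf f0; first by case: i f0.
have mc : measurable_fun setT (@tuple_cons R n) := @measurable_tuple_cons R n.
have intc : (@lebesgue_measure R \x lebesgue_tuple n).-integrable setT
    ((EFin \o f) \o @tuple_cons R n).
  exact: (integrable_pushforward_comp mc intf).
have mf : measurable_fun setT (EFin \o f) by case/integrableP: intf.
transitivity (\int[pushforward (@lebesgue_measure R \x lebesgue_tuple n) (@tuple_cons R n)]_t
   (f t)%:E); first by [].
rewrite (integral_pushforward mc mf)// preimage_setT.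
case: (unliftP ord0 i) f0 => [j ->|->] f0.
- rewrite -(integral12_prod_meas1 intc) -(integral0 (@lebesgue_measure R) setT).
  apply: ae_eq_integral => //; first exact: (measurable_fubini_F intc).
  apply: filterS (ae_integrable1 intc) => x intx _.
  apply: (IH (fun t => f (tuple_cons (x, t))) j) => // t.
  by rewrite -[RHS](f0 (tuple_cons (x, t))); under [RHS]eq_integral do rewrite tuple_upd_consS.
- rewrite -(integral21_prod_meas1 intc) -(integral0 (lebesgue_tuple n) setT).
  apply: eq_integral => t _; rewrite /fubini_G /=.
  by rewrite -[RHS](f0 (tuple_cons (0%R, t))); under [RHS]eq_integral do rewrite tuple_upd_cons0.
Qed.
End tuple_slices.

Section rV_borel.
Context {R : realType} (n : nat).
Local Notation rV := 'rV[R]_n.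
Local Notation mu := (@lebesgue_rV R n).

Lemma measurable_coord (i : 'I_n) : measurable_fun setT (fun x : rV => x ord0 i).
Proof.
move=> _ Y mY; rewrite setTI; apply: sub_sigma_algebra => /=.
rewrite -bigcup_seq/=; exists i => /=; first by rewrite mem_index_enum.
by exists Y => //; rewrite setTI.
Qed.

Definition box (a : rV) (r : R) : set rV := [set x | forall i, `|x ord0 i - a ord0 i| <= r].

Lemma measurable_box a r : measurable (box a r).
Proof.
have -> : box a r = \bigcap_(i in [set: 'I_n]) [set x : rV | `|x ord0 i - a ord0 i| <= r].
  by apply/seteqP; split=> x /= H i; [move=> _|]; exact: H.
apply: fin_bigcap_measurable => [|i _]; first exact: finite_finset.
rewrite -[X in measurable X]setTI.
have -> : [set x : rV | `|x ord0 i - a ord0 i| <= r] =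
    (fun x : rV => x ord0 i) @^-1` `[a ord0 i - r, a ord0 i + r].
  by apply/seteqP; split=> x /=; rewrite in_itv/= ler_distl.
exact: measurable_coord.
Qed.

(** The sigma-algebra is generated by the coordinates, so [U] is written as a countable union of
    boxes with rational centres and radii 1/(k+1). *)
Lemma open_measurable_rV (U : set rV) : open U -> measurable U.
Proof.
move=> oU.
pose B (p : 'rV[rat]_n * nat) := box (map_mx ratr p.1 : rV) (p.2.+1%:R^-1).
have -> : U = \bigcup_p if `[< B p `<=` U >] then B p else set0.
  apply/seteqP; split=> [x Ux|x [p _]]; last first.
    by case: asboolP => // pU /pU.
  have /nbhs_ballP[e /= e0 He] : nbhs x U by exact: open_nbhs_nbhs.
  have [k [d [dE d0 de]]] : exists (k : nat) (d : R),
      [/\ d = k.+1%:R^-1, 0 < d & d < e / 2].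
    have e2 : 0 < e / 2 by rewrite divr_gt0.
    have [k _ /(_ k (leqnn k)) ke] := near_infty_natSinv_lt (PosNum e2).
    by exists k, k.+1%:R^-1; rewrite invr_gt0 ltr0n.
  have /choice[q qx] : forall i, exists r : rat, `|x ord0 i - ratr r| < d.
    move=> i; have [|r] := @rat_in_itvoo R (x ord0 i - d) (x ord0 i + d); first lra.
    by rewrite in_itv/= => /andP[r1 r2]; exists r; rewrite distrC ltr_distl r1 r2.
  exists (\row_i q i, k) => //; case: asboolP => [_ i|].
    by rewrite !mxE -dE; exact/ltW/qx.
  case=> y By; apply: He; split=> // i j; rewrite (ord1 i) /ball/=.
  by have := By j; have := qx j; rewrite !mxE /= -dE !ltr_norml !ler_norml; lra.
apply: countable_bigcupT_measurable => // p.
by case: asboolP => // _; exact: measurable_box.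
Qed.

Lemma closed_measurable_rV (K : set rV) : closed K -> measurable K.
Proof.
move=> cK; rewrite -[X in measurable X]setCK; apply: measurableC.
by apply: open_measurable_rV; exact: closed_openC.
Qed.

Lemma continuous_measurable_rV (f : rV -> R) : continuous f -> measurable_fun setT f.
Proof.
move=> cf; apply: (measurability _ (RGenOInfty.measurableE R)) => _ [_ [x ->] <-].
rewrite setTI; apply: open_measurable_rV; move/continuousP: cf; apply.
exact: interval_open.
Qed.

End rV_borel.

Lemma lebesgue_rV_box {R : realType} n (a : 'rV[R]_n) r : 0 <= r ->
  @lebesgue_rV R n (box a r) = ((r *+ 2) ^+ n)%:E.
Proof.
move=> r0; transitivity (lebesgue_tuple n [set t : n.-tuple R |
    forall i, `|tnth t i - a ord0 i| <= r]).
  rewrite -[LHS]/(lebesgue_tuple n (@row_of_tuple R n @^-1` box a r)); congr (lebesgue_tuple n _).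
  by apply/seteqP; split=> t /= H i; have := H i; rewrite mxE.
suff H (b : 'I_n -> R) : lebesgue_tuple n [set t : n.-tuple R |
    forall i, `|tnth t i - b i| <= r] = ((r *+ 2) ^+ n)%:E.
  exact: (H (fun i => a ord0 i)).
elim: n b {a} => [|k IH] b.
  by rewrite /= diracE expr0; congr (_%:E); rewrite mem_set// => -[].
pose b0 := b ord0; pose b' i := b (lift ord0 i).
rewrite -[LHS]/((@lebesgue_measure R \x lebesgue_tuple k)%E
  (@tuple_cons R k @^-1` [set t : k.+1.-tuple R | forall i, `|tnth t i - b i| <= r])).
have -> : @tuple_cons R k @^-1` [set t | forall i, `|tnth t i - b i| <= r] =
    `[b0 - r, b0 + r]%classic `*` [set t : k.-tuple R | forall i, `|tnth t i - b' i| <= r].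
  apply/seteqP; split=> -[x t] /=.
    move=> H; split; first by have := H ord0; rewrite in_itv/= -ler_distl.
    by move=> i; have := H (lift ord0 i); rewrite tnthS.
  move=> [x0 H] i; case: (unliftP ord0 i) => [j ->|->].
    by rewrite tnthS; exact: H.
  by move: x0; rewrite in_itv/= -ler_distl.
rewrite product_measure1E//; last first.
  have -> : [set t : k.-tuple R | forall i, `|tnth t i - b' i| <= r] =
      @row_of_tuple R k @^-1` box (\row_i b' i) r.
    by apply/seteqP; split=> t /= H i; have := H i; rewrite !mxE.
  rewrite -[X in measurable X]setTI; apply: measurable_row_of_tuple => //.
  exact: measurable_box.
have lm : @lebesgue_measure R `[b0 - r, b0 + r]%classic = (r *+ 2)%:E.
  rewrite lebesgue_measure_itv/= lte_fin; case: ifPn => [_|].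
    by rewrite EFinN -EFinB; congr (_%:E); rewrite mulr2n; ring.
  by rewrite -leNgt => rr; have -> : r = 0; [lra|rewrite mul0rn].
by rewrite exprS EFinM -(IH b') -lm.
Qed.

(** * Integrals along coordinate lines *)

Section line_integrals.
Context {R : realType} (n : nat).
Local Notation rV := 'rV[R]_n.
Local Notation mu := (@lebesgue_rV R n).

Definition rV_upd (x : rV) (i : 'I_n) (s : R) : rV :=
  \row_k (if k == i then s else x ord0 k).

Lemma rV_upd_upd x i s t : rV_upd (rV_upd x i s) i t = rV_upd x i t.
Proof. by apply/rowP => k; rewrite !mxE; case: eqP. Qed.

Lemma rV_integral0_of_lines (f : rV -> R) (i : 'I_n) :
  mu.-integrable setT (EFin \o f) ->
  (forall x, \int[lebesgue_measure]_s (f (rV_upd x i s))%:E = 0)%E ->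
  (\int[mu]_x (f x)%:E = 0)%E.
Proof.
move=> intf f0; have mrow := @measurable_row_of_tuple R n.
have mf : measurable_fun setT (EFin \o f) by case/integrableP: intf.
transitivity (\int[pushforward (lebesgue_tuple n) (@row_of_tuple R n)]_x (f x)%:E)%E.
  by [].
have intc : (lebesgue_tuple n).-integrable setT ((EFin \o f) \o @row_of_tuple R n).
  exact: (integrable_pushforward_comp mrow intf).
rewrite (integral_pushforward mrow mf)// preimage_setT.
apply: (integral0_of_line_integrals (f := f \o @row_of_tuple R n) (i := i)) => // t.
rewrite -[RHS](f0 (row_of_tuple t)); apply: eq_integral => s _ /=; congr (f _)%:E.
by apply/rowP => k; rewrite !mxE tnth_mktuple.
Qed.

(* Integration by parts: along each line parallel to the i-th axis the domain
   is a segment at whose ends [h] vanishes. *)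
Lemma integral_line_derivative0 (A : set rV) (h g : rV -> R) (i : 'I_n) :
  measurable A -> mu.-integrable A (EFin \o g) ->
  (forall (x : rV) (s : R), is_derive s 1 (fun t : R => h (rV_upd x i t)) (g (rV_upd x i s))) ->
  (forall x, continuous (fun s : R => g (rV_upd x i s))) ->
  (forall x, A x -> exists l r : R, [/\ l <= r,
     forall s, A (rV_upd x i s) <-> l <= s <= r,
     h (rV_upd x i l) = 0 & h (rV_upd x i r) = 0]) ->
  (\int[mu]_(x in A) (g x)%:E = 0)%E.
Proof.
move=> mA intg dh cg slices.
rewrite integral_mkcond.
transitivity (\int[mu]_x (patch (fun=> 0) A g x)%:E)%E.
  by apply: eq_integral => x _; rewrite /patch; case: ifP.
apply: (rV_integral0_of_lines (i := i)).
  have := intg; rewrite integrable_mkcond// => H.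
  by apply: eq_integrable H => // x _ /=; rewrite /patch; case: ifP.
move=> x; have [[s0 As0]|noA] := pselect (exists s, A (rV_upd x i s)); last first.
  apply: integral0_eq => s _; rewrite /patch; case: ifP => //.
  by rewrite inE => As; case: noA; exists s.
have [l [r [lr slice hl hr]]] := slices _ As0.
have {}slice s : A (rV_upd x i s) <-> l <= s <= r.
  by have := slice s; rewrite rV_upd_upd.
rewrite !rV_upd_upd in hl hr.
transitivity (\int[lebesgue_measure]_(s in `[l, r]) (g (rV_upd x i s))%:E)%E.
  rewrite [RHS]integral_mkcond; apply: eq_integral => s _; rewrite /patch.
  have -> : (rV_upd x i s \in A) = (s \in `[l, r]%classic).
    by apply/idP/idP; rewrite !inE /= in_itv/=; [move=> /slice|move=> ?; apply/slice].
  by case: ifP.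
have [lr'|rl] := ltP l r; last first.
  have -> : l = r by apply/eqP; rewrite eq_le lr rl.
  by rewrite set_itv1 integral_set1.
rewrite (@continuous_FTC2 _ _ (fun t => h (rV_upd x i t)))//.
- by rewrite hl hr subee.
- by apply: continuous_subspaceT; exact: cg.
- have dcont : continuous (fun t => h (rV_upd x i t)).
    move=> s; apply: differentiable_continuous; apply/derivable1_diffP.
    by apply: ex_derive; exact: dh.
  split.
  + by move=> s _; apply: ex_derive; exact: dh.
  + by apply: cvg_at_right_filter; exact: dcont.
  + by apply: cvg_at_left_filter; exact: dcont.
- move=> s _; rewrite derive1E.
  by have /@derive_val := dh x s.
Qed.

End line_integrals.

(** * The radial profile *)

Lemma is_derive_continuous {R : realType} (f : R -> R) (t d : R) :
  is_derive t 1 f d -> {for t, continuous f}.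
Proof.
move=> df; apply: differentiable_continuous; apply/derivable1_diffP.
by apply: ex_derive; exact: df.
Qed.

Section profile.
Context {R : realType}.
Variables (m : nat) (delta : R).
Hypotheses (m0 : (0 < m)%N) (delta0 : 0 < delta).
Implicit Types t : R.

Local Notation s := (m%:R^-1 : R).

(** The constant 2m makes (1/m) tau >= 2, from which [g_ge0] and [g1_ge0] follow. *)
Definition prof_tau t : R := 2 * m%:R + ln (1 + t^-1).

Definition prof t : R := - (delta * (t `^ (- s) / prof_tau t)).

(** With the power t^(-s-1) factored out of f', where s = 1/m, the contributions of the power to t
    f'' + (1 + s) f' cancel, leaving delta t^(-s) g'. The two sign conditions thus reduce to g >= 0
    and g' >= 0; [g1] is g'. *)
Let g t : R := s / prof_tau t - (prof_tau t ^+ 2 * (1 + t))^-1.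
Let g1 t : R := s / (prof_tau t ^+ 2 * (t * (1 + t))) +
  (prof_tau t - 2 / t) / (prof_tau t ^+ 3 * (1 + t) ^+ 2).

Definition prof1 t : R := delta * (t `^ (- s - 1) * g t).
Definition prof2 t : R := delta * (t `^ (- s - 1) * (g1 t - (s + 1) / t * g t)).

Let s0 : 0 < s. Proof. by rewrite invr_gt0 ltr0n. Qed.
Let mR0 : 0 < m%:R :> R. Proof. by rewrite ltr0n. Qed.

Lemma prof_tau_ge t : 0 < t -> 2 * m%:R <= prof_tau t.
Proof.
move=> t0; rewrite /prof_tau lerDl ln_ge0// lerDl invr_ge0 ltW//.
Qed.

Lemma prof_tau_gt0 t : 0 < t -> 0 < prof_tau t.
Proof. by move=> t0; apply: lt_le_trans (prof_tau_ge t0); rewrite mulr_gt0. Qed.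

Let is_derive_tau t : 0 < t -> is_derive t 1 prof_tau (- (t * (1 + t))^-1).
Proof.
move=> t0; have tn0 : t != 0 by rewrite gt_eqF.
have p0 : 0 < 1 + t^-1 by rewrite addr_gt0 ?invr_gt0.
have dV : is_derive t 1 (fun x : R => 1 + x^-1) (0 + - t ^- 2 *: 1).
  apply: is_deriveD; apply: is_deriveV => //.
have dl := @is_derive1_comp R (@ln R) (fun x : R => 1 + x^-1) t _ _ (is_derive1_ln p0) dV.
apply: (is_derive_eq (is_deriveD (is_derive_cst (2 * m%:R : R) t 1) dl)).
rewrite /GRing.scale/= !add0r mulr1; field.
by rewrite gt_eqF ?addr_gt0//= gt_eqF// addr_gt0.
Qed.

Let nz t : 0 < t -> [/\ t != 0, 1 + t != 0, prof_tau t != 0 & m%:R != 0 :> R].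
Proof.
move=> t0; have T0 := prof_tau_gt0 t0.
by split; apply: lt0r_neq0 => //; rewrite addr_gt0.
Qed.

Let is_derive_pow t (a : R) : 0 < t -> is_derive t 1 (fun x : R => x `^ a) (a * t `^ (a - 1)).
Proof. exact: is_derive1_powR. Qed.

Let powRS t (a : R) : 0 < t -> t `^ a = t `^ (a - 1) * t.
Proof.
move=> t0; rewrite -[X in _ * X](@powRr1 _ t) ?ltW// -powRD ?subrK//.
by apply/implyP => _; rewrite gt_eqF.
Qed.

Lemma prof_is_derive t : 0 < t -> is_derive t 1 prof (prof1 t).
Proof.
move=> t0; have T0 := prof_tau_gt0 t0.
have d1 := is_derive_pow (- s) t0.
have d2 := is_deriveV (lt0r_neq0 T0) (is_derive_tau t0).
have d3 := is_deriveM d1 d2.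
have d4 := is_deriveN (is_deriveM (is_derive_cst delta t 1) d3).
apply: (is_derive_eq d4).
rewrite /GRing.scale/= /prof1 /g (powRS (- s) t0) mulr0 addr0; field.
by have [n1 n2 n3 n4] := nz t0; rewrite ?n1 ?n2 ?n3 ?n4.
Qed.

Let is_derive_g t : 0 < t -> is_derive t 1 g (g1 t).
Proof.
move=> t0; have T0 := prof_tau_gt0 t0.
have d2 := is_deriveV (lt0r_neq0 T0) (is_derive_tau t0).
have d3 := is_deriveM (is_derive_cst s t 1) d2.
have d1t := is_deriveD (is_derive_cst (1 : R) t 1) (is_derive_id t (1 : R)).
have dd := is_deriveM (is_deriveX 2 (is_derive_tau t0)) d1t.
have n0 : ((prof_tau ^+ 2) * (cst 1 + id)) t != 0.
  by rewrite !fctE mulf_neq0 ?expf_neq0//; have [] := nz t0.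
have d5 := is_deriveB d3 (is_deriveV n0 dd).
apply: (is_derive_eq d5).
rewrite /GRing.scale/= /g1 !fctE; field.
by have [n1 n2 n3 n4] := nz t0; rewrite ?n1 ?n2 ?n3 ?n4.
Qed.

Lemma prof1_is_derive t : 0 < t -> is_derive t 1 prof1 (prof2 t).
Proof.
move=> t0; have T0 := prof_tau_gt0 t0.
have d := is_deriveM (is_derive_cst delta t 1)
  (is_deriveM (is_derive_pow (- s - 1) t0) (is_derive_g t0)).
apply: (is_derive_eq d).
rewrite /GRing.scale/= /prof2 (powRS (- s - 1) t0) mulr0 addr0; field.
by have [n1 n2 n3 n4] := nz t0; rewrite ?n1 ?n2 ?n3 ?n4.
Qed.

Let g_ge0 t : 0 < t -> 0 <= g t.
Proof.
move=> t0; have T0 := prof_tau_gt0 t0; have T1 := prof_tau_ge t0.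
have -> : g t = (s * prof_tau t * (1 + t) - 1) / (prof_tau t ^+ 2 * (1 + t)).
  rewrite /g; field; by have [n1 n2 n3 n4] := nz t0; rewrite ?n1 ?n2 ?n3 ?n4.
rewrite divr_ge0 ?mulr_ge0 ?exprn_ge0 ?(ltW T0)//; last by rewrite addr_ge0// ltW.
have sT : 2 <= s * prof_tau t.
  by rewrite mulrC ler_pdivlMr//.
nra.
Qed.

Let g1_ge0 t : 0 < t -> 0 <= g1 t.
Proof.
move=> t0; have T0 := prof_tau_gt0 t0; have T1 := prof_tau_ge t0.
have -> : g1 t = (s * prof_tau t * (1 + t) + t * prof_tau t - 2) /
    (prof_tau t ^+ 3 * (t * (1 + t) ^+ 2)).
  rewrite /g1; field; by have [n1 n2 n3 n4] := nz t0; rewrite ?n1 ?n2 ?n3 ?n4.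
have sT : 2 <= s * prof_tau t by rewrite mulrC ler_pdivlMr.
apply: divr_ge0; first nra.
apply: mulr_ge0; first by rewrite exprn_ge0// ltW.
by rewrite mulr_ge0 ?(ltW t0)// sqr_ge0.
Qed.

Lemma prof1_ge0 t : 0 < t -> 0 <= prof1 t.
Proof. by move=> t0; rewrite /prof1 !mulr_ge0 ?g_ge0 ?powR_ge0// ltW. Qed.

Lemma prof2_ge t : 0 < t -> 0 <= t * prof2 t + (1 + s) * prof1 t.
Proof.
move=> t0; have -> : t * prof2 t + (1 + s) * prof1 t = delta * (t * t `^ (- s - 1) * g1 t).
  by rewrite /prof2 /prof1; field; by have [n1 n2 n3 n4] := nz t0; rewrite ?n1 ?n2 ?n3 ?n4.
by rewrite !mulr_ge0 ?powR_ge0 ?g1_ge0// ltW.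
Qed.

Lemma prof_lt0 t : 0 < t -> prof t < 0.
Proof.
move=> t0; rewrite oppr_lt0 mulr_gt0// divr_gt0 ?powR_gt0//; exact: prof_tau_gt0.
Qed.

Lemma prof_le t u : 0 < t -> t <= u -> prof t <= prof u.
Proof.
move=> t0; rewrite le_eqVlt => /predU1P[->//|tu].
have pos x : x \in `]t, u[ -> 0 < x by rewrite in_itv/= => /andP[/(lt_trans t0)].
have [x xtu] : exists2 x, x \in `]t, u[ & prof u - prof t = prof1 x * (u - t).
  apply: (MVT tu) => [x /pos x0|]; first exact: prof_is_derive.
  apply: continuous_in_subspaceT => x; rewrite inE/= in_itv/= => /andP[/(lt_le_trans t0) x0 _].
  exact: is_derive_continuous (prof_is_derive x0).
move=> E; rewrite -subr_ge0 E mulr_ge0 ?prof1_ge0 ?(pos x)//.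
by rewrite subr_ge0 ltW.
Qed.

Lemma prof_continuous t : 0 < t -> {for t, continuous prof}.
Proof.
move=> t0; exact: is_derive_continuous (prof_is_derive t0).
Qed.

Lemma prof2_continuous t : 0 < t -> {for t, continuous prof2}.
Proof.
move=> t0; have T0 := prof_tau_gt0 t0; have tn0 : t != 0 by rewrite gt_eqF.
have cT := is_derive_continuous (is_derive_tau t0).
have c1 : (1 + x : R) @[x --> t] --> 1 + t by apply: cvgD => //; exact: cvg_cst.
have cV : (x^-1 : R) @[x --> t] --> t^-1 by apply: cvgV.
have n0 : prof_tau t != 0 by rewrite gt_eqF.
have nt : 1 + t != 0 by rewrite gt_eqF// addr_gt0.
rewrite /prof2 /g1; apply: cvgM; first exact: cvg_cst.
apply: cvgM; first exact: (is_derive_continuous (is_derive_pow _ t0)).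
apply: cvgB; last first.
  apply: cvgM; last exact: (is_derive_continuous (is_derive_g t0)).
  by apply: cvgM => //; exact: cvg_cst.
apply: cvgD.
  apply: cvgM; first exact: cvg_cst.
  apply: cvgV; first by rewrite !mulf_neq0 ?expf_neq0.
  apply: cvgM; last exact: cvgM.
  exact: is_derive_continuous (is_deriveX 2 (is_derive_tau t0)).
apply: cvgM.
  by apply: cvgB => //; apply: cvgM => //; exact: cvg_cst.
apply: cvgV; first by rewrite !mulf_neq0 ?expf_neq0.
apply: cvgM; first exact: is_derive_continuous (is_deriveX 3 (is_derive_tau t0)).
have d1t := is_deriveD (is_derive_cst (1 : R) t 1) (is_derive_id t (1 : R)).
exact: is_derive_continuous (is_deriveX 2 d1t).
Qed.

End profile.

(** * Growth of the profile at 0 *)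

Section profile_bounds.
Context {R : realType}.
Variables (m : nat) (delta : R).
Hypotheses (m0 : (0 < m)%N) (delta0 : 0 < delta).
Implicit Types t : R.

Local Notation s := (m%:R^-1 : R).
Local Notation prof := (prof m delta).
Local Notation tau := (prof_tau m).

Lemma prof_tau_le (eta : R) : 0 < eta -> exists2 c : R, 0 < c &
  forall t, 0 < t <= 1 -> tau t <= c * t `^ (- eta).
Proof.
move=> eta0; exists (2 * m%:R + ln 2 + eta^-1) => [|t /andP[t0 t1]].
  by rewrite ltr_wpDl ?invr_gt0// addr_ge0 ?mulr_ge0// ln_ge0// ler1n.
have tV : 1 <= t^-1 by rewrite invf_ge1.
have p1 : 1 <= t `^ (- eta).
  rewrite powRN invf_ge1 ?powR_gt0//.
  have := @ge0_ler_powR R eta (ltW eta0) t 1; rewrite powR1; apply => //.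
    by rewrite nnegrE ltW.
  by rewrite nnegrE.
have lt : ln t^-1 <= eta^-1 * t `^ (- eta).
  rewrite ler_pdivlMl//.
  have := ln_sublinear (powR_gt0 (- eta) t0).
  by rewrite ln_powR lnV ?posrE// mulNr mulrN => /ltW.
have : ln (1 + t^-1) <= ln 2 + ln t^-1.
  rewrite -lnM ?posrE ?invr_gt0// ler_ln ?posrE ?addr_gt0 ?mulr_gt0 ?invr_gt0//.
  by rewrite mulr_natl mulr2n lerD2r.
have l2 : 0 <= ln (2 : R) by rewrite ln_ge0// ler1n.
have m2 : 0 <= 2 * m%:R :> R by rewrite mulr_ge0.
rewrite /prof_tau; set L := ln (1 + _); set l := ln t^-1 in lt *; set P := t `^ _ in p1 lt *.
move: lt; set E := eta^-1; nra.
Qed.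

Lemma prof_lower (kappa : R) : kappa < s -> exists2 c : R, 0 < c &
  forall t, 0 < t <= 1 -> c * t `^ (- kappa) <= - prof t.
Proof.
move=> ks; have [|c c0 Hc] := @prof_tau_le (s - kappa); first lra.
exists (delta / c) => [|t t01]; first by rewrite divr_gt0.
have t0 : 0 < t by case/andP: t01.
rewrite /prof opprK -mulrA ler_pM2l// ler_pdivlMr ?prof_tau_gt0//.
rewrite -mulrA ler_pdivrMl//.
have -> : c * t `^ (- s) = t `^ (- kappa) * (c * t `^ (- (s - kappa))).
  rewrite mulrCA -powRD; last by apply/implyP => _; rewrite gt_eqF.
  by congr (_ * powR _ _); ring.
by rewrite ler_wpM2l ?powR_ge0// Hc.
Qed.

Lemma prof_diverges (c : R) : exists2 t0 : R, 0 < t0 & forall t, 0 < t < t0 -> prof t < c.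
Proof.
have s0 : 0 < s by rewrite invr_gt0 ltr0n.
have [|k k0 Hk] := @prof_lower (s / 2); first lra.
pose M := (`|c| + 1) / k; have M0 : 0 < M by rewrite divr_gt0// ltr_wpDl.
have M1 : 0 < M `^ (- (s / 2)^-1) by rewrite powR_gt0.
exists (Num.min 1 (M `^ (- (s / 2)^-1))) => [|t /andP[t0]]; first by rewrite lt_min ltr01 M1.
rewrite lt_min => /andP[t1 tM].
have {}Hk := Hk t; rewrite t0 (ltW t1) in Hk; have {}Hk := Hk isT.
have : M <= t `^ (- (s / 2)).
  have -> : M = (M `^ (- (s / 2)^-1)) `^ (- (s / 2)).
    by rewrite -powRrM mulrNN mulVf ?powRr1 ?(ltW M0)// gt_eqF// divr_gt0.
  rewrite !(powRN _ (s / 2)) lef_pV2 ?posrE ?powR_gt0//.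
  apply: ge0_ler_powR; last exact: ltW.
  - by rewrite divr_ge0// ltW.
  - by rewrite nnegrE ltW.
  - by rewrite nnegrE ltW.
rewrite -(ler_pM2l k0) {1}/M mulrC divfK ?gt_eqF// => H.
have := ler_norm (- c); rewrite normrN; lra.
Qed.

(** At t = 4^-(j+1) the power contributes exactly 4^((j+1) n). The denominator satisfies tau >=
    (j+1)/2 and tau >= 1, so its exponent nm can be lowered to 2, which still gives a summable
    series. *)
Lemma prof_upper (n j : nat) : (1 < n)%N ->
  (- prof (4 ^- j.+1)) ^+ (n * m) <=
    delta ^+ (n * m) * 4 * 4 ^+ (j.+1 * n) / j.+1%:R ^+ 2.
Proof.
move=> n1; set t : R := 4 ^- j.+1; have t0 : 0 < t by rewrite invr_gt0 exprn_gt0.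
have T0 := prof_tau_gt0 m0 t0; have T1 := prof_tau_ge m t0.
have m1 : 1 <= m%:R :> R by rewrite ler1n.
have Tj : j.+1%:R / 2 <= tau t.
  have : j.+1%:R / 2 <= ln t^-1.
    rewrite /t invrK lnXn// -[leRHS]mulr_natl ler_pM2l ?ltr0n//.
    (* A crude bound is enough: ln(1/4) <= -3/4 gives ln 4 >= 1/2. *)
    have := @le_ln1Dx R (- (3 / 4)).
    have -> : 1 + - (3 / 4) = 4^-1 :> R by field.
    by rewrite lnV ?posrE//; lra.
  have : ln t^-1 <= ln (1 + t^-1).
    by rewrite ler_ln ?posrE ?addr_gt0 ?invr_gt0// lerDr.
  rewrite /prof_tau; lra.
rewrite /prof opprK exprMn -!mulrA ler_pM2l ?exprn_gt0// expr_div_n.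
have -> : (t `^ (- s)) ^+ (n * m) = 4 ^+ (j.+1 * n).
  rewrite -powR_mulrn ?powR_ge0// -powRrM.
  have -> : - s * (n * m)%:R = - n%:R.
    by rewrite natrM; field; rewrite gt_eqF// ltr0n.
  by rewrite powRN powR_mulrn ?ltW// /t exprVn invrK exprM.
rewrite mulrCA ler_pM2l ?exprn_gt0//.
rewrite -[4 / _]invrK invf_div lef_pV2 ?posrE ?divr_gt0 ?exprn_gt0// ?ltr0n//.
have -> : j.+1%:R ^+ 2 / 4 = (j.+1%:R / 2) ^+ 2 :> R by field.
apply: (@le_trans _ _ (tau t ^+ 2)).
  by rewrite lerXn2r ?nnegrE ?divr_ge0// ltW.
rewrite ler_weXn2l//; first lra.
by rewrite (@leq_trans n)// leq_pmulr.
Qed.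

End profile_bounds.

(** * Smooth radial functions *)

Section radial.
Context {R : realType} {n : nat}.
Local Notation rV := 'rV[R]_n.
Local Notation mu := (@lebesgue_rV R n).
Implicit Types (a x : rV).

Definition sqdist a x : R := \sum_i (x ord0 i - a ord0 i) ^+ 2.

Lemma sqdist_ge0 a x : 0 <= sqdist a x.
Proof. by apply: sumr_ge0 => i _; exact: sqr_ge0. Qed.

Lemma sqdistxx a : sqdist a a = 0.
Proof. by rewrite /sqdist big1// => i _; rewrite subrr expr0n. Qed.

Lemma sqdist_coord_le a x i : (x ord0 i - a ord0 i) ^+ 2 <= sqdist a x.
Proof.
by rewrite /sqdist (bigD1 i)//= lerDl; apply: sumr_ge0 => k _; exact: sqr_ge0.
Qed.

Lemma sqdist_gt0 a x : x != a -> 0 < sqdist a x.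
Proof.
move=> xa; have [i xi] : exists i, x ord0 i != a ord0 i.
  apply: contrapT => H; move/eqP: xa; apply; apply/rowP => i.
  by apply/eqP; apply: contrapT => xi; apply: H; exists i; exact/negP.
apply: lt_le_trans (sqdist_coord_le a x i).
by rewrite exprn_even_gt0//= subr_eq0.
Qed.

Lemma sqdist_upd a x i s : sqdist a (rV_upd x i s) =
  sqdist a x - (x ord0 i - a ord0 i) ^+ 2 + (s - a ord0 i) ^+ 2.
Proof.
rewrite /sqdist (bigD1 i)//= [in RHS](bigD1 i)//= mxE eqxx.
rewrite (eq_bigr (fun k => (x ord0 k - a ord0 k) ^+ 2)) => [|k ki]; first ring.
by rewrite mxE (negbTE ki).
Qed.

Lemma sqdist_box_le a x r : box a r x -> sqdist a x <= n%:R * r ^+ 2.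
Proof.
move=> xr; apply: le_trans (_ : \sum_(i < n) r ^+ 2 <= _).
  apply: ler_sum => i _.
  by have := xr i; rewrite ler_norml => /andP[? ?]; nra.
by rewrite sumr_const card_ord mulr_natl.
Qed.

Lemma radial_is_derive (F F' : R -> R) (eps : R) a x i (s : R) : 0 < eps ->
  (forall t : R, 0 < t -> is_derive t 1 F (F' t)) ->
  is_derive s 1 (fun t : R => F (sqdist a (rV_upd x i t) + eps))
    (F' (sqdist a (rV_upd x i s) + eps) * (2 * (s - a ord0 i))).
Proof.
move=> e0 dF; pose c := sqdist a x - (x ord0 i - a ord0 i) ^+ 2 + eps.
have E t : sqdist a (rV_upd x i t) + eps = c + (t - a ord0 i) ^+ 2.
  by rewrite sqdist_upd /c; ring.
have -> : (fun t => F (sqdist a (rV_upd x i t) + eps)) =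
    F \o (fun t => c + (t - a ord0 i) ^+ 2) by apply/funext => t /=; rewrite E.
rewrite E; apply: is_derive1_comp.
  by apply: dF; rewrite -E ltr_wpDl ?sqdist_ge0.
have d := is_deriveD (is_derive_cst c s 1)
  (is_deriveX 2 (is_deriveB (is_derive_id s (1 : R)) (is_derive_cst (a ord0 i) s 1))).
apply: (is_derive_eq d).
by rewrite /GRing.scale/= !fctE; ring.
Qed.

Lemma sqdist_continuous a : continuous (sqdist a).
Proof.
move=> x; have c i : {for x, continuous (fun y : rV => (y ord0 i - a ord0 i) ^+ 2)}.
  have c0 : {for x, continuous (fun y : rV => y ord0 i - a ord0 i)}.
    by apply: continuousB; [exact: coord_continuous|exact: cst_continuous].
  exact: (continuousM c0 c0).
rewrite /continuous_at /sqdist.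
by apply: cvg_big => [||i _]; [exact: add_continuous|exact: (nbhs_filter x)|exact: c].
Qed.

Lemma radial_continuous (F : R -> R) (eps : R) a : 0 < eps ->
  (forall t : R, 0 < t -> {for t, continuous F}) ->
  continuous (fun x => F (sqdist a x + eps)).
Proof.
move=> e0 cF x; apply: (@continuous_comp _ _ _ (fun x => sqdist a x + eps) F).
  by apply: continuousD; [exact: sqdist_continuous|exact: cst_continuous].
by apply: cF; rewrite ltr_wpDl ?sqdist_ge0.
Qed.

Lemma rV_upd_continuous x i : continuous (fun s : R => rV_upd x i s).
Proof.
move=> s; apply/cvg_ballP => e e0; near=> t; split=> // j k.
rewrite !mxE; case: eqP => _; last exact: ballxx.
by near: t; apply/nbhs_ballP; exists e.
Unshelve. all: by end_near.
Qed.

Lemma compact_measurable_rV (K : set rV) : compact K -> measurable K.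
Proof.
by move=> cK; apply: closed_measurable_rV; apply: compact_closed => //; exact: norm_hausdorff.
Qed.

Lemma compact_sub_box (K : set rV) a : compact K -> exists2 r : R, 0 < r & K `<=` box a r.
Proof.
move=> /compact_bounded[M [_ HM]].
exists (`|M| + 1 + `|a|) => [|x Kx i]; first by rewrite ltr_wpDr// ltr_wpDl.
have Mx : `|x| <= `|M| + 1 by apply: (HM _ _ x Kx); rewrite (le_lt_trans (ler_norm _))// ltrDl.
apply: le_trans (ler_normB _ _) _; apply: lerD.
  apply: le_trans Mx; rewrite /Num.norm/= mx_normrE.
  by apply: le_bigmax (ord0, i).
rewrite {2}/Num.norm/= mx_normrE.
by apply: le_bigmax (ord0, i).
Qed.

Lemma compact_lebesgue_lty (K : set rV) : compact K -> (mu K < +oo)%E.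
Proof.
move=> cK; have [r r0 Kr] := compact_sub_box 0 cK.
apply: (@le_lt_trans _ _ (mu (box 0 r))).
  by apply: le_measure => //; rewrite inE; [exact: compact_measurable_rV|exact: measurable_box].
by rewrite lebesgue_rV_box ?ltry// ltW.
Qed.

Lemma continuous_compact_bounded (K : set rV) (f : rV -> R) : compact K -> continuous f ->
  exists2 M : R, 0 < M & forall x, K x -> `|f x| <= M.
Proof.
move=> cK cf; have cfK : compact (f @` K).
  by apply: continuous_compact => //; exact: continuous_subspaceT.
have /compact_bounded[M [_ HM]] := cfK.
exists (`|M| + 1) => [|x Kx]; first by rewrite ltr_wpDl.
apply: (HM (`|M| + 1)); last by exists x.
by rewrite (le_lt_trans (ler_norm _))// ltrDl.
Qed.

Lemma continuous_compact_integrable (K : set rV) (f : rV -> R) : compact K -> continuous f ->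
  mu.-integrable K (EFin \o f).
Proof.
move=> cK cf; apply: measurable_bounded_integrable.
- exact: compact_measurable_rV.
- exact: compact_lebesgue_lty.
- by apply: measurable_funTS; exact: continuous_measurable_rV.
- have [M M0 HM] := continuous_compact_bounded cK cf.
  exists M; split=> [|y My x Kx]; first exact: num_real.
  exact: le_trans (HM x Kx) (ltW My).
Qed.

Lemma box_compact a r : compact (box a r).
Proof.
have -> : box a r = [set x : rV | forall i, `[a ord0 i - r, a ord0 i + r]%classic (x ord0 i)].
  by apply/seteqP; split=> x /= H i; have := H i; rewrite in_itv/= ler_distl.
apply: (@rV_compact _ _ (fun i => `[a ord0 i - r, a ord0 i + r]%classic)).
by move=> i; exact: segment_compact.
Qed.

End radial.

Section partials.
Context {R : realType} {n : nat}.
Local Notation I := 'I_(n.*2).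
Local Notation Cn := (Cspace R n).
Local Notation mu := (@lebesgue_rV R n.*2).
Implicit Types (phi : Cn -> R) (x : Cn).

Lemma partial_line_is_derive (i : I) phi x (s : R) :
  differentiable phi (rV_upd x i s) ->
  is_derive s 1 (fun t : R => phi (rV_upd x i t)) (partial i phi (rV_upd x i s)).
Proof.
move=> dphi; have dv : derivable phi (rV_upd x i s) (delta_mx ord0 i).
  exact: diff_derivable.
have E (h : R) : rV_upd x i (h + s) = h *: delta_mx ord0 i + rV_upd x i s.
  apply/rowP => k; rewrite !mxE eqxx/=; case: eqP => _; first by rewrite mulr1.
  by rewrite mulr0 add0r.
have F : (fun h : R => h^-1 *: (phi (rV_upd x i (h *: 1 + s)) - phi (rV_upd x i s))) =
    (fun h : R => h^-1 *: (phi (h *: delta_mx ord0 i + rV_upd x i s) - phi (rV_upd x i s))).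
  by apply/funext => h; rewrite -E /GRing.scale/= mulr1.
apply: DeriveDef; first by rewrite /derivable F; exact: dv.
by rewrite /derive F.
Qed.

Lemma smooth_partial phi i : smooth phi -> smooth (partial i phi).
Proof. by move=> sphi s x; have := sphi (rcons s i) x; rewrite -cats1 foldr_cat. Qed.

Lemma smooth_differentiable phi x : smooth phi -> differentiable phi x.
Proof. by move=> /(_ [::] x). Qed.

Lemma smooth_continuous phi : smooth phi -> continuous phi.
Proof. by move=> sphi x; apply: differentiable_continuous; exact: smooth_differentiable. Qed.

Lemma partial_eq0 phi i x : ~ closure [set y | phi y != 0] x -> partial i phi x = 0.
Proof.
move=> Nx; have : \forall y \near x, phi y = 0.
  have := open_nbhs_nbhs (conj (closed_openC (@closed_closure _ [set y | phi y != 0])) Nx).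
  apply: filterS => y Ny; apply/eqP; apply: contrapT => /negP phiy.
  by apply: Ny; exact: subset_closure.
move=> near0; rewrite /partial -(@derive_cst R _ _ (0 : R) x (delta_mx ord0 i)).
exact: near_eq_derive near0.
Qed.

Lemma closure_partial phi i :
  closure [set y | partial i phi y != 0] `<=` closure [set y | phi y != 0].
Proof.
have /closure_id -> := @closed_closure _ [set y | phi y != 0].
apply: closure_subset => y /= /eqP py; apply: contrapT => Ny; apply: py; exact: partial_eq0.
Qed.

End partials.

(** * Integration by parts in one coordinate *)

Section box_ibp.
Context {R : realType} {n : nat}.
Local Notation rV := 'rV[R]_n.
Local Notation mu := (@lebesgue_rV R n).

Lemma continuous_mul (f g : rV -> R) : continuous f -> continuous g ->
  continuous (fun x => f x * g x).
Proof. by move=> cf cg x; exact: (continuousM (cf x) (cg x)). Qed.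

Lemma continuous_add (f g : rV -> R) : continuous f -> continuous g ->
  continuous (fun x => f x + g x).
Proof. by move=> cf cg x; exact: (continuousD (cf x) (cg x)). Qed.

Lemma continuous_opp (f : rV -> R) : continuous f -> continuous (fun x => - f x).
Proof. by move=> cf x; exact: (continuousN (cf x)). Qed.

(** The hypothesis on slices serves two cases: a box containing the support of a test function
    strictly inside, and a ball with [q] vanishing on its boundary. *)
Lemma integral_by_parts (A : set rV) i (p p' q q' : rV -> R) :
  compact A ->
  continuous p -> continuous p' -> continuous q -> continuous q' ->
  (forall x (s : R), is_derive s 1 (fun t : R => p (rV_upd x i t)) (p' (rV_upd x i s))) ->
  (forall x (s : R), is_derive s 1 (fun t : R => q (rV_upd x i t)) (q' (rV_upd x i s))) ->
  (forall x, A x -> exists l r : R, [/\ l <= r,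
     forall s, A (rV_upd x i s) <-> l <= s <= r,
     q (rV_upd x i l) = 0 & q (rV_upd x i r) = 0]) ->
  (\int[mu]_(x in A) (p x * q' x)%:E = \int[mu]_(x in A) (- (p' x * q x))%:E)%E.
Proof.
move=> cA cp cp' cq cq' dp dq slices.
pose g x := p' x * q x + p x * q' x.
have cg : continuous g by apply: continuous_add; exact: continuous_mul.
have g0 : (\int[mu]_(x in A) (g x)%:E = 0)%E.
  apply: (integral_line_derivative0 (h := fun x => p x * q x) (i := i)).
  - exact: compact_measurable_rV.
  - exact: continuous_compact_integrable.
  - move=> x s; apply: (is_derive_eq (is_deriveM (dp x s) (dq x s))).
    by rewrite /g /GRing.scale/=; ring.
  - by move=> x s; apply: continuous_comp; [exact: rV_upd_continuous|exact: cg].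
  - move=> x /slices[l [r [lr sl ql qr]]]; exists l, r; split=> //.
      by rewrite ql mulr0.
    by rewrite qr mulr0.
have cN : continuous (fun x => - (p' x * q x)) by apply/continuous_opp/continuous_mul.
transitivity (\int[mu]_(x in A) ((EFin \o g) \+ (EFin \o (fun x => - (p' x * q x)))%R) x)%E.
  by apply: eq_integral => x _ /=; rewrite -EFinD /g; congr (_%:E); ring.
rewrite integralD_EFin//; first by rewrite g0 add0e.
- exact: compact_measurable_rV.
- exact: continuous_compact_integrable.
- exact: continuous_compact_integrable.
Qed.

Lemma box_slices (M : R) i (x : rV) : box 0 M x ->
  forall s, box 0 M (rV_upd x i s) <-> - M <= s <= M.
Proof.
move=> xM s; split=> [/(_ i)|sM k]; first by rewrite !mxE eqxx subr0 ler_norml.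
by rewrite !mxE subr0; case: eqP => _; [rewrite ler_norml|have := xM k; rewrite mxE subr0].
Qed.

Lemma box_ibp (M r : R) i (p p' q q' : rV -> R) : r < M -> 0 <= M ->
  continuous p -> continuous p' -> continuous q -> continuous q' ->
  (forall x (s : R), is_derive s 1 (fun t : R => p (rV_upd x i t)) (p' (rV_upd x i s))) ->
  (forall x (s : R), is_derive s 1 (fun t : R => q (rV_upd x i t)) (q' (rV_upd x i s))) ->
  (forall x, ~ box 0 r x -> q x = 0) ->
  (\int[mu]_(x in box 0 M) (p x * q' x)%:E =
   \int[mu]_(x in box 0 M) (- (p' x * q x))%:E)%E.
Proof.
move=> rM M0 cp cp' cq cq' dp dq q0; apply: (integral_by_parts (i := i)) => //.
  exact: box_compact.
move=> x xM; exists (- M), M; split; first lra.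
- exact: box_slices.
- apply: q0 => /(_ i); rewrite !mxE eqxx subr0 normrN; apply/negP; rewrite -ltNge ger0_norm//.
- apply: q0 => /(_ i); rewrite !mxE eqxx subr0; apply/negP; rewrite -ltNge ger0_norm//.
Qed.

End box_ibp.

Lemma continuous_compose (T U V : topologicalType) (f : T -> U) (g : U -> V) :
  continuous f -> continuous g -> continuous (fun x => g (f x)).
Proof. by move=> cf cg x; exact: continuous_comp (cf x) (cg (f x)). Qed.

(** * Weak Hessian and sub-mean value property of radial functions *)

Section smooth_radial.
Context {R : realType} {n : nat}.
Local Notation I := 'I_(n.*2).
Local Notation Cn := (Cspace R n).
Local Notation mu := (@lebesgue_rV R n.*2).
Variables (F F1 F2 : R -> R) (eps : R) (a : Cn).
Hypotheses (eps0 : 0 < eps)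
  (dF : forall t : R, 0 < t -> is_derive t 1 F (F1 t))
  (dF1 : forall t : R, 0 < t -> is_derive t 1 F1 (F2 t))
  (cF2 : forall t : R, 0 < t -> {for t, continuous F2}).

Local Notation y x := (sqdist a x + eps).

Definition radial_hessian (x : Cn) (i k : I) : R :=
  2 * F1 (y x) * (i == k)%:R + 4 * F2 (y x) * ((x - a) ord0 i * (x - a) ord0 k).

Let cF t : 0 < t -> {for t, continuous F}.
Proof. by move=> t0; exact: is_derive_continuous (dF t0). Qed.

Let cF1 t : 0 < t -> {for t, continuous F1}.
Proof. by move=> t0; exact: is_derive_continuous (dF1 t0). Qed.

Let grad i x : R := F1 (y x) * (2 * (x ord0 i - a ord0 i)).

Let coord_sub_continuous (b : Cn) i : continuous (fun x : Cn => x ord0 i - b ord0 i).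
Proof.
move=> x; apply: continuousB; first exact: coord_continuous.
exact: cst_continuous.
Qed.

Let grad_continuous i : continuous (grad i).
Proof.
apply: continuous_mul; first exact: radial_continuous.
by apply: continuous_mul; [exact: cst_continuous|exact: coord_sub_continuous].
Qed.

Let hessian_continuous i k : continuous (fun x => radial_hessian x i k).
Proof.
have E x : radial_hessian x i k = F1 (y x) * (2 * (i == k)%:R) +
    F2 (y x) * (4 * ((x ord0 i - a ord0 i) * (x ord0 k - a ord0 k))).
  by rewrite /radial_hessian !mxE; ring.
rewrite (funext E); apply: continuous_add.
  by apply: continuous_mul; [exact: radial_continuous|exact: cst_continuous].
apply: continuous_mul; first exact: radial_continuous.
apply: continuous_mul; first exact: cst_continuous.
by apply: continuous_mul; exact: coord_sub_continuous.
Qed.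

Let grad_line i x (s : R) :
  is_derive s 1 (fun t : R => F (y (rV_upd x i t))) (grad i (rV_upd x i s)).
Proof.
apply: (is_derive_eq (radial_is_derive a x i s eps0 dF)).
by rewrite /grad mxE eqxx.
Qed.

Let hessian_line i k x (s : R) :
  is_derive s 1 (fun t : R => grad i (rV_upd x k t)) (radial_hessian (rV_upd x k s) i k).
Proof.
have d1 := radial_is_derive a x k s eps0 dF1.
have d2 : is_derive s 1 (fun t : R => 2 * (rV_upd x k t ord0 i - a ord0 i)) (2 * (i == k)%:R).
  have [->|ik] := eqVneq i k.
    have -> : (fun t : R => 2 * (rV_upd x k t ord0 k - a ord0 k)) =
       (fun t => 2 * (t - a ord0 k)) by apply/funext => t; rewrite mxE eqxx.
    have d := is_deriveM (is_derive_cst (2 : R) s 1)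
      (is_deriveB (is_derive_id s (1 : R)) (is_derive_cst (a ord0 k) s 1)).
    by apply: (is_derive_eq d); rewrite /GRing.scale/= !fctE; ring.
  have -> : (fun t : R => 2 * (rV_upd x k t ord0 i - a ord0 i)) =
     cst (2 * (x ord0 i - a ord0 i)) by apply/funext => t; rewrite mxE (negbTE ik).
  by apply: (is_derive_eq (is_derive_cst _ s 1)); rewrite mulr0.
apply: (is_derive_eq (is_deriveM d1 d2)).
by rewrite /radial_hessian /GRing.scale/= !mxE eqxx; ring.
Qed.

(** Two integrations by parts. The support lies in a strictly smaller box, so [phi] and its partial
    derivatives vanish on the faces and no boundary term appears. *)
Lemma radial_ibp2 phi (r M : R) i k : smooth phi -> r < M -> 0 <= M ->
  closure [set x | phi x != 0] `<=` box 0 r ->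
  (\int[mu]_(x in box 0 M) (F (y x) * partial i (partial k phi) x)%:E =
   \int[mu]_(x in box 0 M) (phi x * radial_hessian x i k)%:E)%E.
Proof.
move=> sphi rM M0 supp.
have sk := smooth_partial k sphi; have sik := smooth_partial i sk.
have cw : continuous (fun x => F (y x)) by exact: radial_continuous.
have line (psi : Cn -> R) j : smooth psi -> forall x (s : R),
    is_derive s 1 (fun t : R => psi (rV_upd x j t)) (partial j psi (rV_upd x j s)).
  by move=> spsi x s; apply: partial_line_is_derive; exact: smooth_differentiable.
have sk0 (x : Cn) : ~ box 0 r x -> partial k phi x = 0.
  by move=> Nx; apply: partial_eq0 => /supp.
have s0 (x : Cn) : ~ box 0 r x -> phi x = 0.
  move=> Nx; apply/eqP; apply: contrapT => /negP phix.
  by apply/Nx/supp/subset_closure.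
have H1 := box_ibp rM M0 cw (@grad_continuous i) (smooth_continuous sk)
  (smooth_continuous sik) (grad_line i) (line _ i sk) sk0.
have gN (x : Cn) (s : R) : is_derive s 1 (fun t : R => - grad i (rV_upd x k t))
    (- radial_hessian (rV_upd x k s) i k).
  by have h := hessian_line i k x s; exact: is_deriveN.
have H2 := box_ibp rM M0 (continuous_opp (@grad_continuous i))
  (continuous_opp (@hessian_continuous i k)) (smooth_continuous sphi)
  (smooth_continuous sk) gN (line _ k sphi) s0.
rewrite H1.
transitivity (\int[mu]_(x in box 0%R M) ((- grad i x) * partial k phi x)%:E)%E.
  by apply: eq_integral => x _; rewrite mulNr.
rewrite H2; apply: eq_integral => x _; congr (_%:E); ring.
Qed.

Lemma radial_top_re_integral theta phi (r M : R) : smooth phi -> r < M -> 0 <= M ->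
  closure [set x | phi x != 0] `<=` box 0 r ->
  (\int[mu]_(x in box 0 M)
     (F (y x) * top_re theta (fun i k => partial i (partial k phi) x))%:E =
   \int[mu]_(x in box 0 M) (phi x * top_re theta (radial_hessian x))%:E)%E.
Proof.
move=> sphi rM M0 supp.
have cphi := smooth_continuous sphi.
have cw : continuous (fun x => F (y x)) by exact: radial_continuous.
have cB := @box_compact R n.*2 0 M; have mB := compact_measurable_rV cB.
have step (f : Cn -> R) (S : Cn -> I -> I -> R) : continuous f ->
    (forall i k, continuous (fun x => S x i k)) ->
    (\int[mu]_(x in box 0%R M) (f x * top_re theta (S x))%:E =
     \sum_i \sum_k (top_re_coef theta i k)%:E *
        \int[mu]_(x in box 0%R M) (f x * S x i k)%:E)%E.
  move=> cf cS.
  have int i k : mu.-integrable (box 0 M) (EFin \o (fun x => f x * S x i k)).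
    by apply: continuous_compact_integrable => //; exact: continuous_mul.
  have int2 i k : mu.-integrable (box 0 M)
     (fun x => (top_re_coef theta i k)%:E * (f x * S x i k)%:E)%E.
    exact: (integrableZl mB _ (int i k)).
  transitivity (\int[mu]_(x in box 0%R M) (\sum_i \sum_k
     ((top_re_coef theta i k)%:E * (f x * S x i k)%:E)))%E.
    apply: eq_integral => x _; rewrite top_re_lin mulr_sumr -sumEFin.
    apply: eq_bigr => i _; rewrite mulr_sumr -sumEFin; apply: eq_bigr => k _.
    by rewrite -EFinM; congr (_%:E); ring.
  rewrite integral_sum//; last first.
    by move=> i; apply: integrable_sum => // k _; exact: int2.
  apply: eq_bigr => i _; rewrite integral_sum//.
  by apply: eq_bigr => k _; rewrite integralZl//; exact: int.
have chess i k : continuous (partial i (partial k phi)).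
  by apply: smooth_continuous; do 2! apply: smooth_partial.
apply: etrans (step (fun x => F (y x)) _ cw chess) _.
apply: etrans (esym (step phi _ cphi (@hessian_continuous))).
apply: eq_bigr => i _; apply: eq_bigr => k _; congr (_ * _)%E.
exact: (radial_ibp2 i k sphi rM M0 supp).
Qed.

Lemma cballE (b : Cn) (r : R) : cball b r = [set x | sqdist b x <= r ^+ 2].
Proof. by []. Qed.

Lemma cball_sub_box (b : Cn) (r : R) : 0 <= r -> cball b r `<=` box b r.
Proof.
move=> r0 x xr i; rewrite -(@ler_pXn2r _ 2)// ?nnegrE// real_normK ?num_real//.
exact: le_trans (sqdist_coord_le b x i) xr.
Qed.

Lemma cball_compact (b : Cn) (r : R) : 0 <= r -> compact (cball b r).
Proof.
move=> r0; apply: subclosed_compact (@box_compact R n.*2 b r) (cball_sub_box r0).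
rewrite cballE; apply: (@preimage_closed _ _ (sqdist b) [set t : R | t <= r ^+ 2]).
  by move=> x _; exact: sqdist_continuous.
exact: closed_le.
Qed.

Let cball_slices (b : Cn) (r : R) i (x : Cn) : cball b r x -> exists l u : R, [/\ l <= u,
  forall s, cball b r (rV_upd x i s) <-> l <= s <= u,
  (sqdist b (rV_upd x i l) - r ^+ 2) / 2 = 0 &
  (sqdist b (rV_upd x i u) - r ^+ 2) / 2 = 0].
Proof.
rewrite cballE /= => xr; pose d := r ^+ 2 - (sqdist b x - (x ord0 i - b ord0 i) ^+ 2).
have d0 : 0 <= d by rewrite /d; have := sqr_ge0 (x ord0 i - b ord0 i); lra.
have E s : sqdist b (rV_upd x i s) - r ^+ 2 = (s - b ord0 i) ^+ 2 - d.
  by rewrite sqdist_upd /d; ring.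
exists (b ord0 i - Num.sqrt d), (b ord0 i + Num.sqrt d); split.
- by have := sqrtr_ge0 d; lra.
- move=> s; rewrite -subr_le0 E subr_le0 -ler_distl.
  by rewrite -(ler_sqrt _ d0) sqrtr_sqr.
- by rewrite E [b ord0 i - _]addrC addrK sqrrN sqr_sqrtr// subrr mul0r.
- by rewrite E [b ord0 i + _]addrC addrK sqr_sqrtr// subrr mul0r.
Qed.

Hypothesis lap_ge0 : forall x, 0 <= \sum_i radial_hessian x i i.

(** Dilation about [b]: r = 0 collapses the ball to its centre and r = 1 is the identity, so the
    sub-mean value property compares these two values of r. *)
Let scaled (b : Cn) (r : R) (x : Cn) : Cn := b + r *: (x - b).

Let scaled_upd b r x i s :
  scaled b r (rV_upd x i s) = rV_upd (scaled b r x) i (b ord0 i + r * (s - b ord0 i)).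
Proof. by apply/rowP => k; rewrite !mxE; case: eqP => // ->. Qed.

Let scaled_continuous b r : continuous (scaled b r).
Proof.
have E (x : Cn) : scaled b r x = (r *: x) + (b - r *: b).
  by rewrite /scaled scalerBr; apply/rowP => k; rewrite !mxE; ring.
rewrite (funext E) => x.
exact: (cvgD (@scaler_continuous _ Cn r x) (cvg_cst (b - r *: b))).
Qed.

Let scaled_is_derive b x (r : R) : is_derive r 1 (fun r : R => F (y (scaled b r x)))
  (\sum_i grad i (scaled b r x) * (x ord0 i - b ord0 i)).
Proof.
pose h r := sqdist a (scaled b r x) + eps.
pose A := sqdist a b + eps.
pose B : R := \sum_i (b ord0 i - a ord0 i) * (x ord0 i - b ord0 i).
pose D : R := \sum_i (x ord0 i - b ord0 i) ^+ 2.
(* Along the dilation the squared distance to [a] is a quadratic polynomial in r. *)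
have hE r' : h r' = A + (r' * (2 * B) + r' ^+ 2 * D).
  rewrite /h /A -addrA [eps + _]addrC addrA; congr (_ + _).
  rewrite /sqdist /B /D !mulr_sumr -!big_split; apply: eq_bigr => i _ /=.
  by rewrite !mxE; ring.
have dh : is_derive r 1 h (2 * B + 2 * r * D).
  rewrite (funext hE).
  have d := is_deriveD (is_derive_cst A r 1) (is_deriveD
    (is_deriveM (is_derive_id r (1 : R)) (is_derive_cst (2 * B) r 1))
    (is_deriveM (is_deriveX 2 (is_derive_id r (1 : R))) (is_derive_cst D r 1))).
  by apply: (is_derive_eq d); rewrite /GRing.scale/= !fctE; ring.
have h0 : 0 < h r by rewrite /h ltr_wpDl ?sqdist_ge0.
apply: (is_derive_eq (is_derive1_comp (dF h0) dh)).
rewrite /B /D !mulr_sumr -big_split mulr_sumr; apply: eq_bigr => i _ /=.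
by rewrite /grad -/(h r) !mxE; ring.
Qed.

(* x_i - b_i is the i-th partial derivative of (|x - b|^2 - rho^2) / 2, which
   vanishes on the boundary of the ball. *)
Let scaled_integral_ge0 b rho (r : R) : 0 < rho -> 0 <= r ->
  (0 <= \int[mu]_(x in cball b rho)
     (\sum_i grad i (scaled b r x) * (x ord0 i - b ord0 i))%:E)%E.
Proof.
move=> rho0 r0; have cB := @cball_compact b rho (ltW rho0).
have mB := compact_measurable_rV cB.
pose q (x : Cn) := (sqdist b x - rho ^+ 2) / 2.
have cq : continuous q.
  apply: continuous_mul; last exact: cst_continuous.
  by apply: continuous_add; [exact: sqdist_continuous|exact: cst_continuous].
have dq i (x : Cn) (s : R) : is_derive s 1 (fun t : R => q (rV_upd x i t))
    (rV_upd x i s ord0 i - b ord0 i).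
  have E t : q (rV_upd x i t) = ((t - b ord0 i) ^+ 2 +
      (sqdist b x - (x ord0 i - b ord0 i) ^+ 2 - rho ^+ 2)) / 2.
    by rewrite /q sqdist_upd; ring.
  rewrite (funext E) mxE eqxx; set c := _ - rho ^+ 2.
  have d := is_deriveM (is_deriveD (is_deriveX 2 (is_deriveB (is_derive_id s (1 : R))
    (is_derive_cst (b ord0 i) s 1))) (is_derive_cst c s 1)) (is_derive_cst (2^-1 : R) s 1).
  by apply: (is_derive_eq d); rewrite /GRing.scale/= !fctE; field.
have cgs i : continuous (fun x => grad i (scaled b r x)).
  exact: (continuous_compose (@scaled_continuous b r) (@grad_continuous i)).
have chs i : continuous (fun x => r * radial_hessian (scaled b r x) i i).
  apply: continuous_mul; first exact: cst_continuous.
  exact: (continuous_compose (@scaled_continuous b r) (@hessian_continuous i i)).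
have ds i (x : Cn) (s : R) : is_derive s 1 (fun t : R => grad i (scaled b r (rV_upd x i t)))
    (r * radial_hessian (scaled b r (rV_upd x i s)) i i).
  have -> : (fun t : R => grad i (scaled b r (rV_upd x i t))) =
      (fun t => grad i (rV_upd (scaled b r x) i t)) \o (fun t => b ord0 i + r * (t - b ord0 i)).
    by apply/funext => t /=; rewrite scaled_upd.
  rewrite scaled_upd mulrC; apply: is_derive1_comp; first exact: hessian_line.
  have d := is_deriveD (is_derive_cst (b ord0 i) s 1) (is_deriveM (is_derive_cst r s 1)
     (is_deriveB (is_derive_id s (1 : R)) (is_derive_cst (b ord0 i) s 1))).
  by apply: (is_derive_eq d); rewrite /GRing.scale/= !fctE; ring.
have ibp i := integral_by_parts cB (cgs i) (chs i) cq (@coord_sub_continuous b i)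
  (ds i) (dq i) (@cball_slices b rho i).
have int1 i : mu.-integrable (cball b rho)
    (fun x => (grad i (scaled b r x) * (x ord0 i - b ord0 i))%:E).
  by apply: continuous_compact_integrable => //; apply: continuous_mul => //;
    exact: coord_sub_continuous.
have int2 i : mu.-integrable (cball b rho)
    (fun x => (- (r * radial_hessian (scaled b r x) i i * q x))%:E).
  by apply: continuous_compact_integrable => //; apply: continuous_opp; exact: continuous_mul.
under eq_integral do rewrite -sumEFin.
rewrite integral_sum//.
rewrite (eq_bigr _ (fun i _ => ibp i)) -integral_sum//.
apply: integral_ge0 => x xB; rewrite sumEFin lee_fin.
rewrite (eq_bigr (fun i => radial_hessian (scaled b r x) i i * (- (r * q x)))); last first.
  by move=> i _; ring.
rewrite -mulr_suml mulr_ge0// oppr_ge0 mulr_ge0_le0//.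
by move: xB; rewrite cballE /= /q; lra.
Qed.

(* The integral of w(b + r (x - b)) over the ball is nondecreasing in r: its
   derivative is an integral of the Laplacian of w against a nonnegative weight. *)
Lemma radial_submean b rho : 0 < rho ->
  ((F (y b))%:E * mu (cball b rho) <= \int[mu]_(x in cball b rho) (F (y x))%:E)%E.
Proof.
move=> rho0; have cB := @cball_compact b rho (ltW rho0).
have mB := compact_measurable_rV cB; have Boo := compact_lebesgue_lty cB.
have cw : continuous (fun x => F (y x)) by exact: radial_continuous.
have cws r : continuous (fun x => F (y (scaled b r x))).
  exact: (continuous_compose (@scaled_continuous b r) cw).
pose f r x := F (y (scaled b r x)).
have df r x : derive1 (f ^~ x) r = \sum_i grad i (scaled b r x) * (x ord0 i - b ord0 i).
  by rewrite derive1E; have /@derive_val := scaled_is_derive b x r.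
have intf r : mu.-integrable (cball b rho) (EFin \o f r).
  by apply: continuous_compact_integrable => //; exact: cws.
(* For -1 < r < 2 the dilated ball stays in the box of half-side 2 rho, where the gradient is
   bounded. The interval is an open neighbourhood of [0, 1], so that the derivative exists at both
   ends. *)
have /choice[M HM] : forall i, exists M : R, forall x, box b (2 * rho) x -> `|grad i x| <= M.
  move=> i; have [M _ HM] := continuous_compact_bounded
    (@box_compact R n.*2 b (2 * rho)) (@grad_continuous i).
  by exists M.
pose G : Cn -> R := fun=> \sum_i `|M i| * rho.
have Gb (r : R) (x : Cn) : `]-1, 2[%classic r -> cball b rho x ->
    `|\sum_i grad i (scaled b r x) * (x ord0 i - b ord0 i)| <= G x.
  rewrite /= in_itv/= => /andP[r1 r2] xB; apply: le_trans (ler_norm_sum _ _ _) _.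
  have xb := @cball_sub_box b rho (ltW rho0) x xB.
  apply: ler_sum => i _; rewrite normrM ler_pM//.
  apply: le_trans (ler_norm _); apply: HM => k.
  rewrite !mxE [b ord0 k + _]addrC addrK normrM ler_pM//.
  by rewrite ler_norml; lra.
pose Phi r := Rintegral mu (cball b rho) (f r).
have dPhi (r : R) : `]-1, 2[%classic r -> is_derive r 1 Phi
    (Rintegral mu (cball b rho) (fun x => \sum_i grad i (scaled b r x) * (x ord0 i - b ord0 i))).
  move=> rI; have intG : mu.-integrable (cball b rho) (EFin \o G).
    by apply: continuous_compact_integrable => //; exact: cst_continuous.
  have G0 x : 0 <= G x by apply: sumr_ge0 => i _; rewrite mulr_ge0// ltW.
  have der1 r' x : `]-1, 2[%classic r' -> cball b rho x -> derivable (f ^~ x) r' 1.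
    by move=> _ _; apply: ex_derive; exact: scaled_is_derive.
  have Gub r' x : `]-1, 2[%classic r' -> cball b rho x -> `|partial1of2 f r' x| <= G x.
    by move=> r'I xB; rewrite /partial1of2 df; exact: Gb.
  have d1 := derivable_under_integral mB rI (fun r' _ => intf r') der1 G0 intG Gub.
  apply: DeriveDef => //; rewrite -derive1E.
  rewrite (differentiation_under_integral mB rI (fun r' _ => intf r') der1 G0 intG Gub).
  by apply: eq_Rintegral => x _; rewrite /partial1of2 df.
have I01 (r : R) : r \in `[0, 1] -> `]-1, 2[%classic r.
  by rewrite /= !in_itv/= => /andP[? ?]; lra.
pose phi r := Rintegral mu (cball b rho)
  (fun x => \sum_i grad i (scaled b r x) * (x ord0 i - b ord0 i)).
have dI (r : R) : r \in `]0, 1[ -> is_derive r 1 Phi (phi r).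
  by move=> r01; apply/dPhi/I01/subset_itv_oo_cc.
have cI : {within `[0, 1], continuous Phi}.
  apply: continuous_in_subspaceT => r; rewrite inE => r01.
  exact: is_derive_continuous (dPhi _ (I01 _ r01)).
have [c c01] := @MVT R Phi phi 0 1 ltr01 dI cI.
rewrite subr0 mulr1 => E.
have c0 : 0 <= c by move: c01; rewrite in_itv/= => /andP[/ltW].
have : 0 <= Phi 1 - Phi 0.
  by rewrite E /phi /Rintegral fine_ge0// scaled_integral_ge0.
have fin r : (\int[mu]_(x in cball b rho) (f r x)%:E)%E \is a fin_num.
  exact: integrable_fin_num (intf r).
rewrite subr_ge0 /Phi /Rintegral -lee_fin (fineK (fin 0)) (fineK (fin 1)).
have -> : (\int[mu]_(x in cball b rho) (f 1 x)%:E = \int[mu]_(x in cball b rho) (F (y x))%:E)%E.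
  by apply: eq_integral => x _; rewrite /f /scaled scale1r addrCA subrr addr0.
have -> : (\int[mu]_(x in cball b rho) (f 0 x)%:E = (F (y b))%:E * mu (cball b rho))%E.
  under eq_integral do rewrite /f /scaled scale0r addr0.
  by rewrite integral_cst.
by [].
Qed.

End smooth_radial.

(** * The potential and its integrability *)

Section radial_potential.
Context {R : realType} {N : nat}.
Local Notation rV := 'rV[R]_N.
Local Notation mu := (@lebesgue_rV R N).
Variables (m : nat) (delta : R) (a : rV).
Hypotheses (m0 : (0 < m)%N) (delta0 : 0 < delta).
Implicit Types x : rV.

(** [prof] is real-valued even at 0, where inverse and power take default values, so the pole is put
    in by hand. *)
Definition potential x : \bar R :=
  if x == a then -oo%E else (prof m delta (sqdist a x))%:E.

(** The shift 4^-k is the square of the dyadic radius 2^-k: wherever the shifted argument is below 1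
    it lies in a dyadic interval of index j < k. *)
Definition smoothed (k : nat) x : R := prof m delta (sqdist a x + 4 ^- k).

Let eps0 k : 0 < 4 ^- k :> R.
Proof. by rewrite invr_gt0 exprn_gt0. Qed.

Let arg0 k x : 0 < sqdist a x + 4 ^- k.
Proof. by rewrite ltr_wpDl ?sqdist_ge0. Qed.

Lemma smoothed_continuous k : continuous (smoothed k).
Proof.
exact: (@radial_continuous R N (prof m delta) _ a (eps0 k) (prof_continuous m0)).
Qed.

Lemma smoothed_lt0 k x : smoothed k x < 0.
Proof. exact: (prof_lt0 m0 delta0 (arg0 k x)). Qed.

Lemma smoothed_nonincreasing k l x : (k <= l)%N -> smoothed l x <= smoothed k x.
Proof.
move=> kl; apply: (prof_le m0 delta0 (arg0 l x)).
by rewrite lerD2l lef_pV2 ?posrE ?exprn_gt0// ler_weXn2l// ler1n.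
Qed.

Lemma potential_le_smoothed k x : (potential x <= (smoothed k x)%:E)%E.
Proof.
rewrite /potential; case: eqP => [_|/eqP xa]; first exact: leNye.
rewrite lee_fin; apply: (prof_le m0 delta0 (sqdist_gt0 xa)).
by rewrite lerDl ltW.
Qed.

Lemma potential_lt0 x : (potential x < 0)%E.
Proof. by apply: le_lt_trans (potential_le_smoothed 0 x) _; rewrite lte_fin smoothed_lt0. Qed.

Let eps_cvg : (4 ^- k : R) @[k --> \oo] --> (0 : R).
Proof.
under eq_fun do rewrite -exprVn.
by apply: cvg_expr; rewrite ger0_norm ?invr_ge0// invf_lt1// ltr1n.
Qed.

Lemma smoothed_cvg x : (smoothed k x)%:E @[k --> \oo] --> potential x.
Proof.
rewrite /potential; case: eqP => [->|/eqP xa].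
  apply/cvgeNyPle => A; have [t0 t00 Ht] := prof_diverges m0 delta0 A.
  have : \forall k \near \oo, 4 ^- k < t0.
    by apply: (@cvgr_lt _ _ _ _ _ _ eps_cvg).
  apply: filterS => k kt; rewrite lee_fin ltW// /smoothed sqdistxx add0r.
  by apply: Ht; rewrite eps0.
apply: cvg_EFin; first exact: nearW.
have c : (fun k => sqdist a x + 4 ^- k) @ \oo --> sqdist a x.
  by rewrite -[X in _ --> X]addr0; apply: cvgD eps_cvg; exact: cvg_cst.
exact: (cvg_comp _ _ c (prof_continuous m0 (sqdist_gt0 xa))).
Qed.

Lemma abse_smoothed_le k x : (`|(smoothed k x)%:E| <= `|potential x|)%E.
Proof.
have s0 : ((smoothed k x)%:E <= 0)%E by rewrite lee_fin ltW// smoothed_lt0.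
by rewrite (lee0_abs s0) (lee0_abs (ltW (potential_lt0 x))) leeN2 potential_le_smoothed.
Qed.

Lemma measurable_potential : measurable_fun setT potential.
Proof.
apply: (emeasurable_fun_cvg (fun k x => (smoothed k x)%:E)) => [k|x _].
  by apply/measurable_EFinP; apply: continuous_measurable_rV; exact: smoothed_continuous.
exact: smoothed_cvg.
Qed.

(** The potential is the infimum of the continuous functions [smoothed k]. *)
Lemma potential_usc (Omega : set rV) x : (potential x < +oo)%E /\
  forall c : R, (potential x < c%:E)%E -> \forall y \near x, Omega y -> (potential y < c%:E)%E.
Proof.
split=> [|c xc]; first by apply: lt_trans (potential_lt0 x) _; exact: ltry.
have [k kc] : exists k, smoothed k x < c.
  apply: contrapT => H; move: xc; apply/negP; rewrite -leNgt.
  apply: (cvge_ge _ (@smoothed_cvg x)); apply: nearW => k.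
  by rewrite lee_fin leNgt; apply/negP => kc; apply: H; exists k.
have : \forall y \near x, smoothed k y < c.
  by apply: (@cvgr_lt _ _ _ _ _ _ (@smoothed_continuous k x)).
apply: filterS => y yc _; apply: le_lt_trans (potential_le_smoothed k y) _.
by rewrite lte_fin.
Qed.

End radial_potential.

Lemma sum_inv_square_le {R : realType} k : \sum_(j < k) (j.+1%:R ^+ 2)^-1 <= 2 :> R.
Proof.
(* The stronger bound 2 - 1/k telescopes; for k = 0 it reads 2, because the inverse of 0 is 0. *)
suff : \sum_(j < k) (j.+1%:R ^+ 2)^-1 <= 2 - k%:R^-1 :> R.
  by move/le_trans; apply; rewrite lerBlDr lerDl invr_ge0.
elim: k => [|k IH]; first by rewrite big_ord0 invr0 subr0.
rewrite big_ord_recr/=; case: k IH => [_|k].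
  by rewrite big_ord0 invr1 expr1n invr1; lra.
move: (\sum_(j < _) _) => S IH; apply: le_trans (lerD IH (lexx _)) _.
have k0 : 0 < k.+1%:R :> R by [].
rewrite -[k.+2%:R]natr1 -subr_ge0; move: (k.+1%:R : R) k0 => y y0.
have -> : 2 - (y + 1)^-1 - (2 - y^-1 + ((y + 1) ^+ 2)^-1) = (y * (y + 1) ^+ 2)^-1.
  by field; apply/andP; split; lra.
by rewrite invr_ge0 mulr_ge0 ?sqr_ge0// ltW.
Qed.

Lemma dyadic_bracket {R : realType} k (t : R) : 4 ^- k <= t < 1 ->
  exists2 j : 'I_k, 4 ^- j.+1 <= t & t < 4 ^- j.
Proof.
elim: k => [|k IH] /andP[kt t1]; first by move: kt; rewrite expr0 invr1; lra.
have [tk|kt'] := ltP t (4 ^- k); first by exists ord_max.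
have [|j jt tj] := IH; first by rewrite kt'.
by exists (widen_ord (leqnSn k) j).
Qed.

(** * Integrability of the potential at the exponent nm *)

Section potential_powers.
Context {R : realType} {n : nat}.
Local Notation Cn := (Cspace R n).
Local Notation mu := (@lebesgue_rV R n.*2).
Variables (m : nat) (delta : R) (a : Cn).
Hypotheses (m0 : (0 < m)%N) (n1 : (1 < n)%N) (delta0 : 0 < delta).
Implicit Types x : Cn.

Local Notation potential := (potential m delta a).
Local Notation smoothed := (smoothed m delta a).
Local Notation prof := (prof m delta).

(** Full boxes instead of annuli: their volume is explicit, and the overlaps only enlarge the
    majorant. *)
Let shell j : set Cn := box a (2 ^- j).
Let coef j : R := (- prof (4 ^- j.+1)) ^+ (n * m).

Let prof_le0 (t : R) : 0 < t -> 0 <= - prof t.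
Proof. by move=> t0; rewrite oppr_ge0 ltW// prof_lt0. Qed.

Let coef_ge0 j : 0 <= coef j.
Proof. by rewrite exprn_ge0// prof_le0// invr_gt0 exprn_gt0. Qed.

Let prof_pow_le (s t : R) : 0 < s -> s <= t ->
  (- prof t) ^+ (n * m) <= (- prof s) ^+ (n * m).
Proof.
move=> s0 st; have t0 := lt_le_trans s0 st.
by rewrite lerXn2r ?nnegrE ?prof_le0// lerN2; exact: prof_le.
Qed.

(** If the shifted squared distance t is at least 1 the constant term suffices. Otherwise 4^-(j+1)
    <= t < 4^-j for some j < k; monotonicity bounds the value by [coef j], and |x - a| < 2^-j puts
    [x] in [shell j]. *)
Let smoothed_pow_le k x : (- smoothed k x) ^+ (n * m) <=
  (- prof 1) ^+ (n * m) + \sum_(j < k) coef j * \1_(shell j) x.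
Proof.
have t0 : 0 < 4 ^- k :> R by rewrite invr_gt0 exprn_gt0.
have s0 := sqdist_ge0 a x; set S := \sum_(j < k) _.
have S0 : 0 <= S by apply: sumr_ge0 => j _; rewrite mulr_ge0// indicE.
rewrite /smoothed; have [t1|t1] := leP 1 (sqdist a x + 4 ^- k).
  by rewrite ler_wpDr// prof_pow_le.
have [|j jt tj] := @dyadic_bracket R k (sqdist a x + 4 ^- k); first by rewrite t1 lerDr s0.
apply: le_trans (_ : coef j <= _); first by rewrite prof_pow_le// invr_gt0 exprn_gt0.
rewrite ler_wpDl ?exprn_ge0 ?prof_le0// /S (bigD1 j)//= indicE mem_set ?mulr1.
  by rewrite lerDl sumr_ge0// => i _; rewrite mulr_ge0// indicE.
move=> i; rewrite -(@ler_pXn2r _ 2)// ?nnegrE ?invr_ge0 ?exprn_ge0//.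
have E : (2 ^- j) ^+ 2 = 4 ^- j :> R.
  by rewrite exprVn -exprM mulnC exprM; congr ((_ ^+ _)^-1); ring.
rewrite real_normK ?num_real// E; apply: le_trans (sqdist_coord_le a x i) _; lra.
Qed.

Let shell_measure j : ((coef j)%:E * mu (shell j) <=
  (delta ^+ (n * m) * 4 * 4 ^+ n * 4 ^+ n * (j.+1%:R ^+ 2)^-1)%:E)%E.
Proof.
rewrite lebesgue_rV_box ?invr_ge0 ?exprn_ge0// -EFinM lee_fin.
apply: le_trans (ler_wpM2r _ (prof_upper m0 delta0 j n1)) _.
  by rewrite exprn_ge0// mulrn_wge0// invr_ge0 exprn_ge0.
have -> : (2 ^- j *+ 2) ^+ n.*2 = 4 ^+ n * (4 ^+ (j * n))^-1 :> R.
  have E4 : 4 = 2 ^+ 2 :> R by ring.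
  rewrite -[2 ^- j *+ 2]mulr_natr exprMn exprVn -!exprM E4 -!exprM mulrC.
  by congr (_ ^+ _ * (_ ^+ _)^-1); lia.
rewrite mulSn exprD.
have z : 4 ^+ (j * n) != 0 :> R by rewrite expf_neq0// pnatr_eq0.
have z' : j.+1%:R ^+ 2 != 0 :> R by rewrite expf_neq0// pnatr_eq0.
by rewrite le_eqVlt; apply/orP; left; apply/eqP; field; rewrite z nat1r pnatr_eq0.
Qed.

Let bound (r : R) : R := (- prof 1) ^+ (n * m) * (r *+ 2) ^+ n.*2 +
  delta ^+ (n * m) * 4 * 4 ^+ n * 4 ^+ n * 2.

Let smoothed_pow_integral (r : R) k : 0 < r ->
  (\int[mu]_(x in box a r) ((- smoothed k x) ^+ (n * m))%:E <= (bound r)%:E)%E.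
Proof.
move=> r0; have mB := measurable_box a r.
have mS j : measurable (shell j) by exact: measurable_box.
have mI (D : set Cn) j : measurable_fun D (fun x => ((coef j)%:E * (\1_(shell j) x)%:E)%E).
  under eq_fun do rewrite -EFinM.
  apply/measurable_EFinP; apply: measurable_funM; first exact: measurable_cst.
  exact: measurable_indic.
have I0 j x : (0 <= (coef j)%:E * (\1_(shell j) x)%:E)%E.
  by rewrite -EFinM lee_fin mulr_ge0// indicE.
have c0 : (0 <= ((- prof 1) ^+ (n * m))%:E)%E by rewrite lee_fin exprn_ge0// prof_le0.
apply: (@le_trans _ _ (\int[mu]_(x in box a r) (((- prof 1) ^+ (n * m))%:E +
    \sum_(j < k) ((coef j)%:E * (\1_(shell j) x)%:E)))%E).
  apply: ge0_le_integral => //.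
  - by move=> x _; rewrite lee_fin exprn_ge0// oppr_ge0 (ltW (smoothed_lt0 _ _ _ _ _)).
  - apply/measurable_EFinP; apply: measurable_funX.
    apply: measurable_funTS; apply: continuous_measurable_rV.
    exact: (continuous_opp (@smoothed_continuous R _ m delta a m0 k)).
  - by apply: emeasurable_funD; [exact: measurable_cst|exact: emeasurable_sum].
  - move=> x _; under eq_bigr do rewrite -EFinM.
    by rewrite sumEFin -EFinD lee_fin.
rewrite ge0_integralD//; last 2 first.
  by move=> x _; apply: sume_ge0.
  exact: emeasurable_sum.
rewrite integral_cst// (lebesgue_rV_box _ (ltW r0)) -EFinM /bound EFinD leeD2l//.
rewrite ge0_integral_sum//.
apply: (@le_trans _ _ (\sum_(j < k) ((coef j)%:E * mu (shell j)))%E).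
  apply: lee_sum => j _; rewrite ge0_integralZl_EFin//.
  - apply: lee_wpmul2l; first by rewrite lee_fin.
    by rewrite integral_indic// le_measure ?inE//; exact: measurableI.
  - by apply/measurable_EFinP; exact: measurable_indic.
apply: le_trans; first by apply: lee_sum => j _; exact: shell_measure.
rewrite sumEFin lee_fin -mulr_sumr ler_wpM2l ?sum_inv_square_le//.
by rewrite !mulr_ge0 ?exprn_ge0// ltW.
Qed.

Lemma smoothed_pow_cvg x : ((- smoothed k x) ^+ (n * m))%:E @[k --> \oo] -->
  (`|potential x| `^ (n * m)%:R)%E.
Proof.
have nm0 : (0 < n * m)%N by rewrite muln_gt0 m0 ltnW.
have := @smoothed_cvg R _ m delta a m0 delta0 x; rewrite /potential.
case: eqP => [_ /cvgeNyPle H|/eqP xa /fine_cvgP[_ H]].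
  rewrite poweRyr ?pnatr_eq0 -?lt0n//; apply/cvgeyPge => A.
  apply: filterS (H (- (`|A| + 1))) => k; rewrite !lee_fin lerNr => kA.
  have A1 : 1 <= - smoothed k x by apply: le_trans kA; rewrite lerDr.
  apply: le_trans (ler_eXnr nm0 A1); apply: le_trans kA.
  by rewrite ler_wpDr// ler_norm.
rewrite abse_EFin poweR_EFin powR_mulrn//.
apply: cvg_EFin; first exact: nearW.
rewrite (ltr0_norm (prof_lt0 m0 delta0 (sqdist_gt0 xa))).
apply: (cvg_comp (fun k => - smoothed k x) (fun t => t ^+ (n * m))); last exact: exprn_continuous.
exact: cvgN.
Qed.

(** Monotone convergence, the integrals of the smoothed powers being at most [bound r] for every
    k. *)
Lemma potential_pow_integrable (r : R) : 0 < r ->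
  mu.-integrable (box a r) (fun x => `|potential x| `^ (n * m)%:R)%E.
Proof.
move=> r0; have mB := measurable_box a r.
have mg k : measurable_fun (box a r) (fun x => ((- smoothed k x) ^+ (n * m))%:E).
  apply/measurable_EFinP; apply: measurable_funX.
  apply: measurable_funTS; apply: continuous_measurable_rV.
  exact: (continuous_opp (@smoothed_continuous R _ m delta a m0 k)).
have g0 k x : (0 <= ((- smoothed k x) ^+ (n * m))%:E)%E.
  by rewrite lee_fin exprn_ge0// oppr_ge0 (ltW (smoothed_lt0 _ _ _ _ _)).
apply/integrableP; split.
  apply: (emeasurable_fun_cvg _ _ mg) => x _; exact: smoothed_pow_cvg.
have hom x : {homo (fun k => ((- smoothed k x) ^+ (n * m))%:E) : k l / (k <= l)%N >-> (k <= l)%E}.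
  move=> k l kl; have s0 i := ltW (smoothed_lt0 a m0 delta0 i x).
  rewrite lee_fin lerXn2r ?nnegrE ?oppr_ge0//.
  by rewrite lerN2; exact: smoothed_nonincreasing.
have H := cvg_monotone_convergence mB mg (fun k x _ => g0 k x) (fun x _ => hom x).
apply: (@le_lt_trans _ _ ((bound r)%:E)); last exact: ltry.
have -> : (\int[mu]_(x in box a r) `| `|potential x| `^ (n * m)%:R | =
   \int[mu]_(x in box a r) limn (fun k => ((- smoothed k x) ^+ (n * m))%:E))%E.
  apply: eq_integral => x _; rewrite gee0_abs ?poweR_ge0//.
  by apply/esym/cvg_lim => //; exact: smoothed_pow_cvg.
apply: (cvge_le _ (H mu)); apply: nearW => k; exact: smoothed_pow_integral.
Qed.

End potential_powers.

Lemma nbhs_box {R : realType} {N : nat} (a : 'rV[R]_N) (U : set 'rV[R]_N) :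
  nbhs a U -> exists2 r : R, 0 < r & box a r `<=` U.
Proof.
move=> /nbhs_ballP[e /= e0 eU]; exists (e / 2) => [|x xr]; first by rewrite divr_gt0.
apply: eU; split=> // i k; rewrite (ord1 i) /ball/= distrC.
by apply: le_lt_trans (xr k) _; lra.
Qed.

Lemma box_nbhs {R : realType} {N : nat} (a : 'rV[R]_N) (r : R) : 0 < r -> nbhs a (box a r).
Proof.
move=> r0; apply/nbhs_ballP; exists r => // x [_ xr] i.
by have := xr ord0 i; rewrite /ball/= distrC => /ltW.
Qed.

(** * Divergence beyond the exponent nm *)

Section potential_nonintegrable.
Context {R : realType} {n : nat}.
Local Notation Cn := (Cspace R n).
Local Notation mu := (@lebesgue_rV R n.*2).
Variables (m : nat) (delta : R) (a : Cn).
Hypotheses (m0 : (0 < m)%N) (n0 : (0 < n)%N) (delta0 : 0 < delta).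

Local Notation potential := (potential m delta a).
Local Notation prof := (prof m delta).

Let potential_box (r : R) x : 0 < r -> box a r x ->
  (potential x <= (prof (n.*2%:R * r ^+ 2))%:E)%E.
Proof.
move=> r0 xr; rewrite /potential; case: eqP => [_|/eqP xa]; first exact: leNye.
rewrite lee_fin; apply: (prof_le m0 delta0 (sqdist_gt0 xa)).
exact: sqdist_box_le.
Qed.

(** With n/p < kappa < 1/m, the profile is at most -c t^(-kappa). On a box of volume comparable to
    t^n this makes the integral of |u|^p at least C t^(n - kappa p), whose exponent -eta is
    negative; letting t tend to 0 contradicts finiteness. *)
Lemma potential_pow_not_integrable (U : set Cn) (p : R) : open U -> U a ->
  (n * m)%:R < p -> ~ mu.-integrable U (fun x => `|potential x| `^ p)%E.
Proof.
move=> oU Ua pnm intU; have mU := open_measurable_rV oU.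
have p0 : 0 < p by exact: le_lt_trans pnm.
have mR0 : 0 < m%:R :> R by rewrite ltr0n.
have nR0 : 0 < n%:R :> R by rewrite ltr0n.
have n2R0 : 0 < n.*2%:R :> R by rewrite ltr0n double_gt0.
pose kappa : R := (n%:R / p + m%:R^-1) / 2.
have np : n%:R / p < m%:R^-1.
  by rewrite ltr_pdivrMr// mulrC ltr_pdivlMr// -natrM.
have km : kappa < m%:R^-1 by rewrite /kappa; lra.
have kp : n%:R / p < kappa by rewrite /kappa; lra.
have k0 : 0 < kappa by apply: lt_trans kp; rewrite divr_gt0.
pose eta := kappa * p - n%:R.
have eta0 : 0 < eta by rewrite subr_gt0 -ltr_pdivrMr.
have [c c0 Hc] := prof_lower m0 delta0 km.
have [r1 r10 boxU] : exists2 r : R, 0 < r & box a r `<=` U.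
  by apply: nbhs_box; exact: open_nbhs_nbhs.
pose J := fine (\int[mu]_(x in U) (`|potential x| `^ p))%E.
have JE : (\int[mu]_(x in U) (`|potential x| `^ p) = J%:E)%E.
  by rewrite fineK//; exact: integrable_fin_num.
pose C := c `^ p * (2 / n%:R) ^+ n.
have C0 : 0 < C by rewrite mulr_gt0 ?powR_gt0// exprn_gt0// divr_gt0.
have lower (t : R) : 0 < t -> t <= 1 -> t <= n.*2%:R * r1 ^+ 2 -> C * t `^ (- eta) <= J.
  (* The half-side r satisfies 2n r^2 = t, the largest squared distance to [a] in the box, so the
     potential is at most f(t) there. *)
  move=> t0 t1 tr1; pose r := Num.sqrt (t / n.*2%:R).
  have tn0 : 0 < t / n.*2%:R by rewrite divr_gt0.
  have r0 : 0 < r by rewrite sqrtr_gt0.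
  have r2 : r ^+ 2 = t / n.*2%:R by rewrite sqr_sqrtr// ltW.
  have tE : n.*2%:R * r ^+ 2 = t by rewrite r2 mulrC divfK// gt_eqF.
  have rr1 : r <= r1.
    rewrite -(@ler_pXn2r _ 2)// ?nnegrE ?(ltW r0) ?(ltW r10)//.
    by rewrite -(ler_pM2l n2R0) tE.
  have brU : box a r `<=` U.
    by move=> x xr; apply: boxU => i; exact: le_trans (xr i) rr1.
  have mB := measurable_box a r.
  pose h := (c * t `^ (- kappa)) `^ p.
  have vol : (r *+ 2) ^+ n.*2 = (2 / n%:R) ^+ n * t ^+ n.
    rewrite -muln2 mulnC exprM -exprMn; congr (_ ^+ _).
    rewrite -[r *+ 2]mulr_natr exprMn r2 -mul2n natrM; field.
    by rewrite gt_eqF.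
  have hE : h * (r *+ 2) ^+ n.*2 = C * t `^ (- eta).
    rewrite /h powRM ?powR_ge0 ?(ltW c0)// -powRrM vol mulrACA; congr (_ * _).
    rewrite -powR_mulrn ?(ltW t0)// -powRD; last by rewrite (gt_eqF t0) implybT.
    by congr (_ `^ _); rewrite /eta; ring.
  rewrite -hE -lee_fin -JE EFinM -(lebesgue_rV_box a (ltW r0)) -integral_cst//.
  apply: le_trans (_ : (\int[mu]_(x in box a r) (`|potential x| `^ p) <= _)%E); last first.
    apply: ge0_subset_integral => //; first by case/integrableP: intU.
    by move=> x _; exact: poweR_ge0.
  apply: ge0_le_integral => //.
  - by move=> x _; rewrite lee_fin powR_ge0.
  - by case/integrableP: (integrableS mU mB brU intU).
  move=> x xr; rewrite /= /h -poweR_EFin.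
  have H1 : (potential x <= (prof t)%:E)%E by rewrite -tE; exact: potential_box.
  have H2 : c * t `^ (- kappa) <= - prof t by apply: Hc; rewrite t0 t1.
  have h0 : 0 <= c * t `^ (- kappa) by rewrite mulr_ge0 ?powR_ge0// ltW.
  apply: gt0_ler_poweR; rewrite ?in_itv/= ?andbT ?lee_fin ?leey ?andbT//; first exact: ltW.
  rewrite lee0_abs; last by rewrite ltW// potential_lt0.
  by rewrite leeNr -EFinN; apply: le_trans H1 _; rewrite lee_fin lerNr.
have J0 : 0 <= J by rewrite fine_ge0// integral_ge0// => x _; exact: poweR_ge0.
pose M := J / C + 1.
have M0 : 0 < M by rewrite ltr_wpDl// divr_ge0// ltW.
(* Small enough for the profile bound, for the box to fit in [U], and for t^(-eta) to exceed J /
   C. *)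
pose t := Num.min (Num.min 1 (n.*2%:R * r1 ^+ 2)) (M `^ (- eta^-1)).
have t0 : 0 < t by rewrite !lt_min ltr01 mulr_gt0 ?exprn_gt0// powR_gt0.
have t1 : t <= 1 by rewrite !ge_min lexx.
have tr1 : t <= n.*2%:R * r1 ^+ 2 by rewrite !ge_min lexx orbT.
have tM : t <= M `^ (- eta^-1) by rewrite !ge_min lexx orbT.
have MtE : M <= t `^ (- eta).
  rewrite powRN -[M]invrK lef_pV2 ?posrE ?invr_gt0 ?powR_gt0//.
  have -> : M^-1 = (M `^ (- eta^-1)) `^ eta.
    by rewrite -powRrM mulNr mulVf ?gt_eqF// powRN powRr1// ltW.
  by apply: ge0_ler_powR; rewrite ?nnegrE ?powR_ge0 ?(ltW eta0) ?(ltW t0).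
have := le_trans (ler_wpM2l (ltW C0) MtE) (lower t t0 t1 tr1).
by rewrite /M mulrDr mulr1 mulrC divfK ?gt_eqF// gerDl leNgt C0.
Qed.

End potential_nonintegrable.

Lemma continuous_sum {R : realType} (T : topologicalType) (I : finType) (f : I -> T -> R) :
  (forall i, continuous (f i)) -> continuous (fun x => \sum_i f i x).
Proof.
move=> cf x; rewrite (_ : (fun x => _) = \sum_i f i); last by apply/funext => y; rewrite fct_sumE.
by apply: (big_ind (fun g : T -> R => {for x, continuous g})) => [|g h|i _];
  [exact: cst_continuous|exact: continuousD|exact: cf].
Qed.

(** * The potential is m-subharmonic *)

Section potential_SH.
Context {R : realType} {n : nat}.
Local Notation Cn := (Cspace R n).
Local Notation mu := (@lebesgue_rV R n.*2).
Variables (m : nat) (delta : R) (a : Cn).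
Hypotheses (m0 : (0 < m)%N) (mn : (m < n)%N) (delta0 : 0 < delta).
Implicit Types x : Cn.

Local Notation potential := (potential m delta a).
Local Notation smoothed := (smoothed m delta a).
Local Notation prof := (prof m delta).
Local Notation prof1 := (prof1 m delta).
Local Notation prof2 := (prof2 m delta).
Local Notation y k x := (sqdist a x + 4 ^- k).

Let n1 : (1 < n)%N. Proof. exact: leq_ltn_trans mn. Qed.

Let eps0 k : 0 < 4 ^- k :> R.
Proof. by rewrite invr_gt0 exprn_gt0. Qed.

Let arg0 k x : 0 < y k x.
Proof. by rewrite ltr_wpDl ?sqdist_ge0. Qed.

(** Since nm >= 1, |u| <= 1 + |u|^(nm), and the right-hand side is integrable on boxes. *)
Lemma potential_compact_integrable (K : set Cn) : compact K -> mu.-integrable K potential.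
Proof.
move=> cK; have [r r0 Kr] := compact_sub_box a cK.
have mB := measurable_box a r.
apply: (@integrableS _ _ _ mu (box a r)) => //; first exact: compact_measurable_rV.
have nm0 : (0 < n * m)%N by rewrite muln_gt0 m0 ltnW.
have i1 : mu.-integrable (box a r) (cst 1%E).
  exact: continuous_compact_integrable (@box_compact R n.*2 a r) (@cst_continuous _ _ (1 : R)).
apply: (le_integrable mB _ _ (integrableD mB i1 (potential_pow_integrable a m0 n1 delta0 r0))).
  by apply: measurable_funTS; exact: measurable_potential.
move=> x _; rewrite [leRHS]gee0_abs ?adde_ge0 ?poweR_ge0//.
have nm1 : (n * m)%:R != 0 :> R by rewrite pnatr_eq0 -lt0n.
case: (potential x) => [t||]; last 2 first.
- by rewrite (_ : `|+oo| = +oo)%E// (poweRyr nm1) leey.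
- by rewrite (_ : `|-oo| = +oo)%E// (poweRyr nm1) leey.
rewrite abse_EFin poweR_EFin powR_mulrn// -EFinD lee_fin; have [t1|t1] := leP `|t| 1.
  by rewrite ler_wpDr// exprn_ge0.
by rewrite ler_wpDl// ler_eXnr// ltW.
Qed.

(** The profile inequality times m reads m t f'' + (m + 1) f' >= 0, and m + 1 <= n with f' >= 0. The
    profile is evaluated at t = |x - a|^2 + 4^-k but f'' is multiplied by |x - a|^2 <= t only, which
    helps when f'' < 0. *)
Let qform_ge0 k x : 0 <= n%:R * prof1 (y k x) + m%:R * (prof2 (y k x) * sqdist a x).
Proof.
set t := y k x; have t0 : 0 < t := arg0 k x.
have p1 := prof1_ge0 m0 delta0 t0; have p2 := prof2_ge m0 delta0 t0.
have s0 := sqdist_ge0 a x.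
have st : sqdist a x <= t by rewrite lerDl ltW.
have mR0 : 0 < m%:R :> R by rewrite ltr0n.
have p2' : 0 <= m%:R * (t * prof2 t) + (m%:R + 1) * prof1 t.
  have -> : m%:R * (t * prof2 t) + (m%:R + 1) * prof1 t =
     m%:R * (t * prof2 t + (1 + m%:R^-1) * prof1 t) by field; rewrite gt_eqF.
  by rewrite mulr_ge0// ltW.
have nm : m%:R + 1 <= n%:R :> R by rewrite natr1 ler_nat.
move: (sqdist a x) s0 st => S S0 St; move: (prof1 t) (prof2 t) p1 p2' => f g f0 H.
have H2 : 0 <= n%:R * f + m%:R * (t * g) by nra.
have [g0|g0] := leP 0 g; first by rewrite addr_ge0 ?mulr_ge0// ltW.
apply: le_trans H2 _; rewrite lerD2l ler_pM2l//; nra.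
Qed.

Let lap_ge0 k x : 0 <= \sum_i radial_hessian prof1 prof2 (4 ^- k) a x i i.
Proof.
rewrite /radial_hessian; under eq_bigr do rewrite eqxx mulr1 -expr2.
rewrite big_split/= sumr_const card_ord -mulr_sumr.
have -> : \sum_i (x - a) ord0 i ^+ 2 = sqdist a x.
  by apply: eq_bigr => i _; rewrite !mxE.
have := qform_ge0 k x; have := prof1_ge0 m0 delta0 (arg0 k x).
have nm : m%:R <= n%:R :> R by rewrite ler_nat ltnW.
have m1 : 1 <= m%:R :> R by rewrite ler1n.
have E (z : R) : z *+ n.*2 = 2 * (n%:R * z) by rewrite -[LHS]mulr_natr -muln2 natrM; ring.
rewrite E.
move: (prof1 _) (prof2 _) => f g; move: (sqdist a x) => S f0 H.
(* The Laplacian is 4 (n f' + f'' |x - a|^2); multiplying the bracket by m gives at least the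
   quantity of [qform_ge0], because m >= 1 and f' >= 0. *)
suff : 0 <= m%:R * (n%:R * f + g * S).
  by rewrite pmulr_rge0; [lra|lra].
have : n%:R * f <= m%:R * (n%:R * f) by rewrite ler_peMl// mulr_ge0// (le_trans _ nm)// (le_trans _ m1).
lra.
Qed.

Lemma potential_submean b rho : 0 < rho ->
  (potential b * mu (cball b rho) <= \int[mu]_(x in cball b rho) potential x)%E.
Proof.
move=> rho0; have cB := @cball_compact R n b rho (ltW rho0).
have mB := compact_measurable_rV cB.
have ms k : measurable_fun (cball b rho) (fun x => (smoothed k x)%:E).
  apply/measurable_EFinP; apply: measurable_funTS; apply: continuous_measurable_rV.
  exact: smoothed_continuous.
have [_ _ H] := dominated_convergence mB ms
  (measurable_funTS (measurable_potential a m0 delta0))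
  (aeW _ (fun x _ => @smoothed_cvg R _ m delta a m0 delta0 x))
  (integrable_abse (potential_compact_integrable cB))
  (aeW _ (fun x k _ => abse_smoothed_le a m0 delta0 k x)).
apply: (cvge_ge _ H); apply: nearW => k.
apply: le_trans (_ : (smoothed k b)%:E * mu (cball b rho) <= _)%E.
  by apply: lee_wpmul2r => //; exact: potential_le_smoothed.
exact: (@radial_submean R n prof prof1 prof2 (4 ^- k) a (eps0 k)
  (prof_is_derive delta m0) (prof1_is_derive delta m0) (prof2_continuous m0)
  (lap_ge0 k) b rho rho0).
Qed.

Let weak_limit (K : set Cn) (psi : Cn -> R) : compact K -> continuous psi ->
  (forall k, (0 <= \int[mu]_(x in K) (smoothed k x * psi x)%:E)%E) ->
  (0 <= \int[mu]_(x in K) (potential x * (psi x)%:E))%E.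
Proof.
move=> cK cpsi pos; have mK := compact_measurable_rV cK.
have [C C0 HC] := continuous_compact_bounded cK cpsi.
have mpsi : measurable_fun K psi.
  by apply: measurable_funTS; exact: continuous_measurable_rV.
have ms k : measurable_fun K (fun x => (smoothed k x * psi x)%:E).
  apply/measurable_EFinP; apply: measurable_funM => //.
  by apply: measurable_funTS; apply: continuous_measurable_rV; exact: smoothed_continuous.
have mf : measurable_fun K (fun x => (potential x * (psi x)%:E)%E).
  apply: emeasurable_funM; last exact/measurable_EFinP.
  by apply: measurable_funTS; exact: measurable_potential.
have cvg x : K x -> (smoothed k x * psi x)%:E @[k --> \oo] --> (potential x * (psi x)%:E)%E.
  by move=> _; under eq_fun do rewrite EFinM; apply: cvgeZr => //; exact: smoothed_cvg.
have ig := integrableZl mK C (integrable_abse (potential_compact_integrable cK)).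
have ub x k : K x -> (`|(smoothed k x * psi x)%:E| <= C%:E * `|potential x|)%E.
  move=> Kx; rewrite EFinM abseM muleC; apply: lee_pmul => //.
    by rewrite abse_EFin lee_fin; exact: HC.
  exact: abse_smoothed_le.
have [_ _ H] := dominated_convergence mK ms mf (aeW _ cvg) ig (aeW _ (fun x k => ub x k)).
by apply: (cvge_ge _ H); apply: nearW => k; exact: pos.
Qed.

Let integral_support (D E : set Cn) (f : Cn -> \bar R) :
  (forall x, D x -> ~ E x -> f x = 0%E) -> (forall x, E x -> ~ D x -> f x = 0%E) ->
  (\int[mu]_(x in D) f x = \int[mu]_(x in E) f x)%E.
Proof.
move=> f1 f2; rewrite integral_mkcond [RHS]integral_mkcond.
apply: eq_integral => x _; rewrite !patchE.
case: ifPn => [|/negP]; rewrite in_setE => Dx; case: ifPn => [|/negP]; rewrite in_setE => Ex //.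
  exact: f1.
by rewrite f2.
Qed.

Lemma potential_ddc_wedge_ge0 (Omega : set Cn) (alpha : 'I_m.-1 -> cform R n) :
  (forall j, m_positive m (alpha j)) -> ddc_wedge_ge0 Omega potential
    (wedge (\big[wedge/form1]_(j < m.-1) alpha j) (wedge_exp beta (n - m))).
Proof.
move=> alpha0; set theta := wedge _ _ => phi [sphi cK KO] phi0.
set K := closure _ in cK KO.
pose psi x := top_re theta (fun i k => partial i (partial k phi) x).
have psi0 x : ~ K x -> psi x = 0.
  move=> Kx; rewrite /psi top_re_lin big1// => i _; rewrite big1// => k _.
  by rewrite partial_eq0 ?mul0r// => /closure_partial.
have cpsi : continuous psi.
  rewrite /psi; under eq_fun do rewrite top_re_lin.
  apply: continuous_sum => i; apply: continuous_sum => k.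
  apply: continuous_mul; last exact: cst_continuous.
  by apply: smooth_continuous; do 2! apply: smooth_partial.
under eq_integral do rewrite top_re_ddc -/(psi _).
rewrite (@integral_support _ K); last 2 first.
- by move=> x _ /psi0 ->; rewrite mule0.
- by move=> x /KO.
apply: weak_limit => // k; have [r r0 Kr] := compact_sub_box 0 cK.
(* The support can meet a line in any compact set, whereas a strictly larger box has segments as
   slices, with the test function zero at their ends. *)
rewrite (@integral_support _ (box 0 (r + 1))); last 2 first.
- move=> x /Kr xr; case => i; apply: le_trans (xr i) _; lra.
- by move=> x _ /psi0 ->; rewrite mulr0.
have r1 : r < r + 1 by rewrite ltrDl.
have r2 : 0 <= r + 1 by rewrite ltW// ltr_wpDr.
rewrite (@radial_top_re_integral R n prof prof1 prof2 (4 ^- k) a (eps0 k)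
  (prof_is_derive delta m0) (prof1_is_derive delta m0) (prof2_continuous m0)
  theta phi r (r + 1) sphi r1 r2 Kr).
apply: integral_ge0 => x _; rewrite lee_fin mulr_ge0//.
apply: (@top_re_radial_ge0 R n m alpha (prof1 (y k x)) (prof2 (y k x)) (x - a)) => //.
  exact: prof1_ge0.
have -> : sqnorm (x - a) = sqdist a x by apply: eq_bigr => i _; rewrite !mxE.
exact: qform_ge0.
Qed.

Lemma potential_SH (Omega : set Cn) : open Omega -> SH m Omega potential.
Proof.
move=> oO; split.
- split; first by apply: measurable_funTS; exact: measurable_potential.
  by move=> K cK _; exact: potential_compact_integrable.
- split=> [x _|b rho rho0 _]; first exact: potential_usc.
  exact: potential_submean.
- by move=> alpha; exact: potential_ddc_wedge_ge0.
Qed.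

End potential_SH.

(** * Integrability exponents and their semicontinuity *)

Section integrability_exponents.
Context {R : realType} {n : nat}.
Local Notation Cn := (Cspace R n).
Local Notation mu := (@lebesgue_rV R n.*2).
Implicit Types (Omega : set Cn) (a : Cn).

(** An open set [U] witnessing an exponent at [x] witnesses it at every point of [U]. *)
Lemma iota_at_lsc Omega u : lsc_on Omega (fun x => nbhs x) (iota_at Omega u).
Proof.
move=> x _ c /ereal_sup_gt[_ [p [p0 [U [oU xU cU UO iU]]] <-]] cp.
apply: filterS (open_nbhs_nbhs (conj oU (xU x erefl))) => y Uy _.
apply: lt_le_trans cp _; apply: ereal_sup_ubound; exists p => //; split=> //.
by exists U; split=> // _ ->.
Qed.

Lemma I_set_box Omega u a p : open Omega -> Omega a -> 0 < p ->
  (forall r, 0 < r -> mu.-integrable (box a r) (fun x => `|u x| `^ p)%E) ->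
  I_set Omega u [set a] p.
Proof.
move=> oO Oa p0 iu; split=> //.
have [r r0 rO] : exists2 r : R, 0 < r & box a r `<=` Omega.
  by apply: nbhs_box; exact: open_nbhs_nbhs.
have cB := @box_compact R n.*2 a r.
have clB : closure (box a r)^° `<=` box a r.
  have /closure_id {2}-> : closed (box a r).
    by apply: compact_closed cB; exact: norm_hausdorff.
  by apply: closure_subset; exact: interior_subset.
exists (box a r)^°; split.
- exact: open_interior.
- by move=> _ ->; exact: box_nbhs.
- by apply: subclosed_compact clB => //; exact: closed_closure.
- exact: subset_trans rO.
- apply: integrableS (iu r r0) => //.
  + exact: measurable_box.
  + by apply: open_measurable_rV; exact: open_interior.
  + exact: interior_subset.
Qed.

Lemma L1loc_cst0 Omega : open Omega -> L1loc Omega (cst 0%E).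
Proof.
move=> oO; split; first exact: measurable_cst.
by move=> K cK _; apply: integrable0; exact: compact_measurable_rV.
Qed.

Lemma SH_cst0 m Omega : open Omega -> SH m Omega (cst 0%E).
Proof.
move=> oO; split; first exact: L1loc_cst0.
- split=> [x _|b r _ _]; last by rewrite mul0e integral0.
  split=> [|c c0]; first exact: ltry.
  by apply: (filterE (nbhs_filter x)) => y _; exact: c0.
- move=> alpha _ phi _ _; rewrite integral0_eq// => x _.
  by rewrite mul0e.
Qed.

Lemma iota_at_cst0 Omega a : open Omega -> Omega a -> iota_at Omega (cst 0%E) a = +oo%E.
Proof.
move=> oO Oa; apply/eqP; rewrite -leye_eq leNgt; apply/negP => H.
have [c cE] : exists c : R, (iota_at Omega (cst 0%E) a <= c%:E)%E.
  by move: H; case: (iota_at _ _ _) => [t||]//= _; [exists t|exists 0; rewrite leNye].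
have c0 : 0 < `|c| + 1 by rewrite ltr_wpDl.
have : I_set Omega (cst 0%E) [set a] (`|c| + 1).
  apply: I_set_box => //.
  move=> r r0; apply: (eq_integrable _ (cst 0%E)); first exact: measurable_box.
    by move=> x _; rewrite /cst abse0 poweR0r// gt_eqF.
  by apply: integrable0; exact: measurable_box.
move=> Ic; have : ((`|c| + 1)%:E <= c%:E)%E.
  by apply: le_trans cE; apply: ereal_sup_ubound; exists (`|c| + 1).
by rewrite lee_fin leNgt ltr_pwDr// ler_norm.
Qed.

Lemma iota_at_potential_le m Omega a (delta : R) : (0 < m)%N -> (0 < n)%N -> 0 < delta ->
  (iota_at Omega (potential m delta a) a <= (n * m)%:R%:E)%E.
Proof.
move=> m0 n0 d0; apply: ge_ereal_sup => _ [p [p0 [U [oU aU _ _ iU]]] <-].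
rewrite lee_fin leNgt; apply/negP => pnm.
exact: (potential_pow_not_integrable m0 n0 d0 oU (aU a erefl) pnm iU).
Qed.

Lemma potential_scale m a (delta : R) x : 0 < delta ->
  potential m delta a x = (delta%:E * potential m 1 a x)%E.
Proof.
move=> d0; rewrite /potential; case: eqP => _; first by rewrite gt0_muleNy.
by rewrite -EFinM /prof; congr (_%:E); rewrite mul1r mulrN.
Qed.

(** Semicontinuity fails at the zero function at the level nm. The potential is linear in delta, so
    delta = e / (J + 1) brings it into any given L^1 neighbourhood while its exponent stays at most
    nm. The class [D] is a parameter in order to cover both L^1_loc and the m-subharmonic
    functions. *)
Lemma iota_at_not_lsc m Omega a D : (0 < m)%N -> (m < n)%N -> open Omega -> Omega a ->
  D (cst 0%E) -> (forall delta : R, 0 < delta -> D (potential m delta a)) ->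
  ~ lsc_on D (L1loc_nbhs Omega) (fun u => iota_at Omega u a).
Proof.
move=> m0 mn oO Oa D0 Dp /(_ _ D0 (n * m)%:R); rewrite iota_at_cst0// => /(_ (ltry _)).
move=> -[[K e] [cK KO e0] sub]; rewrite /fst /snd in cK KO e0 sub.
have mK := compact_measurable_rV cK.
have i1 := integrable_abse (potential_compact_integrable a m0 mn ltr01 cK).
pose J := fine (\int[mu]_(x in K) `|potential m 1 a x|)%E.
have JE : (\int[mu]_(x in K) `|potential m 1 a x| = J%:E)%E.
  by rewrite fineK//; exact: integrable_fin_num.
have J0 : 0 <= J by rewrite fine_ge0// integral_ge0.
pose delta := e / (J + 1); have d0 : 0 < delta by rewrite divr_gt0// ltr_wpDl.
have dE : (`|delta%:E| = delta%:E)%E by rewrite gee0_abs// lee_fin ltW.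
have /sub/(_ (Dp _ d0)) : (\int[mu]_(x in K) `|potential m delta a x - 0| < e%:E)%E.
  under eq_integral => x _ do rewrite sube0 (potential_scale _ _ _ d0) abseM dE.
  rewrite ge0_integralZl_EFin//; last 2 first.
  - by case/integrableP: i1.
  - exact: ltW.
  rewrite JE -EFinM lte_fin /delta -mulrA gtr_pMr// mulrC ltr_pdivrMr ?mul1r ?ltrDl//.
  by rewrite ltr_wpDl.
by rewrite ltNge iota_at_potential_le// (leq_ltn_trans (leq0n m)).
Qed.

Lemma connected_setT_rV : connected [set: Cn].
Proof.
have -> : [set: Cn] = \bigcup_(x in setT) ((fun t : R => t *: x) @` `[0, 1]).
  apply/seteqP; split=> // x _; exists x => //; exists 1; last exact: scale1r.
  by rewrite /= in_itv/= ler01 lexx.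
apply: bigcup_connected => [|x _].
  by exists 0 => x _; exists 0; [rewrite /= in_itv/= ler01 lexx|exact: scale0r].
apply: connected_continuous_connected; first exact: segment_connected.
by apply: continuous_subspaceT => t; exact: scalel_continuous.
Qed.

End integrability_exponents.

Theorem theorem8p3 (R : realType) (m n : nat) (m_gt0 : (1 <= m)%N)
    (m_lt_n : (m < n)%N) :
  (forall Omega : set (Cspace R n), is_domain Omega ->
    (forall u : Cspace R n -> \bar R, L1loc Omega u ->
       lsc_on Omega (fun x => nbhs x) (iota_at Omega u)) /\
    (forall a : Cspace R n, Omega a ->
       ~ lsc_on (L1loc Omega) (L1loc_nbhs Omega) (fun u => iota_at Omega u a) /\
       ~ lsc_on (SH m Omega) (L1loc_nbhs Omega) (fun u => iota_at Omega u a))) /\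
  (exists (Omega : set (Cspace R n)) (u : Cspace R n -> \bar R)
          (a : Cspace R n),
     [/\ is_domain Omega, SH m Omega u, Omega a & ~ open (I_set Omega u [set a])]).
Proof.
have n1 : (1 < n)%N by exact: leq_ltn_trans m_lt_n.
split.
  move=> Omega [oO _ _]; split=> [u _|a Oa]; first exact: iota_at_lsc.
  have pSH (delta : R) (d0 : 0 < delta) := potential_SH a m_gt0 m_lt_n d0 oO.
  split; apply: (iota_at_not_lsc m_gt0 m_lt_n oO Oa).
  - exact: L1loc_cst0.
  - by move=> delta /pSH[].
  - exact: SH_cst0.
  - exact: pSH.
pose a : Cspace R n := 0; exists setT, (potential m 1 a), a; split.
- by split; [exact: openT|exact: connected_setT_rV|exists 0].
- exact: (potential_SH a m_gt0 m_lt_n ltr01 openT).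
- by [].
move=> oI; have : I_set setT (potential m 1 a) [set a] (n * m)%:R.
  apply: I_set_box => //; first exact: openT.
    by rewrite ltr0n muln_gt0 m_gt0 ltnW.
  by move=> r; exact: potential_pow_integrable.
move=> Ip; have /nbhs_ballP[e /= e0 sub] := open_nbhs_nbhs (conj oI Ip).
have [p0 [U [oU aU _ _ iU]]] : I_set setT (potential m 1 a) [set a] ((n * m)%:R + e / 2).
  by apply: sub; rewrite /ball/= opprD addNKr normrN ger0_norm; lra.
apply: (potential_pow_not_integrable m_gt0 (ltnW n1) ltr01 oU (aU a erefl) _ iU).
by rewrite ltrDl divr_gt0.
Qed.
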